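(* Let $(M,\mathcal{O})\simeq(M,\bigwedge\mathcal{G})$ be a (holomorphic) split supermanifold and $\mathcal{T}=\mathcal{D}er\,\mathcal O$ its tangent sheaf. The following conditions are equivalent: (1) the sheaf $\mathcal{T}$ corresponds to the unit 1-cohomology class with values in $\mathcal{A}ut^{\mathcal{O}}_{(1)}\mathrm{gr}\,\mathcal{T}$ under the classification of locally free sheaves of $\mathcal O$-modules with given retract by non-abelian cohomology; (2) the exact sequence $$0\to\mathcal{G}\otimes\mathcal{G}^*\stackrel{\delta}{\longrightarrow}\mathcal{T}_0\stackrel{\gamma}{\longrightarrow}\Theta\to0$$ of sheaves of $\mathcal F$-modules splits; (3) $\mathcal{G}$ possesses a (holomorphic) connection.
   Context: Here $(M,\mathcal F)$ is the underlying complex manifold, $\mathcal G$ is a locally free sheaf of $\mathcal F$-modules of finite rank (the sheaf of holomorphic sections of a vector bundle $\mathbb G\to M$), $\mathcal O=\bigwedge_{\mathcal F}\mathcal G=\bigoplus_q\mathcal O_q$, $\mathcal O_q=\bigwedge^q\mathcal G$, with $\mathbb Z_2$-grading the reduction mod 2 of the $\mathbb Z$-grading, and $\mathcal J\subset\mathcal O$ is the ideal generated by $\mathcal O_{\bar1}$; $\mathcal O$ is identified with $\mathrm{gr}\,\mathcal O=\bigoplus_p\mathcal J^p/\mathcal J^{p+1}$. The tangent sheaf $\mathcal T$ is the $\mathbb Z_2$-graded sheaf of (super)derivations of $\mathcal O$ over $\mathbb C$; it is a locally free sheaf of $\mathcal O$-modules. For $p\ge-1$, $\mathcal T_p=\{v\in\mathcal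 T\mid v(\mathcal O_q)\subset\mathcal O_{p+q}\ \text{for all }q\ge0\}$, and $\mathcal T=\bigoplus_{p\ge-1}\mathcal T_p$. $\Theta$ is the tangent sheaf of $M$. The map $\gamma$ restricts a derivation of degree $0$ to $\mathcal F\subset\mathcal O$; the map $\delta$ sends a sheaf homomorphism $\mathcal G\to\mathcal G$ to the corresponding derivation of degree $0$ that is zero on $\mathcal F$. Retract and corresponding class: $\mathcal T_{(p)}=\mathcal J^p\mathcal T$ and $\mathrm{gr}\,\mathcal T=\bigoplus_{p\ge0}\mathcal T_{(p)}/\mathcal T_{(p+1)}\simeq\mathcal O\otimes_{\mathcal F}(\mathcal T/\mathcal J\mathcal T)$, a locally free $\mathcal O$-module. $\mathcal Aut^{\mathcal O}_{(1)}\mathrm{gr}\,\mathcal T$ is the sheaf of groups of $\mathcal O$-linear parity-preserving automorphisms $a$ of $\mathrm{gr}\,\mathcal T$ with $a(v)\equiv v\bmod\mathcal J\,\mathrm{gr}\,\mathcal T$. Choose an open cover $(U_i)$ and isomorphisms of $\mathbb Z_2$-graded $\mathcal O$-modules $\delta_i:\mathcal T|_{U_i}\to\mathrm{gr}\,\mathcal T|_{U_i}$ inducing the identity on $\mathrm{gr}\,\mathcal T$; the cocycle $(\delta_i\circ\delta_j^{-1})$ defines a class in the pointed set $H^1(M,\mathcal Aut^{\mathcal O}_{(1)}\mathrm{gr}\,\mathcal T)$, well defined as an orbit of the group of global automorphisms of $\mathrm{gr}\,\mathcal T$ preserving its $\mathbb Z$-grading (acting by conjugation, and fixing the unit class). This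 is the class corresponding to $\mathcal T$; the unit class is that of the trivial cocycle. A (holomorphic) connection on $\mathcal G$ (i.e. in the bundle $\mathbb G$) is a $\mathbb C$-bilinear map of sheaves $\nabla:\Theta\times\mathcal G\to\mathcal G$ with $\nabla_{fX}s=f\nabla_Xs$ and $\nabla_X(fs)=f\nabla_Xs+X(f)s$ for $f\in\mathcal F$, $X\in\Theta$, $s\in\mathcal G$. *)

(* Defs.v *)
From HB Require Import structures.
From mathcomp Require Import all_boot all_order all_algebra.
From mathcomp Require Import complex.
From mathcomp Require Import all_classical all_reals all_analysis.

Set Implicit Arguments.
Unset Strict Implicit.
Unset Printing Implicit Defensive.

Import Order.TTheory GRing.Theory Num.Theory.
Import numFieldNormedType.Exports.

Local Open Scope classical_set_scope.
Local Open Scope ring_scope.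

Record opens (M : topologicalType) := Opens {
  oset :> set M;
  oset_open : open oset }.

Definition opensT (M : topologicalType) : opens M := Opens (@openT M).

Definition opensI (M : topologicalType) (U V : opens M) : opens M :=
  Opens (openI (oset_open U) (oset_open V)).

Definition locally_on (M : topologicalType) (U : opens M)
    (P : forall V : opens M, V `<=` U -> Prop) : Prop :=
  forall x, oset U x ->
    exists (V : opens M) (s : V `<=` U), oset V x /\ P V s.

Definition is_sheaf (M : topologicalType) (E : opens M -> Type)
    (res : forall U V : opens M, V `<=` U -> E U -> E V) : Prop :=
  forall (U : opens M) (I : Type) (W : I -> opens M)
         (sW : forall i, W i `<=` U),
    U `<=` \bigcup_i W i ->
    (forall s t : E U,
        (forall i, res _ _ (sW i) s = res _ _ (sW i) t) -> s = t) /\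
    (forall s : forall i, E (W i),
        (forall i j (V : opens M) (si : V `<=` W i) (sj : V `<=` W j),
            res _ _ si (s i) = res _ _ sj (s j)) ->
        exists t : E U, forall i, res _ _ (sW i) t = s i).

(* Sheaves of associative unital K-algebras. Sections form a [pzRingType]     *)
(* since the algebra of sections over the empty set is zero; the K-algebra    *)
(* structure is given by the central morphism [acst].                         *)
Record algSheaf (K : numFieldType) (M : topologicalType) := AlgSheaf {
  asec :> opens M -> pzRingType;
  ares : forall U V : opens M, V `<=` U -> {rmorphism asec U -> asec V};
  acst : forall U, {rmorphism K -> asec U};
  acst_central : forall U c (a : asec U), acst U c * a = a * acst U c;
  ares_cst : forall (U V : opens M) (s : V `<=` U) c,
    ares s (acst U c) = acst V c;
  ares_id : forall (U : opens M) (s : U `<=` U) a, ares s a = a;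
  ares_comp : forall (U V W : opens M) (sVU : V `<=` U) (sWV : W `<=` V)
    (sWU : W `<=` U) a, ares sWV (ares sVU a) = ares sWU a;
  asheaf : is_sheaf (fun U V s => ares s : asec U -> asec V) }.

Arguments ares {K M A U V} s : rename.
Arguments acst {K M} A U : rename.

Record comAlgSheaf (K : numFieldType) (M : topologicalType) := ComAlgSheaf {
  calg :> algSheaf K M;
  calgC : forall U (f g : calg U), f * g = g * f }.

Record algMor (K : numFieldType) (M : topologicalType) (A B : algSheaf K M) :=
  AlgMor {
  amor :> forall U, {rmorphism A U -> B U};
  amor_cst : forall U c, amor U (acst A U c) = acst B U c;
  amor_res : forall (U V : opens M) (s : V `<=` U) a,
    amor V (ares s a) = ares s (amor U a) }.

Record modSheaf (K : numFieldType) (M : topologicalType) (A : algSheaf K M) :=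
  ModSheaf {
  msec :> forall U, lmodType (A U);
  mres : forall U V : opens M, V `<=` U -> msec U -> msec V;
  mresP : forall (U V : opens M) (s : V `<=` U) a v w,
    mres s (a *: v + w) = ares s a *: mres s v + mres s w;
  mres_id : forall (U : opens M) (s : U `<=` U) v, mres s v = v;
  mres_comp : forall (U V W : opens M) (sVU : V `<=` U) (sWV : W `<=` V)
    (sWU : W `<=` U) v, mres sWV (mres sVU v) = mres sWU v;
  msheaf : is_sheaf mres }.

Arguments mres {K M A E U V} s v : rename.

Definition locally_free (K : numFieldType) (M : topologicalType)
    (A : algSheaf K M) (E : modSheaf A) : Prop :=
  forall x : M, exists (U : opens M) (r : nat) (e : 'I_r -> E U), oset U x /\
    forall (V : opens M) (s : V `<=` U) (v : E V),
      exists! c : 'I_r -> A V, v = \sum_(i < r) c i *: mres s (e i).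

Section SheafTheory.
Context (K : numFieldType) (M : topologicalType).

Lemma aresE (A : algSheaf K M) (U V : opens M) (s t : V `<=` U) (a : A U) :
  ares s a = ares t a.
Proof. by rewrite (Prop_irrelevance s t). Qed.

Lemma asep (A : algSheaf K M) (U : opens M) (a b : A U) :
  locally_on (fun V (s : V `<=` U) => ares s a = ares s b) -> a = b.
Proof.
move=> h.
pose I := {V : opens M & {s : V `<=` U | ares s a = ares s b}}.
pose W (i : I) := projT1 i.
have sW (i : I) : W i `<=` U by case: i => V [].
have cov : U `<=` \bigcup_i W i.
  move=> x Ux; have [V [s [Vx e]]] := h x Ux.
  by exists (existT _ V (exist _ s e)).
have [sep _] := @asheaf _ _ A _ _ _ sW cov.
by apply: sep => -[V [s e]]; move: (sW _) => /= t; rewrite !(aresE t s).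
Qed.

Variable A : algSheaf K M.

Section Restriction.
Variables (E : modSheaf A) (U V : opens M) (s : V `<=` U).

Lemma mresD v w : mres s (v + w) = mres s v + mres s w :> E V.
Proof. by rewrite -[v in LHS]scale1r mresP rmorph1 scale1r. Qed.

Lemma mres0 : mres s 0 = 0 :> E V.
Proof. by apply: (addrI (mres s 0)); rewrite -mresD !addr0. Qed.

Lemma mresN v : mres s (- v) = - mres s v :> E V.
Proof. by apply: (addrI (mres s v)); rewrite -mresD !subrr mres0. Qed.

Lemma mresZ a v : mres s (a *: v) = ares s a *: mres s v :> E V.
Proof. by rewrite -[a *: v]addr0 mresP mres0 addr0. Qed.

End Restriction.

Lemma msep (E : modSheaf A) (U : opens M) (a b : E U) :
  locally_on (fun V (s : V `<=` U) => mres s a = mres s b) -> a = b.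
Proof.
move=> h.
pose I := {V : opens M & {s : V `<=` U | mres s a = mres s b}}.
pose W (i : I) := projT1 i.
have sW (i : I) : W i `<=` U by case: i => V [].
have cov : U `<=` \bigcup_i W i.
  move=> x Ux; have [V [s [Vx e]]] := h x Ux.
  by exists (existT _ V (exist _ s e)).
have [sep _] := @msheaf _ _ _ E _ _ _ sW cov.
by apply: sep => -[V [s e]]; move: (sW _) => /= t; rewrite (Prop_irrelevance t s).
Qed.

End SheafTheory.

Section SubSheaf.
Context (K : numFieldType) (M : topologicalType) (A : algSheaf K M).

Record subSheaf (E : modSheaf A) := SubSheaf {
  sset :> forall U, set (E U);
  sset0 : forall U, sset (0 : E U);
  ssetP : forall U a (v w : E U), sset v -> sset w -> sset (a *: v + w);
  sset_res : forall (U V : opens M) (s : V `<=` U) (v : E U),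
    sset v -> sset (mres s v);
  sset_loc : forall U (v : E U),
    locally_on (fun V (s : V `<=` U) => sset (mres s v)) -> sset v }.

Variables (E : modSheaf A) (S : subSheaf E).

Record subSec (U : opens M) := SubSec {
  ssval : E U;
  ssvalP : S U ssval }.

Variable U : opens M.

Lemma ssval_inj : injective (@ssval U).
Proof.
case=> [v hv] [w hw] /= e; case: _ / e hw => hw.
by rewrite (Prop_irrelevance hv hw).
Qed.

HB.instance Definition _ := gen_eqMixin (subSec U).
HB.instance Definition _ := gen_choiceMixin (subSec U).

Lemma ssetD v w : S U v -> S U w -> S U (v + w).
Proof. by move=> hv hw; rewrite -[v]scale1r; exact: ssetP. Qed.

Lemma ssetZ a v : S U v -> S U (a *: v).
Proof. by move=> hv; rewrite -[_ *: _]addr0; apply: ssetP => //; exact: sset0. Qed.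

Lemma ssetN v : S U v -> S U (- v).
Proof. by move=> hv; rewrite -scaleN1r; exact: ssetZ. Qed.

Definition ss0 : subSec U := SubSec (sset0 S U).
Definition ssadd (v w : subSec U) : subSec U :=
  SubSec (ssetD (ssvalP v) (ssvalP w)).
Definition ssopp (v : subSec U) : subSec U := SubSec (ssetN (ssvalP v)).
Definition ssscale (a : A U) (v : subSec U) : subSec U :=
  SubSec (ssetZ a (ssvalP v)).

Lemma ssaddA : associative ssadd.
Proof. by move=> u v w; apply: ssval_inj; exact: addrA. Qed.
Lemma ssaddC : commutative ssadd.
Proof. by move=> u v; apply: ssval_inj; exact: addrC. Qed.
Lemma ssadd0 : left_id ss0 ssadd.
Proof. by move=> u; apply: ssval_inj; exact: add0r. Qed.
Lemma ssaddN : left_inverse ss0 ssopp ssadd.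
Proof. by move=> u; apply: ssval_inj; exact: addNr. Qed.

HB.instance Definition _ :=
  GRing.isZmodule.Build (subSec U) ssaddA ssaddC ssadd0 ssaddN.

Lemma ssscaleA a b v : ssscale a (ssscale b v) = ssscale (a * b) v.
Proof. by apply: ssval_inj; exact: scalerA. Qed.
Lemma ssscale1 : left_id 1 ssscale.
Proof. by move=> u; apply: ssval_inj; exact: scale1r. Qed.
Lemma ssscaleDr : right_distributive ssscale +%R.
Proof. by move=> a u v; apply: ssval_inj; exact: scalerDr. Qed.
Lemma ssscaleDl v : {morph ssscale^~ v : a b / a + b}.
Proof. by move=> a b; apply: ssval_inj; exact: scalerDl. Qed.

HB.instance Definition _ :=
  GRing.Zmodule_isLmodule.Build (A U) (subSec U)
    ssscaleA ssscale1 ssscaleDr ssscaleDl.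

End SubSheaf.

Section SubSheafSheaf.
Context (K : numFieldType) (M : topologicalType) (A : algSheaf K M).
Variables (E : modSheaf A) (S : subSheaf E).

Definition ssres (U V : opens M) (s : V `<=` U) (v : subSec S U) : subSec S V :=
  SubSec (sset_res s (ssvalP v)).

Lemma ssresP (U V : opens M) (s : V `<=` U) (a : A U) (v w : subSec S U) :
  ssres s (a *: v + w) = ares s a *: ssres s v + ssres s w.
Proof. by apply: ssval_inj; exact: mresP. Qed.

Lemma ssres_id (U : opens M) (s : U `<=` U) (v : subSec S U) : ssres s v = v.
Proof. by apply: ssval_inj; exact: mres_id. Qed.

Lemma ssres_comp (U V W : opens M) (sVU : V `<=` U) (sWV : W `<=` V)
  (sWU : W `<=` U) (v : subSec S U) : ssres sWV (ssres sVU v) = ssres sWU v.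
Proof. by apply: ssval_inj; exact: mres_comp. Qed.

Lemma sssheaf : is_sheaf ssres.
Proof.
move=> U I W sW cov; have [sep glue] := @msheaf _ _ _ E _ _ _ sW cov.
split=> [v w h|v h].
  by apply/ssval_inj/sep => i; have /(congr1 (@ssval _ _ _ _ _ _)) := h i.
have [i j V si sj|t ht] := glue (fun i => ssval (v i)).
  by have /(congr1 (@ssval _ _ _ _ _ _)) := h i j V si sj.
have St : S U t.
  apply: sset_loc => x Ux; have [i _ Wx] := cov x Ux.
  by exists (W i), (sW i); split=> //; rewrite ht; exact: ssvalP.
by exists (SubSec St) => i; apply: ssval_inj; exact: ht.
Qed.

Definition subSheafMod : modSheaf A :=
  ModSheaf (msec := fun U => subSec S U : lmodType (A U))
    ssresP ssres_id ssres_comp sssheaf.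

End SubSheafSheaf.

(* Sections over U of the sheaf of K-linear endomorphisms of A, as an         *)
(* A-module: endomorphisms of the restriction of A to U.                      *)
Record endo (K : numFieldType) (M : topologicalType) (A : algSheaf K M)
    (U : opens M) := Endo {
  efun :> forall V : opens M, V `<=` U -> A V -> A V;
  efunP : forall (V : opens M) (s : V `<=` U) c a b,
    efun s (acst A V c * a + b) = acst A V c * efun s a + efun s b;
  efun_res : forall (V W : opens M) (sVU : V `<=` U) (sWV : W `<=` V)
    (sWU : W `<=` U) a, efun sWU (ares sWV a) = ares sWV (efun sVU a) }.

Section EndoSheaf.
Context (K : numFieldType) (M : topologicalType) (A : algSheaf K M).

Section EndoMod.
Variable U : opens M.
Local Notation T := (endo A U).

HB.instance Definition _ := gen_eqMixin T.
HB.instance Definition _ := gen_choiceMixin T.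

Lemma endo_ext (D D' : T) :
  (forall (V : opens M) (s : V `<=` U) a, D V s a = D' V s a) -> D = D'.
Proof.
case: D => f fP fr; case: D' => g gP gr /= h.
have e : f = g by apply: functional_extensionality_dep => V;
  apply: functional_extensionality_dep => s; apply/funext => a; exact: h.
case: _ / e gP gr {h} => gP gr.
by rewrite (Prop_irrelevance fP gP) (Prop_irrelevance fr gr).
Qed.

Lemma efunD (D : T) (V : opens M) (s : V `<=` U) a b :
  D V s (a + b) = D V s a + D V s b.
Proof. by have := efunP D s 1 a b; rewrite rmorph1 !mul1r. Qed.

Lemma efun0 (D : T) (V : opens M) (s : V `<=` U) : D V s 0 = 0.
Proof. by apply: (addrI (D V s 0)); rewrite -efunD !addr0. Qed.

Definition endo0 : T.
Proof.
apply: (@Endo K M A U (fun V s a => 0)).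
- by move=> V s c a b; rewrite addr0 mulr0.
- by move=> V W sVU sWV sWU a; rewrite rmorph0.
Defined.

Definition endoD (D D' : T) : T.
Proof.
apply: (@Endo K M A U (fun V s a => D V s a + D' V s a)).
- by move=> V s c a b; rewrite !efunP mulrDr addrACA.
- by move=> V W sVU sWV sWU a; rewrite rmorphD !(efun_res _ sVU sWV sWU).
Defined.

Definition endoN (D : T) : T.
Proof.
apply: (@Endo K M A U (fun V s a => - D V s a)).
- by move=> V s c a b; rewrite efunP opprD mulrN.
- by move=> V W sVU sWV sWU a; rewrite rmorphN (efun_res _ sVU sWV sWU).
Defined.

Definition endoZ (x : A U) (D : T) : T.
Proof.
apply: (@Endo K M A U (fun V s a => ares s x * D V s a)).
- by move=> V s c a b; rewrite efunP mulrDr !mulrA acst_central.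
- move=> V W sVU sWV sWU a.
  by rewrite rmorphM (efun_res _ sVU sWV sWU) (ares_comp sVU sWV sWU).
Defined.

Lemma endoDA : associative endoD.
Proof. by move=> *; apply: endo_ext => *; exact: addrA. Qed.
Lemma endoDC : commutative endoD.
Proof. by move=> *; apply: endo_ext => *; exact: addrC. Qed.
Lemma endoD0 : left_id endo0 endoD.
Proof. by move=> *; apply: endo_ext => *; exact: add0r. Qed.
Lemma endoDN : left_inverse endo0 endoN endoD.
Proof. by move=> *; apply: endo_ext => *; exact: addNr. Qed.

HB.instance Definition _ := GRing.isZmodule.Build T endoDA endoDC endoD0 endoDN.

Lemma endoZA x y D : endoZ x (endoZ y D) = endoZ (x * y) D.
Proof. by apply: endo_ext => V s a /=; rewrite rmorphM mulrA. Qed.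
Lemma endoZ1 : left_id 1 endoZ.
Proof. by move=> D; apply: endo_ext => V s a /=; rewrite rmorph1 mul1r. Qed.
Lemma endoZDr : right_distributive endoZ +%R.
Proof. by move=> x D D'; apply: endo_ext => V s a /=; exact: mulrDr. Qed.
Lemma endoZDl D : {morph endoZ^~ D : x y / x + y}.
Proof. by move=> x y; apply: endo_ext => V s a /=; rewrite rmorphD mulrDl. Qed.

HB.instance Definition _ :=
  GRing.Zmodule_isLmodule.Build (A U) T endoZA endoZ1 endoZDr endoZDl.

End EndoMod.

Definition endo_res (U V : opens M) (s : V `<=` U) (D : endo A U) : endo A V.
Proof.
apply: (@Endo K M A V (fun W t a => D W (subset_trans t s) a)).
- by move=> *; exact: efunP.
- by move=> *; exact: efun_res.
Defined.

Lemma efunE (U V : opens M) (s t : V `<=` U) (D : endo A U) a :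
  D V s a = D V t a.
Proof. by rewrite (Prop_irrelevance s t). Qed.

Lemma endo_resP (U V : opens M) (s : V `<=` U) (x : A U) (D D' : endo A U) :
  endo_res s (x *: D + D') = ares s x *: endo_res s D + endo_res s D'.
Proof.
by apply: endo_ext => W t a /=; rewrite (ares_comp s t (subset_trans t s)).
Qed.

Lemma endo_res_id (U : opens M) (s : U `<=` U) (D : endo A U) :
  endo_res s D = D.
Proof. by apply: endo_ext => W t a /=; exact: efunE. Qed.

Lemma endo_res_comp (U V W : opens M) (sVU : V `<=` U) (sWV : W `<=` V)
  (sWU : W `<=` U) (D : endo A U) :
  endo_res sWV (endo_res sVU D) = endo_res sWU D.
Proof. by apply: endo_ext => X t a /=; exact: efunE. Qed.

Lemma subIl (V W : opens M) : opensI V W `<=` V.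
Proof. by move=> x []. Qed.
Lemma subIr (V W : opens M) : opensI V W `<=` W.
Proof. by move=> x []. Qed.

Lemma endo_sheaf : is_sheaf endo_res.
Proof.
move=> U I W sW cov.
have covV (V : opens M) : V `<=` U -> V `<=` \bigcup_i opensI V (W i).
  by move=> s x Vx; have [i _ Wx] := cov x (s x Vx); exists i.
split=> [D D' h|D h].
  apply: endo_ext => V s a.
  apply: asep => x /[dup] Vx /s /cov [i _ Wx].
  exists (opensI V (W i)), (@subIl V (W i)); split=> //.
  have := congr1 (fun d : endo A (W i) => d _ (@subIr V (W i)) (ares (@subIl V (W i)) a)) (h i).
  by rewrite /= !(efun_res _ s (@subIl V (W i))).
have gl (V : opens M) (s : V `<=` U) (a : A V) : exists b : A V, forall i,
    ares (@subIl V (W i)) b = D i _ (@subIr V (W i)) (ares (@subIl V (W i)) a).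
  have [_] := @asheaf _ _ A _ _ _ (fun i => @subIl V (W i)) (covV V s).
  apply=> i j X si sj.
  have ti := subset_trans si (@subIr V (W i)).
  have tj := subset_trans sj (@subIr V (W j)).
  have sX := subset_trans si (@subIl V (W i)).
  rewrite -(efun_res _ _ si ti) -(efun_res _ _ sj tj).
  rewrite !(ares_comp _ _ sX).
  have := congr1 (fun d : endo A X => d X (@subset_refl _ X) (ares sX a)) (h i j X ti tj).
  by rewrite /= (efunE _ ti) (efunE _ tj).
pose f (V : opens M) (s : V `<=` U) (a : A V) : A V := sval (cid (gl V s a)).
have fE (V : opens M) (s : V `<=` U) (a : A V) i : ares (@subIl V (W i)) (f V s a) =
    D i _ (@subIr V (W i)) (ares (@subIl V (W i)) a).
  by rewrite /f; case: cid.
have fsep (V : opens M) (s : V `<=` U) (a b : A V) :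
    (forall i, ares (@subIl V (W i)) a = ares (@subIl V (W i)) b) -> a = b.
  by have [+ _] := @asheaf _ _ A _ _ _ (fun i => @subIl V (W i)) (covV V s); apply.
have fP (V : opens M) (s : V `<=` U) c a b :
    f V s (acst A V c * a + b) = acst A V c * f V s a + f V s b.
  apply: (fsep V s) => i; rewrite fE !rmorphD !rmorphM !ares_cst.
  by rewrite efunP !fE.
have fr (V X : opens M) (s : V `<=` U) (t : X `<=` V) (sX : X `<=` U) a :
    f X sX (ares t a) = ares t (f V s a).
  apply: (fsep X sX) => i; rewrite fE.
  have u : opensI X (W i) `<=` opensI V (W i) by move=> x [/t ? ?].
  have w := subset_trans u (@subIl V (W i)).
  rewrite !(ares_comp _ _ w) -(ares_comp (@subIl V (W i)) u w).
  rewrite -[RHS](ares_comp (@subIl V (W i)) u w) fE.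
  by rewrite (efun_res _ (@subIr V (W i)) u).
exists (@Endo K M A U f fP fr) => i; apply: endo_ext => V t a /=.
apply: (fsep V (subset_trans t (sW i))) => j; rewrite fE.
have tl := subset_trans (@subIl V (W j)) t.
rewrite -(efun_res _ _ _ tl).
have := congr1 (fun d : endo A _ => d _ (@subset_refl _ _) (ares (@subIl V (W j)) a)) (h i j (opensI V (W j)) tl (@subIr V (W j))).
by rewrite /= (efunE _ tl) (efunE _ (@subIr V (W j))) => ->.
Qed.

Definition endoSheaf : modSheaf A :=
  ModSheaf (msec := fun U => endo A U : lmodType (A U))
    endo_resP endo_res_id endo_res_comp endo_sheaf.

End EndoSheaf.

Section Derivations.
Context (K : numFieldType) (M : topologicalType) (F : comAlgSheaf K M).

Definition is_der (U : opens M) (X : endo F U) : Prop :=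
  forall (V : opens M) (s : V `<=` U) f g,
    X V s (f * g) = X V s f * g + f * X V s g.

Lemma is_der0 (U : opens M) : is_der (0 : endo F U).
Proof. by move=> V s f g; rewrite /= mul0r mulr0 addr0. Qed.

Lemma is_derP (U : opens M) (a : F U) (X Y : endo F U) :
  is_der X -> is_der Y -> is_der (a *: X + Y).
Proof.
move=> hX hY V s f g /=; rewrite hX hY !mulrDl !mulrDr addrACA !mulrA.
by rewrite [f * ares s a]calgC.
Qed.

Lemma is_der_res (U V : opens M) (s : V `<=` U) (X : endo F U) :
  is_der X -> is_der (endo_res s X).
Proof. by move=> hX W t f g; exact: hX. Qed.

Lemma is_der_loc (U : opens M) (X : endo F U) :
  locally_on (fun V (s : V `<=` U) => is_der (endo_res s X)) -> is_der X.
Proof.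
move=> h V s f g; apply: asep => x Vx; have [W [t [Wx hW]]] := h x (s x Vx).
have l := @subIl M V W; have r := @subIr M V W.
exists (opensI V W), l; split=> //.
have := hW _ r (ares l f) (ares l g).
rewrite /= -rmorphM !(efunE _ (subset_trans l s)).
by rewrite !(efun_res X s l (subset_trans l s)) rmorphD !rmorphM.
Qed.

(* The tangent sheaf of the ringed space (M, F).                              *)
Definition Der : modSheaf F :=
  subSheafMod (@SubSheaf K M F (endoSheaf F) (fun U => @is_der U : set (endo F U))
    is_der0 is_derP is_der_res is_der_loc).

Definition dapp (U : opens M) (X : Der U) (V : opens M) (s : V `<=` U) :
    F V -> F V :=
  efun (ssval X : endo F U) s.

End Derivations.

(* Sheaves of supercommutative superalgebras; [sproj false] and [sproj true]  *)
(* are the projections onto the even and the odd part.                        *)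
Record superAlg (K : numFieldType) (M : topologicalType) := SuperAlg {
  salg :> algSheaf K M;
  sproj : bool -> forall U, salg U -> salg U;
  sprojD : forall k U (a b : salg U),
    sproj k (a + b) = sproj k a + sproj k b;
  sproj_res : forall k (U V : opens M) (s : V `<=` U) (a : salg U),
    sproj k (ares s a) = ares s (sproj k a);
  sproj_sum : forall U (a : salg U), sproj false a + sproj true a = a;
  sproj_proj : forall k l U (a : salg U),
    sproj k (sproj l a) = if k == l then sproj l a else 0;
  sproj_cst : forall U c, sproj false (acst salg U c) = acst salg U c;
  sprojM : forall j k U (a b : salg U), sproj j a = a -> sproj k b = b ->
    sproj (addb j k) (a * b) = a * b;
  scommute : forall j k U (a b : salg U), sproj j a = a -> sproj k b = b ->
    a * b = (-1) ^+ (j && k) * (b * a) }.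

Arguments sproj {K M} s k {U} a : rename.

Definition spar (K : numFieldType) (M : topologicalType) (O : superAlg K M)
    (k : bool) (U : opens M) : set (O U) :=
  [set a | sproj O k a = a].

Record superMod (K : numFieldType) (M : topologicalType) (O : superAlg K M) :=
  SuperMod {
  smod :> modSheaf O;
  mproj : bool -> forall U, smod U -> smod U;
  mprojD : forall k U (v w : smod U), mproj k (v + w) = mproj k v + mproj k w;
  mproj_res : forall k (U V : opens M) (s : V `<=` U) (v : smod U),
    mproj k (mres s v) = mres s (mproj k v);
  mproj_sum : forall U (v : smod U), mproj false v + mproj true v = v;
  mproj_proj : forall k l U (v : smod U),
    mproj k (mproj l v) = if k == l then mproj l v else 0;
  mprojZ : forall j k U (a : O U) (v : smod U),
    spar j a -> mproj k v = v -> mproj (addb j k) (a *: v) = a *: v }.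

Arguments mproj {K M O} s k {U} v : rename.

Definition mpar (K : numFieldType) (M : topologicalType) (O : superAlg K M)
    (E : superMod O) (k : bool) (U : opens M) : set (E U) :=
  [set v | mproj E k v = v].

Section SuperDerivations.
Context (K : numFieldType) (M : topologicalType) (O : superAlg K M).

Definition is_sder (k : bool) (U : opens M) (D : endo O U) : Prop :=
  forall (V : opens M) (s : V `<=` U),
    (forall j a, spar j a -> spar (addb j k) (D V s a)) /\
    (forall j a b, spar j a ->
       D V s (a * b) = D V s a * b + (-1) ^+ (j && k) * (a * D V s b)).

Definition is_superder (U : opens M) (D : endo O U) : Prop :=
  exists D0 D1 : endo O U, [/\ is_sder false D0, is_sder true D1 & D = D0 + D1].

Lemma sproj0 k (U : opens M) : sproj O k (0 : O U) = 0.
Proof. by apply: (addrI (sproj O k (0 : O U))); rewrite -sprojD !addr0. Qed.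

Lemma spar_proj k (U : opens M) (a : O U) : spar k (sproj O k a).
Proof. by rewrite /spar /= sproj_proj eqxx. Qed.

Lemma spar_res k (U V : opens M) (s : V `<=` U) (a : O U) :
  spar k a -> spar k (ares s a).
Proof. by rewrite /spar /= sproj_res => ->. Qed.

Lemma spar0 k (U : opens M) : spar k (0 : O U).
Proof. exact: sproj0. Qed.

Lemma sparD k (U : opens M) (a b : O U) : spar k a -> spar k b -> spar k (a + b).
Proof. by rewrite /spar /= sprojD => -> ->. Qed.

Lemma sproj_other k l (U : opens M) (a : O U) :
  spar l a -> sproj O k a = if k == l then a else 0.
Proof. by move=> <-; rewrite sproj_proj; case: eqP. Qed.

Lemma sparM j k (U : opens M) (a b : O U) :
  spar j a -> spar k b -> spar (addb j k) (a * b).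
Proof. exact: sprojM. Qed.

Lemma sproj_cstM k (U : opens M) c (a : O U) :
  sproj O k (acst O U c * a) = acst O U c * sproj O k a.
Proof.
rewrite -[a in LHS]sproj_sum mulrDr sprojD.
have h l : spar l (acst O U c * sproj O l a).
  exact: (@sparM false l _ _ _ (sproj_cst O U c : spar false (acst O U c)) (spar_proj l a)).
rewrite (sproj_other k (h false)) (sproj_other k (h true)).
by case: k; rewrite /= ?add0r ?addr0.
Qed.

Definition eproj (k : bool) (U : opens M) (D : endo O U) : endo O U.
Proof.
apply: (@Endo K M O U (fun V s a =>
  sproj O k (D V s (sproj O false a)) + sproj O (~~ k) (D V s (sproj O true a)))).
- move=> V s c a b.
  by rewrite !sprojD !sproj_cstM !efunP !sprojD !sproj_cstM mulrDr addrACA.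
- by move=> V W t u v a; rewrite !sproj_res !(efun_res D t u v) !sproj_res rmorphD.
Defined.

Lemma eprojD k (U : opens M) (D D' : endo O U) :
  eproj k (D + D') = eproj k D + eproj k D'.
Proof. by apply: endo_ext => V s a /=; rewrite !sprojD addrACA. Qed.

Lemma eproj_sum (U : opens M) (D : endo O U) :
  eproj false D + eproj true D = D.
Proof.
apply: endo_ext => V s a /=.
by rewrite addrACA sproj_sum [X in _ + X]addrC sproj_sum -efunD sproj_sum.
Qed.

Lemma eproj_res k (U V : opens M) (s : V `<=` U) (D : endo O U) :
  eproj k (endo_res s D) = endo_res s (eproj k D).
Proof. by apply: endo_ext => W t a. Qed.

Lemma eproj_sder k l (U : opens M) (D : endo O U) :
  is_sder l D -> eproj k D = if k == l then D else 0.
Proof.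
move=> h; apply: endo_ext => V s a.
have [hp _] := h V s.
have h0 := sproj_other k (hp _ _ (spar_proj false a)).
have h1 := sproj_other (~~ k) (hp _ _ (spar_proj true a)).
rewrite /= h0 h1 {h h0 h1}.
by case: k l {hp} => [] [] /=; rewrite ?addr0 // -efunD sproj_sum.
Qed.

Lemma is_sder0 k (U : opens M) : is_sder k (0 : endo O U).
Proof.
by move=> V s; split=> [*|*]; rewrite ?mul0r ?mulr0 ?addr0 //; exact: spar0.
Qed.

Lemma is_sderD k (U : opens M) (D D' : endo O U) :
  is_sder k D -> is_sder k D' -> is_sder k (D + D').
Proof.
move=> h h' V s; have [p l] := h V s; have [p' l'] := h' V s; split.
  by move=> j a ha; apply: sparD; [exact: p | exact: p'].
by move=> j a b ha /=; rewrite (l j) // (l' j) // mulrDl !mulrDr addrACA.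
Qed.

Lemma is_sderZ j k (U : opens M) (x : O U) (D : endo O U) :
  spar j x -> is_sder k D -> is_sder (addb j k) (x *: D).
Proof.
move=> hx h V s; have [p l] := h V s; have hs := spar_res s hx; split.
  move=> i a ha; have := sparM hs (p i a ha).
  by rewrite addbCA.
move=> i a b ha; rewrite /= (l i) // mulrDr mulrA; congr (_ + _).
have e : (-1) ^+ (i && addb j k) = (-1) ^+ (i && k) * (-1) ^+ (j && i) :> O V.
  by case: i j k {ha hx h p l hs} => [] [] [] //=;
    rewrite ?mulr1 ?mul1r // -expr2 sqrrN expr1n.
rewrite e [in LHS]mulrA (commr_sign (ares s x) (i && k)) -!mulrA; congr (_ * _).
by rewrite mulrA (scommute hs ha) -!mulrA.
Qed.

Lemma is_sder_res k (U V : opens M) (s : V `<=` U) (D : endo O U) :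
  is_sder k D -> is_sder k (endo_res s D).
Proof. by move=> h W t; exact: h. Qed.

Lemma is_sder_loc k (U : opens M) (D : endo O U) :
  locally_on (fun V (s : V `<=` U) => is_sder k (endo_res s D)) -> is_sder k D.
Proof.
move=> h V s; split.
  move=> j a ha; apply: asep => x Vx; have [W [t [Wx hW]]] := h x (s x Vx).
  have l := @subIl M V W; have r := @subIr M V W.
  exists (opensI V W), l; split=> //; have [+ _] := hW _ r.
  move=> /(_ j _ (spar_res l ha)).
  rewrite /= (efunE _ (subset_trans l s)) (efun_res D s l (subset_trans l s)).
  by rewrite -sproj_res.
move=> j a b ha; apply: asep => x Vx; have [W [t [Wx hW]]] := h x (s x Vx).
have l := @subIl M V W; have r := @subIr M V W.
exists (opensI V W), l; split=> //; have [_] := hW _ r.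
move=> /(_ j _ (ares l b) (spar_res l ha)).
rewrite /= -rmorphM !(efunE _ (subset_trans l s)).
rewrite !(efun_res D s l (subset_trans l s)) => ->.
by rewrite rmorphD !rmorphM rmorph_sign.
Qed.

Lemma is_superderP (U : opens M) (D : endo O U) :
  is_superder D <-> forall k, is_sder k (eproj k D).
Proof.
split=> [[D0 [D1 [h0 h1 ->]]] k|h].
  rewrite eprojD (eproj_sder k h0) (eproj_sder k h1).
  by case: k; rewrite /= ?add0r ?addr0.
by exists (eproj false D), (eproj true D); split=> //; rewrite eproj_sum.
Qed.

Lemma sder_superder k (U : opens M) (D : endo O U) :
  is_sder k D -> is_superder D.
Proof.
case: k => h.
  by exists 0, D; split; rewrite ?add0r //; exact: is_sder0.
by exists D, 0; split; rewrite ?addr0 //; exact: is_sder0.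
Qed.

Lemma superder0 (U : opens M) : is_superder (0 : endo O U).
Proof. by apply: (@sder_superder false); apply: is_sder0. Qed.

Lemma superderP (U : opens M) (a : O U) (D D' : endo O U) :
  is_superder D -> is_superder D' -> is_superder (a *: D + D').
Proof.
move=> [D0 [D1 [h0 h1 ->]]] [D0' [D1' [h0' h1' ->]]].
pose a0 := sproj O false a; pose a1 := sproj O true a.
have p0 : spar false a0 := spar_proj false a.
have p1 : spar true a1 := spar_proj true a.
exists (a0 *: D0 + a1 *: D1 + D0'), (a1 *: D0 + a0 *: D1 + D1'); split.
- apply: is_sderD => //; apply: is_sderD.
    exact: (is_sderZ p0 h0).
  exact: (is_sderZ p1 h1).
- apply: is_sderD => //; apply: is_sderD.
    exact: (is_sderZ p1 h0).
  exact: (is_sderZ p0 h1).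
rewrite [RHS]addrACA; congr (_ + _).
have -> : a = a0 + a1 by rewrite /a0 /a1 sproj_sum.
rewrite scalerDl !scalerDr [X in _ + X]addrC addrACA; congr (_ + _).
exact: addrC.
Qed.

Lemma superder_res (U V : opens M) (s : V `<=` U) (D : endo O U) :
  is_superder D -> is_superder (endo_res s D).
Proof.
by move=> /is_superderP h; apply/is_superderP => k; rewrite eproj_res;
  apply: is_sder_res.
Qed.

Lemma superder_loc (U : opens M) (D : endo O U) :
  locally_on (fun V (s : V `<=` U) => is_superder (endo_res s D)) ->
  is_superder D.
Proof.
move=> h; apply/is_superderP => k; apply: is_sder_loc => x Ux.
have [V [s [Vx /is_superderP hV]]] := h x Ux.
by exists V, s; split=> //; rewrite -eproj_res.
Qed.

Definition sDerSub : subSheaf (endoSheaf O) :=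
  @SubSheaf K M O (endoSheaf O) (fun U => @is_superder U : set (endo O U))
    superder0 superderP superder_res superder_loc.

Definition sDerMod : modSheaf O := subSheafMod sDerSub.

Lemma superder_proj k (U : opens M) (D : endo O U) :
  is_superder D -> is_superder (eproj k D).
Proof. by move=> /is_superderP /(_ k); exact: sder_superder. Qed.

Definition tproj (k : bool) (U : opens M) (D : sDerMod U) : sDerMod U :=
  @SubSec K M O _ sDerSub U (eproj k (ssval D)) (superder_proj k (ssvalP D)).

Lemma tprojD k (U : opens M) (D D' : sDerMod U) :
  tproj k (D + D') = tproj k D + tproj k D'.
Proof. by apply: ssval_inj; exact: eprojD. Qed.

Lemma tproj_res k (U V : opens M) (s : V `<=` U) (D : sDerMod U) :
  tproj k (mres s D) = mres s (tproj k D).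
Proof. by apply: ssval_inj; exact: eproj_res. Qed.

Lemma tproj_sum (U : opens M) (D : sDerMod U) :
  tproj false D + tproj true D = D.
Proof. by apply: ssval_inj; exact: eproj_sum. Qed.

Lemma tproj_proj k l (U : opens M) (D : sDerMod U) :
  tproj k (tproj l D) = if k == l then tproj l D else 0.
Proof.
have /is_superderP h := ssvalP D.
by apply: ssval_inj; rewrite /= (eproj_sder k (h l)); case: eqP.
Qed.

Lemma tprojZ j k (U : opens M) (a : O U) (D : sDerMod U) :
  spar j a -> tproj k D = D -> tproj (addb j k) (a *: D) = a *: D.
Proof.
move=> ha hD; apply: ssval_inj.
have hk : is_sder k (ssval D : endo O U).
  by rewrite -hD; have /is_superderP := ssvalP D; apply.
by have := eproj_sder (addb j k) (is_sderZ ha hk); rewrite eqxx.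
Qed.

Definition sDer : superMod O :=
  SuperMod tprojD tproj_res tproj_sum tproj_proj tprojZ.

Definition sdapp (U : opens M) (D : sDer U) (V : opens M) (s : V `<=` U) :
    O V -> O V :=
  efun (ssval D : endo O U) s.

End SuperDerivations.

Section Manifold.
Context (K : numFieldType) (M : topologicalType).

Definition holomorphic_on (n : nat) (D : set 'rV[K]_n) (u : 'rV[K]_n -> K) :
    Prop :=
  forall z, D z -> differentiable (u : 'rV[K]_n -> K^o) z.

(* [phi] is a homeomorphism from U onto an open subset of K^n, and [theta]    *)
(* an isomorphism from F over U to the pullback under [phi] of the sheaf of   *)
(* holomorphic functions. Only the values of [phi] on U, and for V included   *)
(* in U those of [theta V f] on the image of V, are relevant.                 *)
Record is_chart (F : algSheaf K M) (n : nat) (U : opens M)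
    (phi : M -> 'rV[K]_n) (theta : forall V, F V -> 'rV[K]_n -> K) : Prop :=
  IsChart {
  chart_inj : forall x y, oset U x -> oset U y -> phi x = phi y -> x = y;
  chart_cont : forall D : set 'rV[K]_n, open D -> open (U `&` phi @^-1` D);
  chart_open : forall V : opens M, V `<=` U -> open (phi @` V);
  chart_hol : forall V : opens M, V `<=` U -> forall f : F V,
    holomorphic_on (phi @` V) (theta V f);
  chart_surj : forall V : opens M, V `<=` U ->
    forall u, holomorphic_on (phi @` V) u ->
    exists f : F V, forall z, (phi @` V) z -> theta V f z = u z;
  chart_sinj : forall V : opens M, V `<=` U -> forall f g : F V,
    (forall z, (phi @` V) z -> theta V f z = theta V g z) -> f = g;
  chart_add : forall V : opens M, V `<=` U -> forall (f g : F V) z,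
    (phi @` V) z -> theta V (f + g) z = theta V f z + theta V g z;
  chart_mul : forall V : opens M, V `<=` U -> forall (f g : F V) z,
    (phi @` V) z -> theta V (f * g) z = theta V f z * theta V g z;
  chart_cst : forall V : opens M, V `<=` U -> forall c z,
    (phi @` V) z -> theta V (acst F V c) z = c;
  chart_res : forall (V W : opens M) (s : W `<=` V), V `<=` U ->
    forall (f : F V) z, (phi @` W) z -> theta W (ares s f) z = theta V f z }.

Definition complex_manifold (n : nat) (F : comAlgSheaf K M) : Prop :=
  [/\ hausdorff_space M, @second_countable M &
    forall x : M, exists (U : opens M) (phi : M -> 'rV[K]_n)
      (theta : forall V, F V -> 'rV[K]_n -> K),
      oset U x /\ is_chart U phi theta].

End Manifold.

Section SplitSupermanifold.
Context (K : numFieldType) (M : topologicalType).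
Variables (F : comAlgSheaf K M) (G : modSheaf F).

(* The exterior algebra of G over F, given by its universal property among    *)
(* sheaves of associative F-algebras; F is even and G is odd. The sheaf       *)
(* underlying a split supermanifold.                                          *)
Record extAlg := ExtAlg {
  ealg :> superAlg K M;
  ealpha : algMor F ealg;
  eiota : forall U, G U -> ealg U;
  ealpha_even : forall U (f : F U), spar false (ealpha U f);
  eiota_odd : forall U (g : G U), spar true (eiota g);
  eiotaP : forall U (f : F U) (g h : G U),
    eiota (f *: g + h) = ealpha U f * eiota g + eiota h;
  eiota_res : forall (U V : opens M) (s : V `<=` U) (g : G U),
    eiota (mres s g) = ares s (eiota g);
  eiota_sqr : forall U (g : G U), eiota g * eiota g = 0;
  euniv : forall (B : algSheaf K M) (beta : algMor F B)
      (j : forall U, G U -> B U),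
    (forall U f (b : B U), beta U f * b = b * beta U f) ->
    (forall U (f : F U) (g h : G U),
        j U (f *: g + h) = beta U f * j U g + j U h) ->
    (forall (U V : opens M) (s : V `<=` U) (g : G U),
        j V (mres s g) = ares s (j U g)) ->
    (forall U (g : G U), j U g * j U g = 0) ->
    let extends (kappa : algMor ealg B) :=
      (forall U f, kappa U (ealpha U f) = beta U f) /\
      (forall U (g : G U), kappa U (eiota g) = j U g) in
    (exists kappa, extends kappa) /\
    (forall kappa kappa', extends kappa -> extends kappa' ->
       forall U a, kappa U a = kappa' U a) }.

Variable O : extAlg.

(* Sections of the q-th exterior power of G: locally sums of q-fold products  *)
(* of sections of G, with coefficients in F.                                  *)
Definition Odeg (q : nat) (U : opens M) : set (O U) :=
  [set a | locally_on (fun V (s : V `<=` U) =>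
    exists (m : nat) (f : 'I_m -> F V) (g : 'I_m -> 'I_q -> G V),
      ares s a = \sum_(i < m) ealpha O V (f i) * \prod_(j < q) eiota O (g i j))].

Definition T0 (U : opens M) : set (sDer O U) :=
  [set D | forall q (V : opens M) (s : V `<=` U) (a : O V),
    Odeg q a -> Odeg q (sdapp D s a)].

(* A derivation D of degree 0 maps F = O_0 to itself; [gamma D] is the induced  *)
(* derivation of F. The default value 0 is only taken for D outside [T0].      *)
Definition gamma (U : opens M) (D : sDer O U) : Der F U :=
  xget 0 [set X : Der F U | forall (V : opens M) (s : V `<=` U) f,
    ealpha O V (dapp X s f) = sdapp D s (ealpha O V f)].

(* Sections over U of the sheaf Hom_F(G, G), which is the tensor product of G *)
(* and its dual.                                                              *)
Record modEnd (U : opens M) := ModEnd {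
  mefun :> forall V : opens M, V `<=` U -> G V -> G V;
  mefunP : forall (V : opens M) (s : V `<=` U) (f : F V) g h,
    mefun s (f *: g + h) = f *: mefun s g + mefun s h;
  mefun_res : forall (V W : opens M) (sVU : V `<=` U) (sWV : W `<=` V)
    (sWU : W `<=` U) g, mefun sWU (mres sWV g) = mres sWV (mefun sVU g) }.

(* The derivation of degree 0 that is zero on F and equal to h on G; it exists *)
(* and is unique when G is locally free, so the default value is not used.    *)
Definition delta (U : opens M) (h : modEnd U) : sDer O U :=
  xget 0 [set D : sDer O U | [/\ T0 D,
    forall (V : opens M) (s : V `<=` U) f, sdapp D s (ealpha O V f) = 0 &
    forall (V : opens M) (s : V `<=` U) g,
      sdapp D s (eiota O g) = eiota O (h V s g)]].

Record sequence_exact : Prop := SequenceExact {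
  delta_T0 : forall U (h : modEnd U), T0 (delta h);
  delta_inj : forall U, injective (@delta U);
  ker_gamma : forall U (D : sDer O U), T0 D ->
    (gamma D = 0 <-> exists h : modEnd U, delta h = D);
  gamma_surj : forall U (X : Der F U),
    locally_on (fun V (s : V `<=` U) =>
      exists D : sDer O V, T0 D /\ gamma D = mres s X) }.

Record is_splitting (sigma : forall U, Der F U -> sDer O U) : Prop :=
  IsSplitting {
  splitting_T0 : forall U X, T0 (sigma U X);
  splittingP : forall U (f : F U) X Y,
    sigma U (f *: X + Y) = ealpha O U f *: sigma U X + sigma U Y;
  splitting_res : forall (U V : opens M) (s : V `<=` U) X,
    sigma V (mres s X) = mres s (sigma U X);
  splitting_gamma : forall U X, gamma (sigma U X) = X }.

Definition exact_sequence_splits : Prop :=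
  sequence_exact /\ exists sigma, is_splitting sigma.

Record is_connection (nabla : forall U, Der F U -> G U -> G U) : Prop :=
  IsConnection {
  connection_linl : forall U (f : F U) X Y s,
    nabla U (f *: X + Y) s = f *: nabla U X s + nabla U Y s;
  connection_linr : forall U c X s t,
    nabla U X (acst F U c *: s + t) = acst F U c *: nabla U X s + nabla U X t;
  connection_res : forall (U V : opens M) (i : V `<=` U) X s,
    nabla V (mres i X) (mres i s) = mres i (nabla U X s);
  connection_leibniz : forall U X (f : F U) s,
    nabla U X (f *: s) =
      f *: nabla U X s + dapp X (@subset_refl _ (U : set M)) f *: s }.

Definition has_connection : Prop := exists nabla, is_connection nabla.

End SplitSupermanifold.

Section Filtration.
Context (K : numFieldType) (M : topologicalType) (O : superAlg K M).

Definition oddIdeal (U : opens M) : set (O U) :=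
  [set a | locally_on (fun V (s : V `<=` U) =>
    exists (m : nat) (x b y : 'I_m -> O V),
      (forall i, spar true (b i)) /\ ares s a = \sum_(i < m) x i * b i * y i)].

(* [filt p] is J^p E, where J = [oddIdeal].                                     *)
Fixpoint filt (E : superMod O) (p : nat) (U : opens M) : set (E U) :=
  if p is q.+1 then
    [set v | locally_on (fun V (s : V `<=` U) =>
      exists (m : nat) (a : 'I_m -> O V) (w : 'I_m -> E V),
        [/\ forall i, oddIdeal (a i), forall i, filt q (w i) &
            mres s v = \sum_(i < m) a i *: w i])]
  else setT.

(* Isomorphisms from E to E' over W; the components of [f] over open sets not *)
(* included in W are irrelevant.                                              *)
Record is_iso_over (E E' : superMod O) (W : opens M)
    (f : forall V, E V -> E' V) : Prop := IsIsoOver {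
  iso_linear : forall V : opens M, V `<=` W -> forall a (v w : E V),
    f V (a *: v + w) = a *: f V v + f V w;
  iso_par : forall V : opens M, V `<=` W -> forall k (v : E V),
    mpar k v -> mpar k (f V v);
  iso_res : forall (V V' : opens M) (s : V' `<=` V), V `<=` W ->
    forall v : E V, f V' (mres s v) = mres s (f V v);
  iso_bij : forall V : opens M, V `<=` W -> bijective (f V) }.

End Filtration.

Section Retract.
Context (K : numFieldType) (M : topologicalType).
Variables (F : comAlgSheaf K M) (G : modSheaf F) (O : extAlg G).

(* The sheaf gr E, i.e. the direct sum over p of the quotients                *)
(* J^p E / J^(p+1) E, given up to unique isomorphism by the classes           *)
(* [symb p v] of the sections v of J^p E ([symb p v] is irrelevant for other  *)
(* v). By [symbZ] the graded algebra of O acts through its identification     *)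
(* with O, by which the class of a section a of the q-th exterior power in    *)
(* J^q / J^(q+1) is identified with a.                                        *)
Record retract (E : superMod O) := Retract {
  gr :> superMod O;
  symb : forall (p : nat) U, E U -> gr U;
  symbD : forall p U (v w : E U), filt p v -> filt p w ->
    symb p (v + w) = symb p v + symb p w;
  symb_res : forall p (U V : opens M) (s : V `<=` U) (v : E U), filt p v ->
    symb p (mres s v) = mres s (symb p v);
  symb_par : forall p k U (v : E U), filt p v -> mpar k v ->
    mpar k (symb p v);
  symb_ker : forall p U (v : E U), filt p v ->
    (symb p v = 0 <-> filt p.+1 v);
  symbZ : forall q p U (a : O U) (v : E U), Odeg q a -> filt p v ->
    symb (q + p) (a *: v) = a *: symb p v;
  symb_span : forall U (h : gr U), locally_on (fun V (s : V `<=` U) =>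
    exists (m : nat) (v : nat -> E V), (forall p, filt p (v p)) /\
      mres s h = \sum_(p < m) symb p (v p));
  symb_direct : forall U (m : nat) (v : nat -> E U),
    (forall p, filt p (v p)) -> \sum_(p < m) symb p (v p) = 0 ->
    forall p, (p < m)%N -> symb p (v p) = 0 }.

Section Cohomology.
Variable H : superMod O.

Definition is_aut1 (W : opens M) (f : forall V, H V -> H V) : Prop :=
  is_iso_over W f /\
  forall V : opens M, V `<=` W -> forall v : H V, filt 1 (f V v - v).

Record cocycle := Cocycle {
  cidx : Type;
  ccov : cidx -> opens M;
  cfun : cidx -> cidx -> forall V, H V -> H V;
  ccov_all : [set: M] `<=` \bigcup_i ccov i;
  cfun_aut : forall i j, is_aut1 (opensI (ccov i) (ccov j)) (cfun i j);
  cfun_mul : forall i j k (V : opens M),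
    V `<=` ccov i -> V `<=` ccov j -> V `<=` ccov k ->
    forall h : H V, cfun i j (cfun j k h) = cfun i k h }.

Definition cohomologous (c c' : cocycle) : Prop :=
  exists (I : Type) (W : I -> opens M) (t : I -> cidx c) (t' : I -> cidx c')
         (u : I -> forall V, H V -> H V),
    [/\ [set: M] `<=` \bigcup_i W i,
        forall i, W i `<=` ccov (t i) /\ W i `<=` ccov (t' i),
        forall i, is_aut1 (W i) (u i) &
        forall i j (V : opens M), V `<=` W i -> V `<=` W j -> forall h : H V,
          cfun (t' i) (t' j) (u j V h) = u i V (cfun (t i) (t j) h)].

(* Elements of H^1(M, Aut_(1) H) are cohomology classes, as sets of cocycles. *)
Definition H1_class (c : cocycle) : set cocycle := [set c' | cohomologous c c'].

Lemma is_aut1_id (W : opens M) : is_aut1 W (fun V (h : H V) => h).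
Proof.
split; first by split=> // V sV; exists id.
move=> V sV v x Vx; exists V, (@subset_refl _ (V : set M)); split=> //.
exists 0, (fun=> 0), (fun=> 0); split=> [[]//|[]//|].
by rewrite subrr big_ord0 mres0.
Qed.

Definition cocycle1 : cocycle.
Proof.
apply: (@Cocycle unit (fun=> opensT M) (fun _ _ V h => h)) => //.
- by move=> x _; exists tt.
- by move=> i j; exact: is_aut1_id.
Defined.

Definition H1_unit : set cocycle := H1_class cocycle1.

End Cohomology.

Variables (E : superMod O) (H : retract E).

Definition is_local_triv (W : opens M) (d : forall V, E V -> H V) : Prop :=
  is_iso_over W d /\
  forall V : opens M, V `<=` W -> forall p (v : E V), filt p v ->
    filt p.+1 (d V v - symb H p v).

Definition gr_part (p : nat) (U : opens M) : set (H U) :=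
  [set h | locally_on (fun V (s : V `<=` U) =>
    exists v : E V, filt p v /\ mres s h = symb H p v)].

Definition is_graded_aut (b : forall V, H V -> H V) : Prop :=
  is_iso_over (opensT M) b /\
  forall p V (h : H V), gr_part p h -> gr_part p (b V h).

(* The classes [xi] in the orbit, under the graded automorphisms b of gr E,   *)
(* of the class of the cocycle d_i d_j^-1 of local trivializations d_i of E:  *)
(* c i j = b d_i d_j^-1 b^-1.                                                 *)
Definition corresponds_to (xi : set (cocycle H)) : Prop :=
  exists (c : cocycle H) (d : cidx c -> forall V, E V -> H V)
         (b : forall V, H V -> H V),
    [/\ forall i, is_local_triv (ccov i) (d i),
        is_graded_aut b,
        forall i j (V : opens M), V `<=` ccov i -> V `<=` ccov j ->
          forall e : E V, cfun i j (b V (d j V e)) = b V (d i V e) &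
        xi = H1_class c].

End Retract.

Arguments corresponds_to {K M F G O E} H xi.
Arguments cocycle1 {K M F G O} H.
Arguments H1_unit {K M F G O} H.

(* Main.v *)
(* Projecting O to F (+) G, a square-zero extension of F, gives pi_0 : O -> F *)
(* and pi_1 : O -> G, and O-valued derivations extend from F and G to O by    *)
(* the universal property applied to square-zero extensions of O. So a lift   *)
(* of a vector field X to T_0 is the same as an operator on G satisfying the  *)
(* Leibniz rule for X, and splittings of the sequence are connections.        *)
(*   If T has the unit class, an isomorphism T -> gr T inducing the identity  *)
(* on gr T yields for every X in Theta a derivation E of O that is congruent  *)
(* to the local lifts of X modulo JT; then nabla_X g = pi_1(E g).             *)
(*   Conversely, given nabla, the horizontal lifts of vector fields and the   *)
(* contractions with sections of the dual of G generate an F-submodule P of T *)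
(* mapped isomorphically onto T/JT. Locally T is the direct sum of the e_I P, *)
(* for e_I the exterior monomials in a basis of G, since O is free over F; so *)
(* there is a unique O-linear isomorphism T -> gr T sending Z in P to its     *)
(* class in T/JT, and it is a global trivialization.                          *)

From HB Require Import structures.
Require Import Defs.
From mathcomp Require Import all_boot all_order all_algebra.
From mathcomp Require Import complex.
From mathcomp Require Import all_classical all_reals all_analysis.

Set Implicit Arguments.
Unset Strict Implicit.
Unset Printing Implicit Defensive.

Import Order.TTheory GRing.Theory Num.Theory.

Local Open Scope classical_set_scope.
Local Open Scope ring_scope.

(** * Sheaves of algebras *)

(** All three conditions express one datum: an F-linear way to lift vector fields on M to
    derivations of O.

    A derivation of O is determined by its values on F and G ([sDer_eq]), and values obeying the
    evident Leibniz rules extend to O ([sder_ext]). In degree 0, a lift of X is thus an operator on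
    G satisfying the Leibniz rule for X ([lift_exists]). Reading off the action on G turns a section
    of gamma into a connection ([splits_connection]), and conversely ([nabla_splits]). Exactness of
    the sequence holds for every locally free G, since locally the flat connection of a basis lifts
    any vector field ([sequence_is_exact]).

    Two lifts of X to T_0 differ by an element of JT ([lift_filt1]), so X has a canonical class in
    T/JT, the degree 0 part of gr T. If the cocycle of T is a coboundary, the local trivializations
    corrected by it agree on overlaps ([unit_data]); the class of X then has a global preimage E in
    T ([unit_lift_exists]), F-linear in X and congruent to the local lifts modulo JT. E need not
    have degree 0, but g -> pi_1(E g) is a connection ([unit_lift_connection]).

    Conversely, a connection singles out representatives in T of the sections of T/JT, the
    [principal] derivations. Over a basis of G, every derivation is a sum of products e_I Z_I of
    exterior monomials with principal derivations ([principal_expansion]); membership in J^p T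
    forces Z_I = 0 for |I| < p ([filt_components]), and the classes of the Z_I are likewise
    independent in gr T ([symb_free]). Sending each e_I Z_I to e_I times the class of Z_I is
    independent of the basis, hence global, and it is a trivialization with trivial cocycle
    ([connection_unit]). *)

Lemma locallyW (M : topologicalType) (U : opens M)
    (P : forall V : opens M, V `<=` U -> Prop) :
  P U (@subset_refl _ (U : set M)) -> locally_on P.
Proof. by move=> h x Ux; exists U, (@subset_refl _ (U : set M)). Qed.

(** Uniqueness makes local solutions agree on overlaps, so they glue. The cover used consists of all
    open subsets carrying a solution, hence the glued section restricts to every one of them. *)
Lemma glue_unique (M : topologicalType) (E : opens M -> Type)
    (res : forall U V : opens M, V `<=` U -> E U -> E V) (U : opens M)
    (P : forall V : opens M, V `<=` U -> E V -> Prop) :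
  is_sheaf res ->
  (forall (V W : opens M) (s : V `<=` U) (t : W `<=` V) (s' : W `<=` U) v,
     P V s v -> P W s' (res _ _ t v)) ->
  (forall (V : opens M) (s : V `<=` U) v w, P V s v -> P V s w -> v = w) ->
  locally_on (fun V s => exists v, P V s v) ->
  exists v : E U, forall (V : opens M) (s : V `<=` U) w,
    P V s w -> res _ _ s v = w.
Proof.
move=> sh Pres Puniq Pex.
pose I := {V : opens M & {s : V `<=` U | exists v, P V s v}}.
pose W (i : I) := projT1 i.
have sW (i : I) : W i `<=` U by case: i => V [].
have ex (i : I) : exists v, P (W i) (sW i) v.
  by case: i (sW i) => V [s h] /= s'; rewrite (Prop_irrelevance s' s).
pose v i := sval (cid (ex i)).
have vP i : P (W i) (sW i) (v i) by rewrite /v; case: cid.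
have cov : U `<=` \bigcup_i W i.
  move=> x Ux; have [V [s [Vx e]]] := Pex x Ux.
  by exists (existT _ V (exist _ s e)).
have [_ gl] := sh _ _ _ sW cov.
have [|t ht] := gl v.
  move=> i j V si sj; apply: (Puniq V (subset_trans si (sW i))).
    exact: Pres (vP i).
  exact: Pres (vP j).
exists t => V s w h.
pose i : I := existT _ V (exist _ s (ex_intro _ w h)).
have := ht i; rewrite /= -/(W i) => e.
have vw := vP i; move: vw; rewrite -e; move: (sW i) => /= s'.
by rewrite (Prop_irrelevance s' s) => h'; exact: Puniq h' h.
Qed.

Definition mk_rmorph (A B : pzRingType) (f : A -> B) (f1 : f 1 = 1)
    (fD : forall a b, f (a + b) = f a + f b)
    (fM : forall a b, f (a * b) = f a * f b) : {rmorphism A -> B} :=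
  HB.pack f
    (GRing.isNmodMorphism.Build A B f
      (conj (addrI (f 0) (etrans (esym (fD 0 0))
         (etrans (congr1 f (addr0 0)) (esym (addr0 (f 0)))))) fD))
    (GRing.isMonoidMorphism.Build A B f (conj f1 fM)).

(** * Subsheaves of algebras *)

Section SubAlgebra.
Context (K : numFieldType) (M : topologicalType) (A : algSheaf K M).

Record subAlg := SubAlg {
  aset :> forall U, set (A U);
  aset_cst : forall U c, aset (acst A U c);
  asetB : forall U (a b : A U), aset a -> aset b -> aset (a - b);
  asetM : forall U (a b : A U), aset a -> aset b -> aset (a * b);
  aset_res : forall (U V : opens M) (s : V `<=` U) (a : A U),
    aset a -> aset (ares s a);
  aset_loc : forall U (a : A U),
    locally_on (fun V (s : V `<=` U) => aset (ares s a)) -> aset a }.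

Variable S : subAlg.

Record subAlgSec (U : opens M) := SubAlgSec {
  sasval : A U;
  sasvalP : S U sasval }.

Lemma sasval_inj U : injective (@sasval U).
Proof.
case=> [v hv] [w hw] /= e; case: _ / e hw => hw.
by rewrite (Prop_irrelevance hv hw).
Qed.

Section Ring.
Variable U : opens M.

HB.instance Definition _ := gen_eqMixin (subAlgSec U).
HB.instance Definition _ := gen_choiceMixin (subAlgSec U).

Lemma aset0 : S U 0.
Proof. by rewrite -(rmorph0 (acst A U)); exact: aset_cst. Qed.
Lemma aset1 : S U 1.
Proof. by rewrite -(rmorph1 (acst A U)); exact: aset_cst. Qed.
Lemma asetN a : S U a -> S U (- a).
Proof. by rewrite -sub0r; apply: asetB; exact: aset0. Qed.
Lemma asetD a b : S U a -> S U b -> S U (a + b).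
Proof. by move=> Sa Sb; rewrite -[b]opprK; apply/asetB/asetN. Qed.

Definition sas0 : subAlgSec U := SubAlgSec aset0.
Definition sas1 : subAlgSec U := SubAlgSec aset1.
Definition sasN (a : subAlgSec U) := SubAlgSec (asetN (sasvalP a)).
Definition sasD (a b : subAlgSec U) := SubAlgSec (asetD (sasvalP a) (sasvalP b)).
Definition sasM (a b : subAlgSec U) := SubAlgSec (asetM (sasvalP a) (sasvalP b)).

Lemma sasDA : associative sasD.
Proof. by move=> *; apply: sasval_inj; exact: addrA. Qed.
Lemma sasDC : commutative sasD.
Proof. by move=> *; apply: sasval_inj; exact: addrC. Qed.
Lemma sasD0 : left_id sas0 sasD.
Proof. by move=> *; apply: sasval_inj; exact: add0r. Qed.
Lemma sasDN : left_inverse sas0 sasN sasD.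
Proof. by move=> *; apply: sasval_inj; exact: addNr. Qed.

HB.instance Definition _ :=
  GRing.isZmodule.Build (subAlgSec U) sasDA sasDC sasD0 sasDN.

Lemma sasMA : associative sasM.
Proof. by move=> *; apply: sasval_inj; exact: mulrA. Qed.
Lemma sasM1l : left_id sas1 sasM.
Proof. by move=> *; apply: sasval_inj; exact: mul1r. Qed.
Lemma sasM1r : right_id sas1 sasM.
Proof. by move=> *; apply: sasval_inj; exact: mulr1. Qed.
Lemma sasMDl : left_distributive sasM sasD.
Proof. by move=> *; apply: sasval_inj; exact: mulrDl. Qed.
Lemma sasMDr : right_distributive sasM sasD.
Proof. by move=> *; apply: sasval_inj; exact: mulrDr. Qed.

HB.instance Definition _ :=
  GRing.Zmodule_isPzRing.Build (subAlgSec U) sasMA sasM1l sasM1r sasMDl sasMDr.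

End Ring.

Definition sas_res (U V : opens M) (s : V `<=` U) :
  {rmorphism subAlgSec U -> subAlgSec V}.
Proof.
apply: (@mk_rmorph _ _ (fun a => SubAlgSec (aset_res s (sasvalP a)))).
- by apply: sasval_inj; exact: rmorph1.
- by move=> a b; apply: sasval_inj; exact: rmorphD.
- by move=> a b; apply: sasval_inj; exact: rmorphM.
Defined.

Definition sas_cst U : {rmorphism K -> subAlgSec U}.
Proof.
apply: (@mk_rmorph _ _ (fun c => SubAlgSec (aset_cst S U c))).
- by apply: sasval_inj; exact: rmorph1.
- by move=> a b; apply: sasval_inj; exact: rmorphD.
- by move=> a b; apply: sasval_inj; exact: rmorphM.
Defined.

Definition subAlgSheaf : algSheaf K M.
Proof.
apply: (@AlgSheaf K M (fun U => subAlgSec U : pzRingType) sas_res sas_cst).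
- by move=> U c a; apply: sasval_inj; exact: acst_central.
- by move=> U V s c; apply: sasval_inj; exact: ares_cst.
- by move=> U s a; apply: sasval_inj; exact: ares_id.
- by move=> U V W sVU sWV sWU a; apply: sasval_inj; exact: ares_comp.
- move=> U I W sW cov; have [sep glue] := @asheaf _ _ A _ _ _ sW cov; split.
    move=> v w h; apply/sasval_inj/sep => i.
    by have /(congr1 (@sasval _)) := h i.
  move=> v h; have [i j V si sj|t ht] := glue (fun i => sasval (v i)).
    by have /(congr1 (@sasval _)) := h i j V si sj.
  have St : S U t.
    apply: aset_loc => x Ux; have [i _ Wx] := cov x Ux.
    by exists (W i), (sW i); split=> //; rewrite ht; exact: sasvalP.
  by exists (SubAlgSec St) => i; apply: sasval_inj; exact: ht.
Defined.

End SubAlgebra.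

(** * Square-zero extensions by bimodules *)

Section SquareZero.
Context (K : numFieldType) (M : topologicalType) (A : algSheaf K M).

(** Left and right actions are kept apart because the signs of odd derivations will be put into the
    left action. By [bl_cst] the constants are central in the extension. *)
Record bimod := Bimod {
  bsec :> opens M -> zmodType;
  bl : forall U, A U -> bsec U -> bsec U;
  br : forall U, bsec U -> A U -> bsec U;
  bres : forall U V : opens M, V `<=` U -> bsec U -> bsec V;
  blDl : forall U a b (n : bsec U), bl (a + b) n = bl a n + bl b n;
  blDr : forall U a (m n : bsec U), bl a (m + n) = bl a m + bl a n;
  blM : forall U a b (n : bsec U), bl (a * b) n = bl a (bl b n);
  bl1 : forall U (n : bsec U), bl 1 n = n;
  brDl : forall U a (m n : bsec U), br (m + n) a = br m a + br n a;
  brDr : forall U a b (n : bsec U), br n (a + b) = br n a + br n b;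
  brM : forall U a b (n : bsec U), br n (a * b) = br (br n a) b;
  br1 : forall U (n : bsec U), br n 1 = n;
  blr : forall U a b (n : bsec U), br (bl a n) b = bl a (br n b);
  bl_cst : forall U c (n : bsec U), bl (acst A U c) n = br n (acst A U c);
  bresD : forall (U V : opens M) (s : V `<=` U) m n,
    bres s (m + n) = bres s m + bres s n;
  bres_bl : forall (U V : opens M) (s : V `<=` U) a n,
    bres s (bl a n) = bl (ares s a) (bres s n);
  bres_br : forall (U V : opens M) (s : V `<=` U) a n,
    bres s (br n a) = br (bres s n) (ares s a);
  bres_id : forall (U : opens M) (s : U `<=` U) n, bres s n = n;
  bres_comp : forall (U V W : opens M) (sVU : V `<=` U) (sWV : W `<=` V)
    (sWU : W `<=` U) n, bres sWV (bres sVU n) = bres sWU n;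
  bsheaf : is_sheaf bres }.

Variable N : bimod.

Lemma bl0 U a : bl a (0 : N U) = 0.
Proof. by apply: (addrI (bl a 0)); rewrite -blDr !addr0. Qed.
Lemma br0 U a : br (0 : N U) a = 0.
Proof. by apply: (addrI (br 0 a)); rewrite -brDl !addr0. Qed.
Lemma bres0 (U V : opens M) (s : V `<=` U) : bres s (0 : N U) = 0.
Proof. by apply: (addrI (bres s 0)); rewrite -bresD !addr0. Qed.

Section Ring.
Variable U : opens M.

Definition sqz_one : A U * N U := (1, 0).
Definition sqz_mul (x y : A U * N U) : A U * N U :=
  (x.1 * y.1, bl x.1 y.2 + br x.2 y.1).

Lemma sqz_mulA : associative sqz_mul.
Proof.
move=> [a l] [b m] [c n]; rewrite /sqz_mul /= mulrA blDr brDl addrA.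
by rewrite blM brM blr.
Qed.
Lemma sqz_mul1l : left_id sqz_one sqz_mul.
Proof. by case=> a n; rewrite /sqz_mul /= mul1r bl1 br0 addr0. Qed.
Lemma sqz_mul1r : right_id sqz_one sqz_mul.
Proof. by case=> a n; rewrite /sqz_mul /= mulr1 br1 bl0 add0r. Qed.
Lemma sqz_mulDl : left_distributive sqz_mul +%R.
Proof.
move=> [a l] [b m] [c n]; rewrite /sqz_mul /=.
by congr pair; rewrite /= ?mulrDl // blDl brDl addrACA.
Qed.
Lemma sqz_mulDr : right_distributive sqz_mul +%R.
Proof.
move=> [a l] [b m] [c n]; rewrite /sqz_mul /=.
by congr pair; rewrite /= ?mulrDr // blDr brDr addrACA.
Qed.

Definition sqz_ring : pzRingType :=
  HB.pack (A U * N U)%type (GRing.Zmodule_isPzRing.Build (A U * N U)%type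
    sqz_mulA sqz_mul1l sqz_mul1r sqz_mulDl sqz_mulDr).

End Ring.

Definition sqz_res (U V : opens M) (s : V `<=` U) :
  {rmorphism sqz_ring U -> sqz_ring V}.
Proof.
apply: (@mk_rmorph _ _ (fun x : sqz_ring U => (ares s x.1, bres s x.2) : sqz_ring V)).
- by congr pair; rewrite ?rmorph1 ?bres0.
- by move=> [a m] [b n]; congr pair; rewrite ?rmorphD ?bresD.
- by move=> [a m] [b n]; congr pair; rewrite ?rmorphM ?bresD ?bres_bl ?bres_br.
Defined.

Definition sqz_cst U : {rmorphism K -> sqz_ring U}.
Proof.
apply: (@mk_rmorph _ _ (fun c => (acst A U c, 0) : sqz_ring U)).
- by congr pair; rewrite ?rmorph1.
- by move=> a b; congr pair; rewrite ?rmorphD ?addr0.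
- by move=> a b; congr pair; rewrite ?rmorphM //= bl0 br0 addr0.
Defined.

(** A morphism from A to this algebra whose first component is the identity is a derivation of A
    with values in N; in this way a universal property produces derivations. *)
Definition sqz : algSheaf K M.
Proof.
apply: (@AlgSheaf K M sqz_ring sqz_res sqz_cst).
- move=> U c [a n]; congr pair; rewrite /= ?acst_central //.
  by rewrite bl0 br0 bl_cst addrC.
- by move=> U V s c; congr pair; rewrite /= ?ares_cst ?bres0.
- by move=> U s [a n]; congr pair; rewrite /= ?ares_id ?bres_id.
- move=> U V W sVU sWV sWU [a n]; congr pair => /=.
    exact: ares_comp.
  exact: bres_comp.
- move=> U I W sW cov; have [sepA glueA] := @asheaf _ _ A _ _ _ sW cov.
  have [sepN glueN] := @bsheaf N _ _ _ sW cov; split.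
    move=> [a m] [b n] h; congr pair.
      by apply: sepA => i; have [] := h i.
    by apply: sepN => i; have [] := h i.
  move=> x h.
  have [i j V si sj|a ha] := glueA (fun i => (x i).1).
    by have [] := h i j V si sj.
  have [i j V si sj|n hn] := glueN (fun i => (x i).2).
    by have [] := h i j V si sj.
  exists (a, n) => i; rewrite /= ha hn.
  by case: (x i).
Defined.

End SquareZero.

(** * Generators and low-degree projections of the exterior algebra *)

Section Exterior.
Context (K : numFieldType) (M : topologicalType).
Context (F : comAlgSheaf K M) (G : modSheaf F) (O : extAlg G).

Local Notation al := (ealpha O _).
Local Notation io := (@eiota _ _ _ _ O _).

Lemma eiotaD U (g h : G U) : io (g + h) = io g + io h.
Proof. by rewrite -[g]scale1r eiotaP rmorph1 mul1r scale1r. Qed.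

Lemma eiota0 U : io (0 : G U) = 0.
Proof. by apply: (addrI (io 0)); rewrite -eiotaD !addr0. Qed.

Lemma eiotaZ U (f : F U) (g : G U) : io (f *: g) = al f * io g.
Proof. by rewrite -[f *: g]addr0 eiotaP eiota0 addr0. Qed.

Lemma eiota_sum U (I : finType) (P : pred I) (g : I -> G U) :
  io (\sum_(i | P i) g i) = \sum_(i | P i) io (g i).
Proof. exact: (big_morph _ (@eiotaD U) (@eiota0 U)). Qed.

Lemma oddeven U (a : O U) : sproj O false a + sproj O true a = a.
Proof. exact: sproj_sum. Qed.

Lemma even_central U (x a : O U) : spar false x -> x * a = a * x.
Proof.
move=> hx; rewrite -[a]oddeven mulrDr mulrDl.
by rewrite !(scommute hx (spar_proj _ a)) !mul1r.
Qed.

Lemma ealphaC U (f : F U) (a : O U) : al f * a = a * al f.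
Proof. exact/even_central/ealpha_even. Qed.

(** The least family containing F and closed under sums, left multiplication by G and gluing,
    encoded by quantifying over all such families; it serves as an induction principle. *)
Definition generated U (a : O U) := forall P : forall V, O V -> Prop,
  (forall V (f : F V), P V (al f)) ->
  (forall V a b, P V a -> P V b -> P V (a + b)) ->
  (forall V g a, P V a -> P V (io g * a)) ->
  (forall (V : opens M) (a : O V),
    locally_on (fun W (s : W `<=` V) => P W (ares s a)) -> P V a) ->
  P U a.

Lemma generated_al U (f : F U) : generated (al f).
Proof. by move=> P Pf *; exact: Pf. Qed.
Lemma generatedD U (a b : O U) : generated a -> generated b -> generated (a + b).
Proof.
move=> ha hb P Pf PD Pi Pl; apply: (PD); first exact: (ha P Pf PD Pi Pl).
exact: (hb P Pf PD Pi Pl).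
Qed.
Lemma generated_io U g (a : O U) : generated a -> generated (io g * a).
Proof. by move=> ha P Pf PD Pi Pl; apply: (Pi); exact: (ha P Pf PD Pi Pl). Qed.
Lemma generated_loc U (a : O U) :
  locally_on (fun W (s : W `<=` U) => generated (ares s a)) -> generated a.
Proof.
move=> h P Pf PD Pi Pl; apply: (Pl) => x Ux; have [V [s [Vx hV]]] := h x Ux.
by exists V, s; split=> //; exact: (hV P Pf PD Pi Pl).
Qed.
Lemma generated_res U (a : O U) : generated a ->
  forall (V : opens M) (s : V `<=` U), generated (ares s a).
Proof.
move=> ga; apply: (ga (fun U a => forall (V : opens M) (s : V `<=` U),
  generated (ares s a))) => {U a ga} [U f|U a b ha hb|U g a ha|U a h] V s.
- by rewrite -amor_res; exact: generated_al.
- by rewrite rmorphD; apply: generatedD.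
- by rewrite rmorphM -eiota_res; apply: generated_io.
- apply: generated_loc => x Vx; have [W [t [Wx hW]]] := h x (s x Vx).
  have l := @Defs.subIl M V W; have r := @Defs.subIr M V W.
  exists (opensI V W), l; split=> //.
  by rewrite (ares_comp s l (subset_trans r t)) -(ares_comp t r); exact: hW.
Qed.
Lemma generated_alM U (f : F U) (a : O U) : generated a -> generated (al f * a).
Proof.
move=> ga; move: f; apply: (ga (fun U a => forall f, generated (al f * a)))
  => {U a ga} [U f'|U a b ha hb|U g a ha|U a h] f.
- by rewrite -rmorphM; exact: generated_al.
- by rewrite mulrDr; apply: generatedD.
- by rewrite mulrA ealphaC -mulrA; apply: generated_io.
- apply: generated_loc => x Vx; have [W [t [Wx hW]]] := h x Vx.
  by exists W, t; split=> //; rewrite rmorphM -amor_res.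
Qed.
Lemma generatedM U (a b : O U) : generated a -> generated b -> generated (a * b).
Proof.
move=> ga; move: b; apply: (ga (fun U a => forall b, generated b ->
  generated (a * b))) => {U a ga} [U f|U a b ha hb|U g a ha|U a h] c hc.
- exact: generated_alM.
- by rewrite mulrDl; apply: generatedD; [exact: ha|exact: hb].
- by rewrite -mulrA; apply: generated_io; exact: ha.
- apply: generated_loc => x Vx; have [W [t [Wx hW]]] := h x Vx.
  by exists W, t; split=> //; rewrite rmorphM; apply: hW; exact: generated_res.
Qed.

Lemma generated_cst U c : generated (acst O U c).
Proof. by rewrite -(amor_cst (ealpha O)); exact: generated_al. Qed.

Lemma generatedB U (a b : O U) : generated a -> generated b -> generated (a - b).
Proof.
move=> ha hb; apply: generatedD => //; rewrite -mulN1r.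
apply: generatedM => //; rewrite -(rmorph1 al) -rmorphN; exact: generated_al.
Qed.

Definition generatedAlg : subAlg O := @SubAlg K M O
  (fun U => @generated U : set (O U)) generated_cst generatedB generatedM
  (fun U V s a ha => generated_res ha s) generated_loc.

(** The universal property maps O to its subalgebra of generated sections. Followed by the
    inclusion, this is an endomorphism of O fixing F and G, hence the identity. *)
Lemma all_generated U (a : O U) : generated a.
Proof.
pose B := subAlgSheaf generatedAlg.
have @bet V : {rmorphism F V -> B V}.
  apply: (@mk_rmorph (F V) (B V)
    (fun f => @SubAlgSec _ _ _ generatedAlg V (al f) (generated_al f))).
  - by apply: sasval_inj; exact: rmorph1.
  - by move=> f g; apply: sasval_inj; exact: rmorphD.
  - by move=> f g; apply: sasval_inj; exact: rmorphM.
have gen_io V (g : G V) : generated (io g).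
  by rewrite -[io g]mulr1 -(rmorph1 al); apply: generated_io; exact: generated_al.
pose j V (g : G V) : B V := @SubAlgSec _ _ _ generatedAlg V (io g) (gen_io V g).
have @bm : algMor F B.
  apply: (@AlgMor K M F B bet) => [V c|V W s f]; apply: sasval_inj.
    exact: amor_cst.
  exact: amor_res.
have [||||[k [ka ki]] _] := @euniv _ _ _ _ O B bm j.
- by move=> V f b; apply: sasval_inj; exact: ealphaC.
- by move=> V f g h; apply: sasval_inj; exact: eiotaP.
- by move=> V W s g; apply: sasval_inj; exact: eiota_res.
- by move=> V g; apply: sasval_inj; exact: eiota_sqr.
have @v V : {rmorphism O V -> O V}.
  apply: (@mk_rmorph (O V) (O V) (fun a => sasval (k V a))).
  - by rewrite rmorph1.
  - by move=> b c; rewrite rmorphD.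
  - by move=> b c; rewrite rmorphM.
have @vm : algMor O O.
  apply: (@AlgMor K M O O v) => [V c|V W s b].
    by have /(congr1 (@sasval _ _ _ generatedAlg V)) := amor_cst k V c.
  by have /(congr1 (@sasval _ _ _ generatedAlg W)) := amor_res k s b.
pose idm : algMor O O :=
  @AlgMor K M O O (fun V => idfun) (fun V c => erefl) (fun V W s b => erefl).
have [||||_ uni] := @euniv _ _ _ _ O O (ealpha O) (@eiota _ _ _ _ O).
- exact: ealphaC.
- exact: eiotaP.
- exact: eiota_res.
- exact: eiota_sqr.
have e : vm U a = idm U a.
  apply: uni; split=> // V x.
    by have /(congr1 (@sasval _ _ _ generatedAlg V)) := ka V x.
  by have /(congr1 (@sasval _ _ _ generatedAlg V)) := ki V x.
have -> : a = sasval (k U a) by rewrite -[LHS]e.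
exact: (sasvalP (k U a)).
Qed.

Lemma O_ind U (P : forall V : opens M, V `<=` U -> O V -> Prop) :
  (forall V s (f : F V), P V s (al f)) ->
  (forall V s a b, P V s a -> P V s b -> P V s (a + b)) ->
  (forall V s g a, P V s a -> P V s (io g * a)) ->
  (forall (V : opens M) (s : V `<=` U) a,
    locally_on (fun W (t : W `<=` V) => P W (subset_trans t s) (ares t a)) ->
    P V s a) ->
  forall V s a, P V s a.
Proof.
move=> Pf PD Pi Pl V s a; move: s.
apply: (@all_generated V a (fun V a => forall s : V `<=` U, P V s a)).
- by move=> W f s; exact: Pf.
- by move=> W b c hb hc s; exact: PD.
- by move=> W g b hb s; exact: Pi.
- move=> W b h s; apply: Pl => x Wx; have [X [t [Xx hX]]] := h x Wx.
  by exists X, t; split.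
Qed.

Lemma O_ind0 (P : forall V, O V -> Prop) :
  (forall V (f : F V), P V (al f)) ->
  (forall V a b, P V a -> P V b -> P V (a + b)) ->
  (forall V g a, P V a -> P V (io g * a)) ->
  (forall (V : opens M) (a : O V),
    locally_on (fun W (s : W `<=` V) => P W (ares s a)) -> P V a) ->
  forall V a, P V a.
Proof. by move=> Pf PD Pi Pl V a; exact: all_generated. Qed.

(* F (+) G with G an ideal of square zero receives a morphism from O, whose   *)
(* components are the projections onto the parts of degree 0 and 1.           *)
Definition G_bimod : bimod F.
Proof.
apply: (@Bimod K M F (fun U => G U : zmodType) (fun U f g => f *: g)
  (fun U g f => f *: g) (fun U V s g => mres s g)) => /=.
- by move=> *; exact: scalerDl.
- by move=> *; exact: scalerDr.
- by move=> *; rewrite scalerA.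
- by move=> *; rewrite scale1r.
- by move=> *; exact: scalerDr.
- by move=> *; exact: scalerDl.
- by move=> U a b n; rewrite scalerA [b * a]calgC.
- by move=> *; rewrite scale1r.
- by move=> U a b n; rewrite !scalerA [b * a]calgC.
- by [].
- by move=> *; exact: mresD.
- by move=> *; exact: mresZ.
- by move=> *; exact: mresZ.
- by move=> *; exact: mres_id.
- by move=> *; exact: mres_comp.
- exact: msheaf.
Defined.

Definition trunc_beta : algMor F (sqz G_bimod).
Proof.
have @b U : {rmorphism F U -> sqz G_bimod U}.
  apply: (@mk_rmorph _ _ (fun f => (f, 0) : sqz G_bimod U)).
  - by [].
  - by move=> f g; congr pair; rewrite addr0.
  - by move=> f g; congr pair; rewrite /= !scaler0 addr0.
apply: (@AlgMor K M F (sqz G_bimod) b) => [//|U V s f].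
by congr pair; rewrite /= mres0.
Defined.

Lemma trunc_exists : exists k : algMor O (sqz G_bimod),
  (forall U (f : F U), k U (al f) = (f, 0)) /\
  (forall U (g : G U), k U (io g) = (0, g)).
Proof.
have [||||h _] := @euniv _ _ _ _ O _ trunc_beta (fun U g => (0, g)); last exact: h.
- move=> U f [a n]; congr pair; rewrite /= ?[f * a]calgC //.
  by rewrite !scaler0 addr0 add0r.
- move=> U f g h; congr pair; rewrite /= ?mulr0 ?addr0 //.
  by rewrite scale0r addr0.
- by move=> U V s g; congr pair; rewrite /= rmorph0.
- by move=> U g; congr pair; rewrite /= ?mulr0 // !scale0r addr0.
Qed.

Definition trunc := sval (cid trunc_exists).
Definition pi0 U (a : O U) : F U := (trunc U a).1.
Definition pi1 U (a : O U) : G U := (trunc U a).2.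

Lemma pi0_al U (f : F U) : pi0 (al f) = f.
Proof. by rewrite /pi0 /trunc; case: cid => k [ka ki] /=; rewrite ka. Qed.
Lemma pi1_al U (f : F U) : pi1 (al f) = 0.
Proof. by rewrite /pi1 /trunc; case: cid => k [ka ki] /=; rewrite ka. Qed.
Lemma pi0_io U (g : G U) : pi0 (io g) = 0.
Proof. by rewrite /pi0 /trunc; case: cid => k [ka ki] /=; rewrite ki. Qed.
Lemma pi1_io U (g : G U) : pi1 (io g) = g.
Proof. by rewrite /pi1 /trunc; case: cid => k [ka ki] /=; rewrite ki. Qed.
Lemma pi0D U (a b : O U) : pi0 (a + b) = pi0 a + pi0 b.
Proof. by rewrite /pi0 rmorphD. Qed.
Lemma pi1D U (a b : O U) : pi1 (a + b) = pi1 a + pi1 b.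
Proof. by rewrite /pi1 rmorphD. Qed.
Lemma pi0M U (a b : O U) : pi0 (a * b) = pi0 a * pi0 b.
Proof. by rewrite /pi0 rmorphM. Qed.
Lemma pi1M U (a b : O U) : pi1 (a * b) = pi0 a *: pi1 b + pi0 b *: pi1 a.
Proof. by rewrite /pi1 rmorphM. Qed.
Lemma pi00 U : pi0 (0 : O U) = 0.
Proof. by rewrite /pi0 rmorph0. Qed.
Lemma pi0_res (U V : opens M) (s : V `<=` U) (a : O U) :
  pi0 (ares s a) = ares s (pi0 a).
Proof. by rewrite /pi0 amor_res. Qed.
Lemma pi1_res (U V : opens M) (s : V `<=` U) (a : O U) :
  pi1 (ares s a) = mres s (pi1 a).
Proof. by rewrite /pi1 amor_res. Qed.

Lemma ealpha_inj U : injective (ealpha O U).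
Proof. by move=> f g /(congr1 (@pi0 U)); rewrite !pi0_al. Qed.
Lemma eiota_inj U : injective (@eiota _ _ _ _ O U).
Proof. by move=> f g /(congr1 (@pi1 U)); rewrite !pi1_io. Qed.

Lemma sproj_io k U (g : G U) (a : O U) :
  sproj O k (io g * a) = io g * sproj O (~~ k) a.
Proof.
rewrite -[a in LHS]oddeven mulrDr sprojD.
have h l := sparM (eiota_odd O g) (spar_proj l a).
rewrite (sproj_other k (h false)) (sproj_other k (h true)) /=.
by case: k; rewrite /= ?addr0 ?add0r.
Qed.

Lemma sproj_al k U (f : F U) : sproj O k (al f) = if k then 0 else al f.
Proof. by rewrite (sproj_other _ (ealpha_even O f)); case: k. Qed.

Lemma pi0_odd U (a : O U) : spar true a -> pi0 a = 0.
Proof.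
move=> <-; move: U a; apply: O_ind0.
- by move=> V f; rewrite sproj_al pi00.
- by move=> V a b ha hb; rewrite sprojD pi0D ha hb addr0.
- by move=> V g a _; rewrite sproj_io pi0M pi0_io mul0r.
- move=> V a h; apply: asep => x Vx; have [W [s [Wx hW]]] := h x Vx.
  by exists W, s; split=> //; rewrite -pi0_res -sproj_res hW rmorph0.
Qed.

(** The sign of the Leibniz rule for parity k: the identity for k even, the parity automorphism for
    k odd. It frees the rule D(ab) = D(a) b + tw(a) D(b) from homogeneity of a. *)
Definition tw (k : bool) U (a : O U) : O U :=
  sproj O false a + (-1) ^+ k * sproj O true a.

Lemma twD k U (a b : O U) : tw k (a + b) = tw k a + tw k b.
Proof. by rewrite /tw !sprojD mulrDr addrACA. Qed.

Lemma tw_par k j U (a : O U) : spar j a -> tw k a = (-1) ^+ (j && k) * a.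
Proof.
move=> h; rewrite /tw !(sproj_other _ h).
by case: j {h} => /=; rewrite ?mulr0 ?addr0 ?add0r ?mul1r.
Qed.

Lemma tw_al k U (f : F U) : tw k (al f) = al f.
Proof. by rewrite (tw_par _ (ealpha_even O f)) mul1r. Qed.

Lemma twM k U (a b : O U) : tw k (a * b) = tw k a * tw k b.
Proof.
rewrite -[a]oddeven -[b]oddeven.
move: (sproj O false a) (sproj O true a) (sproj O false b) (sproj O true b)
  (spar_proj false a) (spar_proj true a) (spar_proj false b) (spar_proj true b).
move=> a0 a1 b0 b1 ha0 ha1 hb0 hb1; rewrite [in LHS]mulrDl ![in LHS]mulrDr !twD.
rewrite (tw_par k (sparM ha0 hb0)) (tw_par k (sparM ha0 hb1)).
rewrite (tw_par k (sparM ha1 hb0)) (tw_par k (sparM ha1 hb1)).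
rewrite (tw_par k ha0) (tw_par k ha1) (tw_par k hb0) (tw_par k hb1) /=.
by rewrite mulrDl !mulrDr; case: k; rewrite /= ?expr1 ?expr0 ?mul1r ?mulN1r
  ?mulrN ?mulNr ?opprK.
Qed.

Lemma tw_res k (U V : opens M) (s : V `<=` U) (a : O U) :
  tw k (ares s a) = ares s (tw k a).
Proof. by rewrite /tw !sproj_res rmorphD rmorphM rmorph_sign. Qed.

Lemma tw_cst k U c : tw k (acst O U c) = acst O U c.
Proof. by rewrite -(amor_cst (ealpha O)) tw_al. Qed.

Lemma pi0_tw k U (a : O U) : pi0 (tw k a) = pi0 a.
Proof.
rewrite -[a in RHS]oddeven /tw !pi0D pi0M.
by rewrite (pi0_odd (spar_proj true a)) mulr0.
Qed.

Local Opaque tw.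

Lemma sder_Leibniz k U (D : endo O U) : is_sder k D ->
  forall (V : opens M) (s : V `<=` U) a b,
  D V s (a * b) = D V s a * b + tw k a * D V s b.
Proof.
move=> hD V s a b; have [_ l] := hD V s.
rewrite -[a]oddeven mulrDl efunD twD !efunD.
rewrite [X in _ = X + _]mulrDl [X in _ = _ + X]mulrDl.
rewrite (l _ _ _ (spar_proj false a)) (l _ _ _ (spar_proj true a)).
rewrite (tw_par k (spar_proj false a)) (tw_par k (spar_proj true a)).
by rewrite addrACA -!mulrA.
Qed.

End Exterior.

(** * Extension of derivations from F and G *)

Section Extension.
Context (K : numFieldType) (M : topologicalType).
Context (F : comAlgSheaf K M) (G : modSheaf F) (O : extAlg G).

Local Notation al := (ealpha O _).
Local Notation io := (@eiota _ _ _ _ O _).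

Lemma opensI_subl (U V W : opens M) : V `<=` U -> opensI V W `<=` opensI U W.
Proof. by move=> s x [/s]. Qed.

Lemma opensI_glb (U V W : opens M) : W `<=` U -> W `<=` V -> W `<=` opensI U V.
Proof. by move=> s t x Wx; split; [exact: s|exact: t]. Qed.

Local Notation sl V W := (@Defs.subIl M V W).
Local Notation sr V W := (@Defs.subIr M V W).

(* The O-bimodule of the sections of O over the traces on U of open sets, on  *)
(* which the left action of an odd section is multiplied by (-1)^k: a         *)
(* derivation of parity k over U is a section of the square-zero extension.   *)
Definition O_bimod (k : bool) (U : opens M) : bimod O.
Proof.
unshelve refine (@Bimod K M O (fun V => O (opensI V U) : zmodType)
  (fun V a n => tw k (ares (sl V U) a) * n)
  (fun V n a => n * ares (sl V U) a)
  (fun V W s n => ares (opensI_subl s) n) _ _ _ _ _ _ _ _ _ _ _ _ _ _ _ _) => /=.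
- by move=> V a b n; rewrite rmorphD twD [LHS]mulrDl.
- by move=> *; rewrite [LHS]mulrDr.
- by move=> V a b n; rewrite rmorphM twM mulrA.
- by move=> V n; rewrite rmorph1 -(rmorph1 (acst O _)) tw_cst rmorph1 mul1r.
- by move=> *; rewrite [LHS]mulrDl.
- by move=> *; rewrite rmorphD mulrDr.
- by move=> *; rewrite rmorphM mulrA.
- by move=> *; rewrite rmorph1 mulr1.
- by move=> *; rewrite mulrA.
- by move=> V c n; rewrite ares_cst tw_cst acst_central.
- by move=> *; rewrite rmorphD.
- move=> V W s a n; rewrite rmorphM -tw_res.
  by rewrite !(ares_comp _ _ (subset_trans (sl W U) s)).
- move=> V W s a n; rewrite rmorphM.
  by rewrite !(ares_comp _ _ (subset_trans (sl W U) s)).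
- by move=> *; exact: ares_id.
- by move=> *; exact: ares_comp.
move=> V I W sW cov.
have cov' : opensI V U `<=` \bigcup_i opensI (W i) U.
  by move=> x [Vx Ux]; have [i _ Wx] := cov x Vx; exists i.
have [sep glue] := @asheaf _ _ O _ _ _ (fun i => opensI_subl (sW i)) cov'.
split=> [a b h|a h]; first exact: sep.
apply: glue => i j X si sj.
have hi := opensI_glb (subset_trans si (sl _ _)) (subset_trans si (sr _ _)).
have Xi := subset_trans si (sl _ _).
have Xj := subset_trans sj (sl _ _).
have /(congr1 (ares (opensI_glb (@subset_refl _ _) (subset_trans si (sr _ _))))) :=
  h i j X Xi Xj.
by rewrite !(ares_comp _ _ si) !(ares_comp _ _ sj).
Defined.

Section Sder.
Variables (U : opens M) (k : bool).
Variable dF : forall V : opens M, V `<=` U -> F V -> O V.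
Variable dG : forall V : opens M, V `<=` U -> G V -> O V.
Hypothesis dF_par : forall (V : opens M) (s : V `<=` U) f, spar k (dF s f).
Hypothesis dFD : forall (V : opens M) (s : V `<=` U) f f',
  dF s (f + f') = dF s f + dF s f'.
Hypothesis dFM : forall (V : opens M) (s : V `<=` U) f f',
  dF s (f * f') = dF s f * al f' + al f * dF s f'.
Hypothesis dF_cst : forall (V : opens M) (s : V `<=` U) c, dF s (acst F V c) = 0.
Hypothesis dF_res : forall (V W : opens M) (s : V `<=` U) (t : W `<=` V)
  (s' : W `<=` U) f, dF s' (ares t f) = ares t (dF s f).
Hypothesis dG_par : forall (V : opens M) (s : V `<=` U) g, spar (~~ k) (dG s g).
Hypothesis dGP : forall (V : opens M) (s : V `<=` U) f g h,
  dG s (f *: g + h) = dF s f * io g + al f * dG s g + dG s h.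
Hypothesis dG_res : forall (V W : opens M) (s : V `<=` U) (t : W `<=` V)
  (s' : W `<=` U) g, dG s' (mres t g) = ares t (dG s g).

(** The pairs (f, dF f) and (g, dG g) satisfy the relations of the exterior algebra in the
    square-zero extension of O by [O_bimod]. The second component of the induced morphism is the
    derivation. *)
Lemma sder_ext : exists D : sDer O U,
  [/\ forall (V : opens M) (s : V `<=` U) f, sdapp D s (al f) = dF s f,
      forall (V : opens M) (s : V `<=` U) g, sdapp D s (io g) = dG s g &
      is_sder k (Defs.ssval D : endo O U)].
Proof.
pose B := sqz (O_bimod k U).
have tw1 V : tw k (1 : O V) = 1 by rewrite -(rmorph1 (acst O V)) tw_cst.
have [bet betE] : {b : forall V, {rmorphism F V -> B V} |
    forall V f, b V f = (al f, dF (sr V U) (ares (sl V U) f)) :> B V}.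
  suff b V : {b : {rmorphism F V -> B V} |
      forall f, b f = (al f, dF (sr V U) (ares (sl V U) f)) :> B V}.
    by exists (fun V => sval (b V)) => V; exact: svalP (b V).
  pose b (f : F V) : B V := (al f, dF (sr V U) (ares (sl V U) f)).
  have b1 : b 1 = 1.
    by rewrite /b -(rmorph1 (acst F V)) ares_cst dF_cst rmorph1 rmorph1.
  have bD f g : b (f + g) = b f + b g by rewrite /b !rmorphD dFD.
  have bM f g : b (f * g) = b f * b g.
    rewrite /b !rmorphM dFM; congr pair => /=.
    by rewrite -!amor_res tw_al addrC.
  by exists (mk_rmorph b1 bD bM).
have [bm bmE] : {b : algMor F B | forall V f,
    b V f = (al f, dF (sr V U) (ares (sl V U) f)) :> B V}.
  have h1 V c : bet V (acst F V c) = acst B V c.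
    by rewrite betE; congr pair; rewrite /= ?amor_cst // ares_cst dF_cst.
  have h2 (V W : opens M) (s : W `<=` V) a :
      bet W (ares s a) = ares s (bet V a).
    rewrite !betE; congr pair => /=; first exact: amor_res.
    rewrite -(dF_res _ _ (sr W U)).
    by rewrite !(ares_comp _ _ (subset_trans (sl W U) s)).
  by exists (@AlgMor K M F B bet h1 h2).
pose j V (g : G V) : B V := (io g, dG (sr V U) (mres (sl V U) g)).
have [||||[kap [ka ki]] _] := @euniv _ _ _ _ O B bm j.
(* Centrality of F: moving [dF f], of parity k, across b costs exactly the sign put into the left
   action. *)
- move=> V f [b n]; rewrite bmE; congr pair => /=; first exact: ealphaC.
  rewrite -!amor_res tw_al ealphaC addrC; congr (_ + _).
  move: (ares _ b) => {}b; rewrite -[b]oddeven mulrDr twD mulrDl.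
  rewrite !(scommute (dF_par _ _) (spar_proj _ b)).
  by rewrite !(tw_par _ (spar_proj _ b)) !andbT ![k && _]andbC !mulrA.
- move=> V f g h; rewrite bmE; congr pair => /=; first exact: eiotaP.
  rewrite mresP dGP -!amor_res -!eiota_res tw_al.
  by rewrite [X in X + _]addrC.
- move=> V W s g; congr pair => /=; first exact: eiota_res.
  rewrite -(dG_res _ _ (sr W U)).
  by rewrite !(mres_comp _ _ (subset_trans (sl W U) s)).
(* The square vanishes: [dG g] has parity opposite to k, so exchanging it with g gives the sign
   opposite to that of the twisted left action. *)
- move=> V g; congr pair => /=; first exact: eiota_sqr.
  rewrite -!eiota_res (tw_par _ (eiota_odd O _)).
  rewrite (scommute (dG_par _ _) (eiota_odd O _)).
  by case: (k); rewrite /= ?expr0 ?expr1 ?mul1r ?mulN1r ?mulNr ?addrN ?addNr.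
have kap1 V a : (kap V a).1 = a.
  move: V a; apply: O_ind0 => [V f|V a b ha hb|V g a ha|V a h].
  - by rewrite ka bmE.
  - by rewrite rmorphD /= ha hb.
  - by rewrite rmorphM ki /= ha.
  - apply: asep => x Vx; have [W [s [Wx hW]]] := h x Vx.
    by exists W, s; split=> //; rewrite -[RHS]hW amor_res.
(* The second component lives over the trace of V on U, which for V inside U has the same points but
   is a different term. *)
pose VU (V : opens M) (s : V `<=` U) := opensI_glb (@subset_refl _ (V : set M)) s.
have [D DE] : {D : endo O U | forall (V : opens M) (s : V `<=` U) a,
    D V s a = ares (VU V s) (kap V a).2}.
  pose d (V : opens M) (s : V `<=` U) a := ares (VU V s) (kap V a).2.
  have h1 (V : opens M) (s : V `<=` U) c a b :
      d V s (acst O V c * a + b) = acst O V c * d V s a + d V s b.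
    rewrite /d !rmorphD !rmorphM amor_cst /= mul0r addr0.
    by rewrite ares_cst tw_cst rmorphM ares_cst.
  have h2 (V W : opens M) (s : V `<=` U) (t : W `<=` V) (s' : W `<=` U) a :
      d W s' (ares t a) = ares t (d V s a).
    by rewrite /d amor_res /= !(ares_comp _ _ (opensI_glb t s')).
  by exists (@Endo K M O U d h1 h2).
have DL (V : opens M) (s : V `<=` U) a b :
    D V s (a * b) = D V s a * b + tw k a * D V s b.
  rewrite !DE rmorphM /= !kap1 rmorphD !rmorphM -tw_res.
  by rewrite !(ares_comp _ _ (@subset_refl _ (V : set M))) !ares_id addrC.
have Dal (V : opens M) (s : V `<=` U) f : D V s (al f) = dF s f.
  rewrite DE ka bmE /= -(dF_res _ _ s) (ares_comp _ _ (@subset_refl _ (V : set M))).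
  by rewrite ares_id.
have Dio (V : opens M) (s : V `<=` U) g : D V s (io g) = dG s g.
  rewrite DE ki /= -(dG_res _ _ s) (mres_comp _ _ (@subset_refl _ (V : set M))).
  by rewrite mres_id.
have Dpar (V : opens M) (s : V `<=` U) a :
    forall j, spar (addb j k) (D V s (sproj O j a)).
  move: V s a; apply: O_ind => [V s f|V s a b ha hb|V s g a ha|V s a h] i.
  - rewrite sproj_al; case: i => /=; last by rewrite Dal; exact: dF_par.
    by rewrite efun0; exact: spar0.
  - by rewrite sprojD efunD; apply: sparD; [exact: ha|exact: hb].
  - rewrite sproj_io DL Dio; apply: sparD.
      have := sparM (dG_par s g) (spar_proj (~~ i) a).
      by rewrite addNb addbN negbK addbC.
    have := sparM (eiota_odd O g) (ha (~~ i)).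
    rewrite (tw_par _ (eiota_odd O g)).
    rewrite addTb addNb negbK => h.
    case: (true && k); rewrite ?expr0 ?expr1 ?mul1r // mulN1r mulNr.
    by rewrite /spar /= -mulN1r -(rmorph1 (acst O V)) -rmorphN sproj_cstM h.
  - rewrite /spar /=; apply: asep => x Vx; have [W [t [Wx hW]]] := h x Vx.
    exists W, t; split=> //; rewrite -sproj_res.
    by rewrite -!(efun_res D s t (subset_trans t s)) -sproj_res; exact: hW.
have hD : is_sder k D.
  move=> V s; split=> [i a <-|i a b hi]; first exact: Dpar.
  by rewrite DL (tw_par _ hi) mulrA.
by exists (@SubSec K M O _ (sDerSub O) U D (sder_superder hD)).
Qed.

End Sder.

Lemma sder_eq0 k (U : opens M) (D : endo O U) : is_sder k D ->
  (forall (V : opens M) (s : V `<=` U) f, D V s (al f) = 0) ->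
  (forall (V : opens M) (s : V `<=` U) g, D V s (io g) = 0) ->
  D = 0.
Proof.
move=> hD hf hg; apply: endo_ext => V s a /=.
move: V s a; apply: O_ind => [V s f|V s a b ha hb|V s g a ha|V s a h].
- exact: hf.
- by rewrite efunD ha hb addr0.
- by rewrite (sder_Leibniz hD) hg ha mul0r mulr0 addr0.
- apply: asep => x Vx; have [W [t [Wx hW]]] := h x Vx.
  exists W, t; split=> //.
  by rewrite -(efun_res D s t (subset_trans t s)) hW rmorph0.
Qed.

(** Each homogeneous component of the difference vanishes on F and G, hence on all of O by the
    Leibniz rule. *)
Lemma sDer_eq (U : opens M) (D E : sDer O U) :
  (forall (V : opens M) (s : V `<=` U) f,
    sdapp D s (al f) = sdapp E s (al f)) ->
  (forall (V : opens M) (s : V `<=` U) g,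
    sdapp D s (io g) = sdapp E s (io g)) ->
  D = E.
Proof.
move=> hf hg; apply/eqP; rewrite -subr_eq0; apply/eqP.
have [X eX] : exists X, X = D - E by exists (D - E).
rewrite -eX.
have {hf} hf (V : opens M) (s : V `<=` U) f : sdapp X s (al f) = 0.
  by rewrite eX; apply/eqP; rewrite subr_eq0; apply/eqP; exact: hf.
have {hg} hg (V : opens M) (s : V `<=` U) f : sdapp X s (io f) = 0.
  by rewrite eX; apply/eqP; rewrite subr_eq0; apply/eqP; exact: hg.
apply: Defs.ssval_inj; rewrite -[LHS]eproj_sum.
have /is_superderP hX := Defs.ssvalP X.
have e k : eproj k (Defs.ssval X : endo O U) = 0.
  apply: (sder_eq0 (hX k)) => V s f /=.
    rewrite !sproj_al /= efun0 sproj0 addr0.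
    by rewrite [efun _ _ _]hf sproj0.
  rewrite !(sproj_other _ (eiota_odd O f)) /= efun0 sproj0 add0r.
  by rewrite [efun _ _ _]hg sproj0.
by rewrite !e addr0.
Qed.

(** Sections of F are even, so neither parity component of D contributes a sign. *)
Lemma sdapp_alM (U : opens M) (D : sDer O U) (V : opens M) (s : V `<=` U) f a :
  sdapp D s (al f * a) = sdapp D s (al f) * a + al f * sdapp D s a.
Proof.
rewrite /sdapp -[Defs.ssval D : endo O U]eproj_sum /=.
have /is_superderP hX := Defs.ssvalP D.
have := sder_Leibniz (hX false) s (al f) a.
have := sder_Leibniz (hX true) s (al f) a.
rewrite !tw_al /= => -> ->.
by rewrite [in RHS]mulrDl [in RHS]mulrDr addrACA.
Qed.

End Extension.

(** * The exact sequence and connections *)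

Lemma mres_sum (K : numFieldType) (M : topologicalType) (A : algSheaf K M)
    (E : modSheaf A) (U V : opens M) (s : V `<=` U) (I : finType) (P : pred I)
    (v : I -> E U) :
  mres s (\sum_(i | P i) v i) = \sum_(i | P i) mres s (v i).
Proof.
apply: (big_morph (fun v : E U => mres s v)) => [v' w|]; first exact: mresD.
exact: mres0.
Qed.

Section Sequence.
Context (K : numFieldType) (M : topologicalType).
Context (F : comAlgSheaf K M) (G : modSheaf F) (O : extAlg G).

Local Notation al := (ealpha O _).
Local Notation io := (@eiota _ _ _ _ O _).

Lemma sdapp_res (U : opens M) (D : sDer O U) (V W : opens M) (s : V `<=` U)
    (t : W `<=` V) (s' : W `<=` U) a :
  sdapp D s' (ares t a) = ares t (sdapp D s a).
Proof. exact: efun_res. Qed.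

Lemma sdapp_mres (U V : opens M) (s : V `<=` U) (D : sDer O U)
    (W : opens M) (t : W `<=` V) (s' : W `<=` U) a :
  sdapp (mres s D) t a = sdapp D s' a.
Proof. by rewrite (Prop_irrelevance s' (subset_trans t s)). Qed.

Lemma sdappP (U : opens M) (a : O U) (D E : sDer O U) (V : opens M)
    (s : V `<=` U) x :
  sdapp (a *: D + E) s x = ares s a * sdapp D s x + sdapp E s x.
Proof. by []. Qed.

Lemma sdapp_add (U : opens M) (D E : sDer O U) (V : opens M) (s : V `<=` U) x :
  sdapp (D + E) s x = sdapp D s x + sdapp E s x.
Proof. by []. Qed.

Lemma sdappD (U : opens M) (D : sDer O U) (V : opens M) (s : V `<=` U) a b :
  sdapp D s (a + b) = sdapp D s a + sdapp D s b.
Proof. exact: efunD. Qed.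

Lemma sdapp0 (U : opens M) (D : sDer O U) (V : opens M) (s : V `<=` U) :
  sdapp D s 0 = 0.
Proof. exact: efun0. Qed.

Lemma sdapp_sum (U : opens M) (D : sDer O U) (V : opens M) (s : V `<=` U)
    (I : finType) (P : pred I) (a : I -> O V) :
  sdapp D s (\sum_(i | P i) a i) = \sum_(i | P i) sdapp D s (a i).
Proof. exact: (big_morph _ (@sdappD U D V s) (@sdapp0 U D V s)). Qed.

Lemma sum_sdapp (U V : opens M) (s : V `<=` U) (I : finType) (P : pred I)
    (a : I -> O U) (D : I -> sDer O U) x :
  sdapp (\sum_(i | P i) a i *: D i) s x =
  \sum_(i | P i) ares s (a i) * sdapp (D i) s x.
Proof.
pose f (D : sDer O U) := sdapp D s x.
by rewrite -/(f _) (big_morph f (id1 := 0) (op1 := +%R)).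
Qed.

Lemma sdapp_cst (U : opens M) (D : sDer O U) (V : opens M) (s : V `<=` U) c a :
  sdapp D s (acst O V c * a) = acst O V c * sdapp D s a.
Proof.
have := efunP (Defs.ssval D : endo O U) s c a 0.
by rewrite !addr0 efun0 addr0.
Qed.

Lemma dapp_res (U : opens M) (X : Der F U) (V W : opens M) (s : V `<=` U)
    (t : W `<=` V) (s' : W `<=` U) f :
  dapp X s' (ares t f) = ares t (dapp X s f).
Proof. exact: efun_res. Qed.

Lemma dapp_mres (U V : opens M) (s : V `<=` U) (X : Der F U)
    (W : opens M) (t : W `<=` V) (s' : W `<=` U) f :
  dapp (mres s X) t f = dapp X s' f.
Proof. by rewrite (Prop_irrelevance s' (subset_trans t s)). Qed.

Lemma dappD (U : opens M) (X : Der F U) (V : opens M) (s : V `<=` U) f g :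
  dapp X s (f + g) = dapp X s f + dapp X s g.
Proof. exact: efunD. Qed.

Lemma dappM (U : opens M) (X : Der F U) (V : opens M) (s : V `<=` U) f g :
  dapp X s (f * g) = dapp X s f * g + f * dapp X s g.
Proof. exact: (Defs.ssvalP X). Qed.

Lemma dapp1 (U : opens M) (X : Der F U) (V : opens M) (s : V `<=` U) :
  dapp X s 1 = 0.
Proof.
apply: (addrI (dapp X s 1)); have := dappM X s 1 1.
by rewrite !mulr1 mul1r addr0 => <-.
Qed.

Lemma dapp_cst (U : opens M) (X : Der F U) (V : opens M) (s : V `<=` U) c :
  dapp X s (acst F V c) = 0.
Proof.
have := efunP (Defs.ssval X : endo F U) s c 1 0.
rewrite !addr0 mulr1 [RHS]addrC efun0 add0r -![efun _ _ _]/(dapp X s _).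
by rewrite dapp1 mulr0.
Qed.

Lemma Der_eq (U : opens M) (X Y : Der F U) :
  (forall (V : opens M) (s : V `<=` U) f, dapp X s f = dapp Y s f) -> X = Y.
Proof. by move=> h; apply: Defs.ssval_inj; apply: endo_ext => *; exact: h. Qed.

Lemma mk_Der (U : opens M) (d : forall V : opens M, V `<=` U -> F V -> F V) :
  (forall (V : opens M) (s : V `<=` U) c f g,
    d V s (acst F V c * f + g) = acst F V c * d V s f + d V s g) ->
  (forall (V : opens M) (s : V `<=` U) f g,
    d V s (f * g) = d V s f * g + f * d V s g) ->
  (forall (V W : opens M) (s : V `<=` U) (t : W `<=` V) (s' : W `<=` U) f,
    d W s' (ares t f) = ares t (d V s f)) ->
  exists X : Der F U, forall (V : opens M) (s : V `<=` U) f, dapp X s f = d V s f.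
Proof.
move=> dP dM dr; pose E : endo F U := @Endo K M F U d dP dr.
have hE : is_der E by [].
by exists (@SubSec K M F (endoSheaf F) (@SubSheaf K M F (endoSheaf F)
    (fun U => @is_der K M F U : set (endo F U))
    (@is_der0 K M F) (@is_derP K M F) (@is_der_res K M F) (@is_der_loc K M F))
    U E hE).
Qed.

Lemma Odeg_loc q U (a : O U) :
  locally_on (fun V (s : V `<=` U) => Odeg q (ares s a)) -> Odeg q a.
Proof.
move=> h x Ux; have [V [s [Vx hV]]] := h x Ux.
have [W [t [Wx hW]]] := hV x Vx.
exists W, (subset_trans t s); split=> //.
by rewrite -(ares_comp s t).
Qed.

Lemma Odeg_mono U (f : F U) q (g : 'I_q -> G U) :
  Odeg q (al f * \prod_(j < q) io (g j)).
Proof.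
apply: locallyW; exists 1%N, (fun=> f), (fun=> g).
by rewrite ares_id big_ord_recl big_ord0 addr0.
Qed.

Lemma Odeg0_al U (f : F U) : Odeg 0 (al f).
Proof. by have := Odeg_mono f (fun _ : 'I_0 => 0); rewrite big_ord0 mulr1. Qed.

Lemma OdegD q U (a b : O U) : Odeg q a -> Odeg q b -> Odeg q (a + b).
Proof.
move=> ha hb x Ux; have [V [s [Vx [m [f [g e]]]]]] := ha x Ux.
have [W [t [Wx [n [f' [g' e']]]]]] := hb x Ux.
have l := @Defs.subIl M V W; have r := @Defs.subIr M V W.
exists (opensI V W), (subset_trans l s); split=> //.
exists (m + n)%N,
  (fun i => match fintype.split i with
    | inl i => ares l (f i) | inr i => ares r (f' i) end),
  (fun i j => match fintype.split i with
    | inl i => mres l (g i j) | inr i => mres r (g' i j) end).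
rewrite big_split_ord rmorphD; congr (_ + _).
  rewrite -(ares_comp s l) e rmorph_sum; apply: eq_bigr => i _.
  rewrite -[lshift _ _]/(unsplit (inl i)) unsplitK.
  rewrite rmorphM amor_res rmorph_prod; congr (_ * _).
  by apply: eq_bigr => j _; rewrite eiota_res.
rewrite -(ares_comp t r) e' rmorph_sum; apply: eq_bigr => i _.
rewrite -[rshift _ _]/(unsplit (inr i)) unsplitK.
rewrite rmorphM amor_res rmorph_prod; congr (_ * _).
by apply: eq_bigr => j _; rewrite eiota_res.
Qed.

Lemma Odeg_0 q U : Odeg q (0 : O U).
Proof.
apply: locallyW; exists 0%N, (fun=> 0), (fun _ _ => 0).
by rewrite rmorph0 big_ord0.
Qed.

Lemma Odeg_sum q U (I : finType) (P : pred I) (a : I -> O U) :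
  (forall i, P i -> Odeg q (a i)) -> Odeg q (\sum_(i | P i) a i).
Proof.
move=> h; apply: (big_ind (fun a => Odeg q a)) => //.
  exact: Odeg_0.
by move=> *; apply: OdegD.
Qed.

Lemma Odeg_alM q U (f : F U) (a : O U) : Odeg q a -> Odeg q (al f * a).
Proof.
move=> h x Ux; have [V [s [Vx [m [f' [g e]]]]]] := h x Ux.
exists V, s; split=> //; exists m, (fun i => ares s f * f' i), g.
rewrite rmorphM e mulr_sumr; apply: eq_bigr => i _.
by rewrite rmorphM amor_res mulrA.
Qed.

Lemma Odeg_ioM q U (h : G U) (a : O U) : Odeg q a -> Odeg q.+1 (io h * a).
Proof.
move=> ha x Ux; have [V [s [Vx [m [f [g e]]]]]] := ha x Ux.
exists V, s; split=> //; exists m, f,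
  (fun i j => if unlift ord0 j is Some k then g i k else mres s h).
rewrite rmorphM e mulr_sumr; apply: eq_bigr => i _.
rewrite big_ord_recl unlift_none mulrA -eiota_res -(ealphaC (f i)) -mulrA.
by congr (_ * (_ * _)); apply: eq_bigr => j _; rewrite liftK.
Qed.

Lemma Odeg1_io U (g : G U) : Odeg 1 (io g).
Proof.
by rewrite -[io g]mulr1 -(rmorph1 al); apply: Odeg_ioM; exact: Odeg0_al.
Qed.

Lemma Odeg0E U (a : O U) : Odeg 0 a -> a = al (pi0 a).
Proof.
move=> h; apply: asep => x Ux; have [V [s [Vx [m [f [g e]]]]]] := h x Ux.
exists V, s; split=> //; rewrite -amor_res -pi0_res e.
rewrite (eq_bigr (fun i => al (f i))); last first.
  by move=> i _; rewrite big_ord0 mulr1.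
by rewrite -rmorph_sum pi0_al.
Qed.

Lemma Odeg1E U (a : O U) : Odeg 1 a -> a = io (pi1 a).
Proof.
move=> h; apply: asep => x Ux; have [V [s [Vx [m [f [g e]]]]]] := h x Ux.
exists V, s; split=> //; rewrite -eiota_res -pi1_res e.
rewrite (eq_bigr (fun i => io (f i *: g i ord0))); last first.
  by move=> i _; rewrite big_ord_recl big_ord0 mulr1 eiotaZ.
by rewrite -eiota_sum pi1_io.
Qed.

Lemma T0_al U (D : sDer O U) : T0 D -> forall (V : opens M) (s : V `<=` U) f,
  sdapp D s (al f) = al (pi0 (sdapp D s (al f))).
Proof. by move=> h V s f; apply/Odeg0E/h/Odeg0_al. Qed.

Lemma T0_io U (D : sDer O U) : T0 D -> forall (V : opens M) (s : V `<=` U) g,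
  sdapp D s (io g) = io (pi1 (sdapp D s (io g))).
Proof. by move=> h V s g; apply/Odeg1E/h/Odeg1_io. Qed.

(** On a monomial f g_1 ... g_q, the Leibniz rule replaces one factor at a time by a section of the
    same degree. *)
Lemma even_T0 U (D : sDer O U) : is_sder false (Defs.ssval D : endo O U) ->
  (forall (V : opens M) (s : V `<=` U) f, exists f', sdapp D s (al f) = al f') ->
  (forall (V : opens M) (s : V `<=` U) g, exists g', sdapp D s (io g) = io g') ->
  T0 D.
Proof.
move=> hD hf hg q V s a ha; apply: Odeg_loc => x Vx.
have [W [t [Wx [m [f [g e]]]]]] := ha x Vx.
exists W, t; split=> //.
rewrite -(sdapp_res D s t (subset_trans t s)) e sdapp_sum.
apply: Odeg_sum => i _; rewrite sdapp_alM; move: (g i) => {e ha}g.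
set s' := subset_trans t s; apply: OdegD.
  by have [f' ->] := hf W s' (f i); exact: Odeg_mono.
apply: Odeg_alM; elim: q g => [|q IH] g.
  rewrite big_ord0 -(rmorph1 al); have [f' ->] := hf W s' 1; exact: Odeg0_al.
rewrite big_ord_recl /sdapp (sder_Leibniz hD) -/(sdapp _ _ _) -/(sdapp _ _ _).
have [g' ->] := hg W s' (g ord0); rewrite (tw_par _ (eiota_odd O _)) mul1r.
apply: OdegD; apply: Odeg_ioM; last exact: IH.
have := Odeg_mono 1 (fun i => g (lift ord0 i)).
by rewrite rmorph1 mul1r.
Qed.

(** The operator f -> pi_0(D f) is a derivation of F with the required property, so the default
    value in [gamma] does not occur. *)
Lemma gammaP U (D : sDer O U) : T0 D -> forall (V : opens M) (s : V `<=` U) f,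
  al (dapp (gamma D) s f) = sdapp D s (al f).
Proof.
move=> h; rewrite /gamma; case: xgetP => [X _ hX //|hX].
have [|||X HX] := @mk_Der U (fun V s f => pi0 (sdapp D s (al f))).
- move=> V s c f g; rewrite rmorphD rmorphM amor_cst sdappD sdapp_cst pi0D.
  by rewrite pi0M -(amor_cst (ealpha O)) pi0_al.
- move=> V s f g; rewrite rmorphM sdapp_alM pi0D !pi0M.
  by rewrite !pi0_al.
- by move=> V W s t s' f; rewrite amor_res (sdapp_res D s t) pi0_res.
by case: (hX X) => V s f; rewrite HX -T0_al.
Qed.

Lemma gammaE U (D : sDer O U) (X : Der F U) : T0 D ->
  (forall (V : opens M) (s : V `<=` U) f,
    sdapp D s (al f) = al (dapp X s f)) -> gamma D = X.
Proof.
move=> h hX; apply: Der_eq => V s f; apply: (@ealpha_inj _ _ _ _ O).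
by rewrite gammaP // hX.
Qed.

(** The bridge between connections and degree 0 derivations: X on F and [nab] on G are compatible
    initial values for [sder_ext]. *)
Lemma lift_exists U (X : Der F U)
    (nab : forall V : opens M, V `<=` U -> G V -> G V) :
  (forall (V : opens M) (s : V `<=` U) f g h,
    nab V s (f *: g + h) = dapp X s f *: g + f *: nab V s g + nab V s h) ->
  (forall (V W : opens M) (s : V `<=` U) (t : W `<=` V) (s' : W `<=` U) g,
    nab W s' (mres t g) = mres t (nab V s g)) ->
  exists D : sDer O U, [/\ T0 D,
    forall (V : opens M) (s : V `<=` U) f, sdapp D s (al f) = al (dapp X s f) &
    forall (V : opens M) (s : V `<=` U) g, sdapp D s (io g) = io (nab V s g)].
Proof.
move=> nP nr.
have [] := @sder_ext _ _ _ _ O U false (fun V s f => al (dapp X s f))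
  (fun V s g => io (nab V s g)).
- by move=> *; exact: ealpha_even.
- by move=> V s f g; rewrite dappD rmorphD.
- by move=> V s f g; rewrite dappM rmorphD !rmorphM.
- by move=> V s c; rewrite dapp_cst rmorph0.
- by move=> V W s t s' f; rewrite (dapp_res X s t) amor_res.
- by move=> *; exact: eiota_odd.
- by move=> V s f g h; rewrite nP !eiotaD !eiotaZ.
- by move=> V W s t s' f; rewrite (nr V W s t) eiota_res.
move=> D [hf hg hD]; exists D; split=> //; apply: even_T0 => // V s x.
  by exists (dapp X s x).
by exists (nab V s x).
Qed.

(** The interior product with the section c of the dual of G. *)
Lemma contraction_exists (U : opens M) (c : forall V : opens M, V `<=` U -> G V -> F V) :
  (forall (V : opens M) (s : V `<=` U) f g h,
    c V s (f *: g + h) = f * c V s g + c V s h) ->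
  (forall (V W : opens M) (s : V `<=` U) (t : W `<=` V) (s' : W `<=` U) g,
    c W s' (mres t g) = ares t (c V s g)) ->
  exists D : sDer O U, [/\
    forall (V : opens M) (s : V `<=` U) f, sdapp D s (al f) = 0,
    forall (V : opens M) (s : V `<=` U) g, sdapp D s (io g) = al (c V s g) &
    is_sder true (Defs.ssval D : endo O U)].
Proof.
move=> cP cr; apply: (@sder_ext _ _ _ _ O U true (fun V s f => 0)
  (fun V s g => al (c V s g))).
- by move=> *; exact: spar0.
- by move=> *; rewrite addr0.
- by move=> *; rewrite mul0r mulr0 addr0.
- by [].
- by move=> *; rewrite rmorph0.
- by move=> *; exact: ealpha_even.
- by move=> *; rewrite cP rmorphD rmorphM mul0r add0r.
- by move=> V W s t s' g; rewrite (cr V W s t) amor_res.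
Qed.

Lemma dapp0 (U V : opens M) (s : V `<=` U) (f : F V) : dapp (0 : Der F U) s f = 0.
Proof. by []. Qed.

(** The case X = 0 of [lift_exists], which excludes the default value in [delta]. *)
Lemma deltaP U (h : modEnd G U) : [/\ T0 (delta O h),
  forall (V : opens M) (s : V `<=` U) f, sdapp (delta O h) s (al f) = 0 &
  forall (V : opens M) (s : V `<=` U) g,
    sdapp (delta O h) s (io g) = io (h V s g)].
Proof.
rewrite /delta; case: xgetP => [D _ //|hD].
have [||D [h1 h2 h3]] := @lift_exists U 0 (fun V s g => h V s g).
- by move=> *; rewrite mefunP dapp0 scale0r add0r.
- by move=> *; exact: mefun_res.
case: (hD D); split=> // V s f; by rewrite h2 dapp0 rmorph0.
Qed.

(** * Local bases of G, flat lifts and contractions *)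

Definition is_basis (U : opens M) (r : nat) (e : 'I_r -> G U) :=
  forall (V : opens M) (s : V `<=` U) (v : G V),
  exists! c : 'I_r -> F V, v = \sum_(i < r) c i *: mres s (e i).

Lemma is_basis_res (U V : opens M) (s : V `<=` U) r (e : 'I_r -> G U) :
  is_basis e -> is_basis (fun i => mres s (e i)).
Proof.
move=> eP W t v; have [c [hc uc]] := eP W (subset_trans t s) v; exists c; split.
  rewrite {1}hc; apply: eq_bigr => i _.
  by rewrite (mres_comp s t (subset_trans t s)).
move=> c' hc'; apply: uc; rewrite {1}hc'; apply: eq_bigr => i _.
by rewrite (mres_comp s t (subset_trans t s)).
Qed.

Section Basis.
Variables (U : opens M) (r : nat) (e : 'I_r -> G U).
Hypothesis eP : is_basis e.

Definition coor (V : opens M) (s : V `<=` U) (v : G V) : 'I_r -> F V :=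
  sval (cid (eP s v)).

Lemma coorP (V : opens M) (s : V `<=` U) (v : G V) :
  v = \sum_(i < r) coor s v i *: mres s (e i).
Proof. by rewrite /coor; case: cid => c []. Qed.

Lemma coorE (V : opens M) (s : V `<=` U) (v : G V) (c : 'I_r -> F V) :
  v = \sum_(i < r) c i *: mres s (e i) -> coor s v = c.
Proof. by move=> h; have [_ u] := svalP (cid (eP s v)); apply: u. Qed.

Lemma coorL (V : opens M) (s : V `<=` U) f (v w : G V) i :
  coor s (f *: v + w) i = f * coor s v i + coor s w i.
Proof.
rewrite (@coorE V s _ (fun i => f * coor s v i + coor s w i)) //.
rewrite {1}(coorP s v) {1}(coorP s w) scaler_sumr -big_split.
by apply: eq_bigr => j _; rewrite scalerDl scalerA.
Qed.

Lemma coor_res (V W : opens M) (s : V `<=` U) (t : W `<=` V) (s' : W `<=` U)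
    (v : G V) i : coor s' (mres t v) i = ares t (coor s v i).
Proof.
rewrite (@coorE W s' _ (fun i => ares t (coor s v i))) //.
rewrite {1}(coorP s v) mres_sum.
by apply: eq_bigr => j _; rewrite mresZ (mres_comp s t s').
Qed.

Lemma coor_e (V : opens M) (s : V `<=` U) i j :
  coor s (mres s (e j)) i = (i == j)%:R.
Proof.
rewrite (@coorE V s _ (fun i => (i == j)%:R)) //.
rewrite (bigD1 j) //= eqxx scale1r big1 ?addr0 // => k /negPf ->.
by rewrite scale0r.
Qed.

(** The lift comes from the flat connection for which the basis is parallel: X differentiates the
    coordinates. *)
Lemma flat_lift (X : Der F U) : exists D : sDer O U, T0 D /\
  forall (V : opens M) (s : V `<=` U) f, sdapp D s (al f) = al (dapp X s f).
Proof.
have [||D [h1 h2 h3]] := @lift_exists U X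
  (fun V s v => \sum_(i < r) dapp X s (coor s v i) *: mres s (e i)).
- move=> V s f v w; rewrite {2}(coorP s v) !scaler_sumr -!big_split /=.
  apply: eq_bigr => i _.
  by rewrite coorL dappD dappM !scalerDl !scalerA.
- move=> V W s t s' v; rewrite mres_sum.
  apply: eq_bigr => i _; rewrite mresZ (mres_comp s t s').
  by rewrite (coor_res s t s') (dapp_res X s t).
by exists D.
Qed.

Lemma pderiv_exists i : exists D : sDer O U, [/\
    forall (V : opens M) (s : V `<=` U) f, sdapp D s (al f) = 0,
    forall (V : opens M) (s : V `<=` U) g, sdapp D s (io g) = al (coor s g i) &
    is_sder true (Defs.ssval D : endo O U)].
Proof.
apply: (@contraction_exists U (fun V s g => coor s g i)) => [*|V W s t s' g].
  exact: coorL.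
exact: coor_res.
Qed.

Definition pderiv i : sDer O U := sval (cid (pderiv_exists i)).

Lemma pderiv_al i (V : opens M) (s : V `<=` U) f :
  sdapp (pderiv i) s (al f) = 0.
Proof. by rewrite /pderiv; case: cid => D []. Qed.
Lemma pderiv_io i (V : opens M) (s : V `<=` U) g :
  sdapp (pderiv i) s (io g) = al (coor s g i).
Proof. by rewrite /pderiv; case: cid => D []. Qed.
Lemma pderiv_odd i : is_sder true (Defs.ssval (pderiv i) : endo O U).
Proof. by rewrite /pderiv; case: cid => D []. Qed.

Lemma pderivM i (V : opens M) (s : V `<=` U) a b :
  sdapp (pderiv i) s (a * b) =
  sdapp (pderiv i) s a * b + tw true a * sdapp (pderiv i) s b.
Proof. exact: (sder_Leibniz (pderiv_odd i)). Qed.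

(** A derivation that kills F is F-linear on G, so its values on the basis determine it. *)
Lemma kernel_expansion (D : sDer O U) :
  (forall (V : opens M) (s : V `<=` U) f, sdapp D s (al f) = 0) ->
  D = \sum_(i < r) sdapp D (@subset_refl _ (U : set M)) (io (e i)) *: pderiv i.
Proof.
move=> hD; apply: sDer_eq => V s x; rewrite sum_sdapp.
  by rewrite hD big1 // => i _; rewrite pderiv_al mulr0.
rewrite {1}(coorP s x) eiota_sum sdapp_sum; apply: eq_bigr => i _.
rewrite eiotaZ sdapp_alM hD mul0r add0r pderiv_io ealphaC; congr (_ * _).
by rewrite eiota_res (sdapp_res _ (@subset_refl _ (U : set M))).
Qed.

End Basis.

Hypothesis freeG : locally_free G.

Lemma local_basis (U : opens M) : locally_on (fun V (s : V `<=` U) =>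
  exists (r : nat) (e : 'I_r -> G V), is_basis e).
Proof.
move=> x Ux; have [V [r [e [Vx eP]]]] := freeG x.
exists (opensI U V), (@Defs.subIl M U V); split=> //.
by exists r, (fun i => mres (@Defs.subIr M U V) (e i)); exact: is_basis_res.
Qed.

Lemma local_lift U (X : Der F U) : locally_on (fun V (s : V `<=` U) =>
  exists D : sDer O V, T0 D /\ forall (W : opens M) (t : W `<=` V) f,
    sdapp D t (al f) = al (dapp (mres s X) t f)).
Proof.
move=> x Ux; have [V [s [Vx [r [e eP]]]]] := local_basis Ux.
by exists V, s; split=> //; exact: (flat_lift eP).
Qed.

(** A degree 0 derivation killing F restricts to an F-linear endomorphism of G, which gives
    exactness at T_0; local flat lifts give surjectivity of gamma. *)
Lemma sequence_is_exact : sequence_exact O.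
Proof.
split.
- by move=> U h; have [] := deltaP h.
- move=> U h h' e; have [_ _ hd] := deltaP h; have [_ _ hd'] := deltaP h'.
  have E V s g : h V s g = h' V s g.
    by apply: (@eiota_inj _ _ _ _ O); rewrite -hd -hd' e.
  case: h h' E {e hd hd'} => f fP fr [f' fP' fr'] /= E.
  have eq : f = f' by apply: functional_extensionality_dep => V;
    apply: functional_extensionality_dep => s; apply/funext => a; exact: E.
  case: _ / eq fP' fr' E => gP gr _.
  by rewrite (Prop_irrelevance fP gP) (Prop_irrelevance fr gr).
- move=> U D hD; split=> [g0|[h <-]]; last first.
    have [h1 h2 h3] := deltaP h.
    by apply: gammaE => // V s f; rewrite h2 dapp0 rmorph0.
  have Df (V : opens M) (s : V `<=` U) f : sdapp D s (al f) = 0.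
    by rewrite -(gammaP hD) g0 dapp0 rmorph0.
  pose m (V : opens M) (s : V `<=` U) g := pi1 (sdapp D s (io g)).
  have mP (V : opens M) (s : V `<=` U) f g h :
      m V s (f *: g + h) = f *: m V s g + m V s h.
    rewrite /m eiotaP sdappD sdapp_alM Df mul0r add0r pi1D pi1M pi0_al.
    by rewrite pi1_al scaler0 addr0.
  have mr (V W : opens M) (s : V `<=` U) (t : W `<=` V) (s' : W `<=` U) g :
      m W s' (mres t g) = mres t (m V s g).
    by rewrite /m eiota_res (sdapp_res D s t) pi1_res.
  exists (ModEnd mP mr); have [h1 h2 h3] := deltaP (ModEnd mP mr).
  apply: (@sDer_eq _ _ _ _ O) => V s x; first by rewrite h2 Df.
  by rewrite h3 -(T0_io hD).
- move=> U X x Ux; have [V [s [Vx [D [hD hX]]]]] := local_lift X Ux.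
  by exists V, s; split=> //; exists D; split=> //; exact: gammaE.
Qed.

(** Since gamma sigma = id, the derivation sigma(X) acts on F as X, so its action on G obeys the
    Leibniz rule. *)
Lemma splits_connection : exact_sequence_splits O -> has_connection G.
Proof.
move=> [_ [sigma [s0 sP sr sg]]].
pose id U := @subset_refl _ (oset U : set M).
have sf U (X : Der F U) f : sdapp (sigma U X) (id U) (al f) = al (dapp X (id U) f).
  by rewrite -{2}(sg U X) gammaP.
exists (fun U X g => pi1 (sdapp (sigma U X) (id U) (io g))); split.
- move=> U f X Y g; rewrite sP sdappP ares_id pi1D pi1M pi0_al pi1_al.
  by rewrite scaler0 addr0.
- move=> U c X g h; rewrite eiotaP sdappD sdapp_alM sf dapp_cst rmorph0 mul0r add0r.
  by rewrite pi1D pi1M pi0_al pi1_al scaler0 addr0.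
- move=> U V i X g; rewrite sr eiota_res.
  by rewrite (sdapp_mres i _ _ (subset_trans (id V) i)) (sdapp_res _ (id U)) pi1_res.
- move=> U X f g; rewrite eiotaZ sdapp_alM sf pi1D !pi1M !pi0_al !pi1_al.
  by rewrite pi1_io pi0_io !scaler0 !addr0 addrC.
Qed.

Section Connection.
Variables (nabla : forall U, Der F U -> G U -> G U).
Hypothesis nablaP : is_connection nabla.
Local Notation id U := (@subset_refl _ (oset U : set M)).

Lemma nabla_lift U (X : Der F U) : exists D : sDer O U, [/\ T0 D,
  forall (V : opens M) (s : V `<=` U) f, sdapp D s (al f) = al (dapp X s f) &
  forall (V : opens M) (s : V `<=` U) g,
    sdapp D s (io g) = io (nabla (mres s X) g)].
Proof.
apply: lift_exists => [V s f g h|V W s t s' g].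
  have := connection_linr nablaP 1 (mres s X) (f *: g) h.
  rewrite rmorph1 !scale1r => ->; rewrite connection_leibniz //.
  by rewrite (dapp_mres s _ _ s) [_ *: _ + _ *: _]addrC.
by rewrite -(connection_res nablaP) (mres_comp s t s').
Qed.

Definition nabla_sigma U (X : Der F U) : sDer O U := sval (cid (nabla_lift X)).

Lemma nabla_sigma_T0 U (X : Der F U) : T0 (nabla_sigma X).
Proof. by rewrite /nabla_sigma; case: cid => D []. Qed.
Lemma nabla_sigma_al U (X : Der F U) (V : opens M) (s : V `<=` U) f :
  sdapp (nabla_sigma X) s (al f) = al (dapp X s f).
Proof. by rewrite /nabla_sigma; case: cid => D []. Qed.
Lemma nabla_sigma_io U (X : Der F U) (V : opens M) (s : V `<=` U) g :
  sdapp (nabla_sigma X) s (io g) = io (nabla (mres s X) g).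
Proof. by rewrite /nabla_sigma; case: cid => D []. Qed.

Lemma nabla_splits : exact_sequence_splits O.
Proof.
split; first exact: sequence_is_exact.
exists nabla_sigma; split.
- exact: nabla_sigma_T0.
- move=> U f X Y; apply: (@sDer_eq _ _ _ _ O) => V s x; rewrite sdappP.
    by rewrite !nabla_sigma_al -amor_res -rmorphM -rmorphD.
  by rewrite !nabla_sigma_io mresP connection_linl // eiotaP amor_res.
- move=> U V i X; apply: (@sDer_eq _ _ _ _ O) => W s x;
    rewrite (sdapp_mres i _ s (subset_trans s i)).
    by rewrite !nabla_sigma_al (dapp_mres i _ s (subset_trans s i)).
  by rewrite !nabla_sigma_io (mres_comp i s (subset_trans s i)).
- by move=> U X; apply: gammaE; [exact: nabla_sigma_T0|exact: nabla_sigma_al].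
Qed.

End Connection.

End Sequence.

(** * Filtrations and symbols *)

Section Filtrations.
Context (K : numFieldType) (M : topologicalType).
Variable (O : superAlg K M).

Lemma oddIdeal_res (U V : opens M) (s : V `<=` U) (a : O U) :
  oddIdeal a -> oddIdeal (ares s a).
Proof.
move=> h x Vx; have [W [t [Wx [m [f [b [y [hb e]]]]]]]] := h x (s x Vx).
have l := @Defs.subIl M V W; have r := @Defs.subIr M V W.
exists (opensI V W), l; split=> //.
exists m, (fun i => ares r (f i)), (fun i => ares r (b i)), (fun i => ares r (y i)).
split=> [i|]; first exact: spar_res.
rewrite (ares_comp s l (subset_trans r t)) -(ares_comp t r) e rmorph_sum.
by apply: eq_bigr => i _; rewrite !rmorphM.
Qed.

Lemma oddIdealM U (x a : O U) : oddIdeal a -> oddIdeal (x * a).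
Proof.
move=> h z Uz; have [W [t [Wz [m [f [b [y [hb e]]]]]]]] := h z Uz.
exists W, t; split=> //; exists m, (fun i => ares t x * f i), b, y.
split=> //; rewrite rmorphM e mulr_sumr.
by apply: eq_bigr => i _; rewrite !mulrA.
Qed.

Lemma odd_oddIdeal U (a : O U) : spar true a -> oddIdeal a.
Proof.
move=> ha; apply: locallyW; exists 1%N, (fun=> 1), (fun=> a), (fun=> 1).
by split=> //; rewrite ares_id big_ord_recl big_ord0 mul1r mulr1 addr0.
Qed.

Section Module.
Variable E : superMod O.

Lemma filt_res p (U V : opens M) (s : V `<=` U) (v : E U) :
  filt p v -> filt p (mres s v).
Proof.
elim: p U V s v => [|p IH] U V s v; first by move=> *; exact: I.
move=> h x Vx.
have [W [t [Wx [m [a [w [ha hw e]]]]]]] := h x (s x Vx).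
have l := @Defs.subIl M V W; have r := @Defs.subIr M V W.
exists (opensI V W), l; split=> //.
exists m, (fun i => ares r (a i)), (fun i => mres r (w i)); split.
- by move=> i; exact: oddIdeal_res.
- by move=> i; exact: (IH _ _ r _ (hw i)).
rewrite (mres_comp s l (subset_trans r t)) -(mres_comp t r) e mres_sum.
by apply: eq_bigr => i _; rewrite mresZ.
Qed.

Lemma filt_loc p (U : opens M) (v : E U) :
  locally_on (fun V (s : V `<=` U) => filt p (mres s v)) -> filt p v.
Proof.
case: p => [|p]; first by move=> *; exact: I.
move=> h x Ux; have [V [s [Vx hV]]] := h x Ux.
have [W [t [Wx hW]]] := hV x Vx; exists W, (subset_trans t s); split=> //.
by rewrite -(mres_comp s t).
Qed.

Lemma filt0 p (U : opens M) : filt p (0 : E U).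
Proof.
case: p => [|p]; first exact: I.
apply: locallyW; exists 0%N, (fun=> 0), (fun=> 0).
by split=> [[]//|[]//|]; rewrite mres0 big_ord0.
Qed.

Lemma filtD p (U : opens M) (v w : E U) : filt p v -> filt p w -> filt p (v + w).
Proof.
case: p => [|p]; first by move=> *; exact: I.
move=> hv hw x Ux.
have [V [s [Vx [m [a [f [ha hf e]]]]]]] := hv x Ux.
have [W [t [Wx [n [b [g [hb hg e']]]]]]] := hw x Ux.
have l := @Defs.subIl M V W; have r := @Defs.subIr M V W.
exists (opensI V W), (subset_trans l s); split=> //.
exists (m + n)%N,
  (fun i => match fintype.split i with
    | inl i => ares l (a i) | inr i => ares r (b i) end),
  (fun i => match fintype.split i with
    | inl i => mres l (f i) | inr i => mres r (g i) end).
split.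
- move=> i; case: fintype.split => k; first exact: (oddIdeal_res l (ha k)).
  exact: (oddIdeal_res r (hb k)).
- move=> i; case: fintype.split => k; first exact: (filt_res l (hf k)).
  exact: (filt_res r (hg k)).
rewrite big_split_ord mresD; congr (_ + _).
  rewrite -(mres_comp s l) e mres_sum; apply: eq_bigr => i _.
  by rewrite -[lshift _ _]/(unsplit (inl i)) unsplitK mresZ.
rewrite -(mres_comp t r) e' mres_sum; apply: eq_bigr => i _.
by rewrite -[rshift _ _]/(unsplit (inr i)) unsplitK mresZ.
Qed.

Lemma filtZ p (U : opens M) (a : O U) (v : E U) : filt p v -> filt p (a *: v).
Proof.
case: p => [|p]; first by move=> *; exact: I.
move=> hv x Ux.
have [V [s [Vx [m [b [f [hb hf e]]]]]]] := hv x Ux.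
exists V, s; split=> //; exists m, (fun i => ares s a * b i), f; split=> //.
  by move=> i; exact: oddIdealM.
by rewrite mresZ e scaler_sumr; apply: eq_bigr => i _; rewrite scalerA.
Qed.

Lemma filtN p (U : opens M) (v : E U) : filt p v -> filt p (- v).
Proof. by move=> h; rewrite -scaleN1r; exact: filtZ. Qed.

Lemma filtB p (U : opens M) (v w : E U) : filt p v -> filt p w -> filt p (v - w).
Proof. by move=> hv hw; apply/filtD/filtN. Qed.

Lemma filt_sum p (U : opens M) (I : Type) (r : seq I) (P : pred I) (v : I -> E U) :
  (forall i, P i -> filt p (v i)) -> filt p (\sum_(i <- r | P i) v i).
Proof.
move=> h; apply: (big_ind (fun a => filt p a)) => //; first exact: filt0.
by move=> *; exact: filtD.
Qed.

Lemma filt_mul p (U : opens M) (a : O U) (v : E U) :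
  oddIdeal a -> filt p v -> filt p.+1 (a *: v).
Proof.
move=> ha hv; apply: locallyW; exists 1%N, (fun=> a), (fun=> v).
by split=> //; rewrite mres_id big_ord_recl big_ord0 addr0.
Qed.

Lemma filtS p (U : opens M) (v : E U) : filt p.+1 v -> filt p v.
Proof.
move=> h; apply: filt_loc => x Ux; have [V [s [Vx [m [a [w [ha hw e]]]]]]] := h x Ux.
by exists V, s; split=> //; rewrite e; apply: filt_sum => i _; exact/filtZ/hw.
Qed.

Lemma filt_le p q (U : opens M) (v : E U) : (p <= q)%N -> filt q v -> filt p v.
Proof.
move=> /subnK <-; elim: (q - p)%N => [//|k IH]; rewrite addSn => /filtS.
exact: IH.
Qed.

End Module.
End Filtrations.

(** * Symbols and the part of positive degree of the graded module *)

Section GradedModule.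
Context (K : numFieldType) (M : topologicalType).
Context (F : comAlgSheaf K M) (G : modSheaf F) (O : extAlg G).
Variables (E : superMod O) (H : retract E).

Local Notation al := (ealpha O _).
Local Notation io := (@eiota _ _ _ _ O _).

Lemma pi0_oddIdeal U (a : O U) : oddIdeal a -> pi0 a = 0.
Proof.
move=> h; apply: asep => x Ux; have [V [s [Vx [m [f [b [y [hb e]]]]]]]] := h x Ux.
exists V, s; split=> //; rewrite -pi0_res e rmorph0 -(pi00 O V).
apply: (big_ind (fun a => pi0 a = pi0 0)) => // [a' b' ha hb'|i _].
  by rewrite pi0D ha hb' pi00 addr0.
by rewrite !pi0M (pi0_odd (hb i)) mulr0 mul0r pi00.
Qed.

Lemma symb0 p U : symb H p (0 : E U) = 0.
Proof. by apply/symb_ker; exact: filt0. Qed.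

Lemma symbN p U (v : E U) : filt p v -> symb H p (- v) = - symb H p v.
Proof.
move=> h; apply: (addrI (symb H p v)).
by rewrite -symbD ?subrr ?symb0 //; exact: filtN.
Qed.

Lemma symbB p U (v w : E U) : filt p v -> filt p w ->
  symb H p (v - w) = symb H p v - symb H p w.
Proof. by move=> hv hw; rewrite symbD ?symbN //; exact: filtN. Qed.

Lemma symb_sum p U (I : Type) (r : seq I) (P : pred I) (v : I -> E U) :
  (forall i, P i -> filt p (v i)) ->
  symb H p (\sum_(i <- r | P i) v i) = \sum_(i <- r | P i) symb H p (v i).
Proof.
move=> hv; pose R (v : E U) (h : H U) := filt p v /\ symb H p v = h.
suff [] : R (\sum_(i <- r | P i) v i) (\sum_(i <- r | P i) symb H p (v i)) by [].
apply: (big_ind2 R) => [|v1 h1 v2 h2 [f1 <-] [f2 <-]|i Pi].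
- by split; [exact: filt0|exact: symb0].
- by split; [exact: filtD|exact: symbD].
- by split=> //; exact: hv.
Qed.

Lemma symb_al p U (f : F U) (v : E U) : filt p v ->
  symb H p (al f *: v) = al f *: symb H p v.
Proof. by move=> hv; rewrite -(@symbZ _ _ _ _ _ _ H 0 p) //; exact: Odeg0_al. Qed.

(** The part of gr E of degree at least 1; only its containing J gr E is needed. *)
Definition positive U (h : H U) := locally_on (fun V (s : V `<=` U) =>
  exists (m : nat) (v : nat -> E V), [/\ v 0%N = 0, forall p, filt p (v p) &
    mres s h = \sum_(p < m) symb H p (v p)]).

Lemma symb_widen U m n (v : nat -> E U) : (m <= n)%N ->
  \sum_(p < m) symb H p (v p) =
  \sum_(p < n) symb H p (if (p < m)%N then v p else 0).
Proof.
move=> mn; rewrite (big_ord_widen n (fun p => symb H p (v p))) // big_mkcond.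
by apply: eq_bigr => p _; case: ifP => // _; rewrite symb0.
Qed.

Lemma positiveD U (h k : H U) : positive h -> positive k -> positive (h + k).
Proof.
move=> hh hk x Ux; have [V [s [Vx [m [v [v0 fv e]]]]]] := hh x Ux.
have [W [t [Wx [n [w [w0 fw e']]]]]] := hk x Ux.
have l := @Defs.subIl M V W; have r := @Defs.subIr M V W.
exists (opensI V W), (subset_trans l s); split=> //.
pose v' p := mres l (if (p < m)%N then v p else 0).
pose w' p := mres r (if (p < n)%N then w p else 0).
have fv' p : filt p (v' p).
  by apply: filt_res; case: ifP => _; rewrite ?fv //; exact: filt0.
have fw' p : filt p (w' p).
  by apply: filt_res; case: ifP => _; rewrite ?fw //; exact: filt0.
exists (m + n)%N, (fun p => v' p + w' p); split.
- by rewrite /v' /w' v0 w0 !if_same !mres0 addr0.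
- by move=> p; exact: filtD.
rewrite mresD -(mres_comp s l) -(mres_comp t r) e e'.
rewrite (symb_widen v (leq_addr n m)) (symb_widen w (leq_addl m n)) !mres_sum.
rewrite -big_split; apply: eq_bigr => p _ /=; rewrite symbD //.
by rewrite /v' /w' !symb_res //; case: ifP => // _; exact: filt0.
Qed.

Lemma positive0 U : positive (0 : H U).
Proof.
by apply: locallyW; exists 0%N, (fun=> 0); split=> //=;
  [move=> p; exact: filt0|rewrite mres0 big_ord0].
Qed.

Lemma positive_loc U (h : H U) :
  locally_on (fun V (s : V `<=` U) => positive (mres s h)) -> positive h.
Proof.
move=> hh x Ux; have [V [s [Vx hV]]] := hh x Ux.
have [W [t [Wx hW]]] := hV x Vx; exists W, (subset_trans t s); split=> //.
by rewrite -(mres_comp s t).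
Qed.

Lemma positive_io U (g : G U) (h : H U) : positive (io g *: h).
Proof.
move=> x Ux; have [V [s [Vx [m [v [fv e]]]]]] := symb_span h Ux.
exists V, s; split=> //.
(* Multiplication by a section of G raises the degree by one, so the entries move one place up and
   place 0 becomes empty. *)
exists m.+1, (fun p => if p is q.+1 then io (mres s g) *: v q else 0); split=> //.
  case=> [|p]; first exact: I.
  apply: filt_mul => //; apply: odd_oddIdeal; exact: eiota_odd.
rewrite big_ord_recl symb0 add0r mresZ e scaler_sumr; apply: eq_bigr => p _ /=.
by rewrite -eiota_res -(@symbZ _ _ _ _ _ _ H 1 p) //; exact: Odeg1_io.
Qed.

(** By induction on the generation of O, subtracting from a its component in F leaves a section that
    moves every degree up. *)
Lemma positive_scale U (a : O U) (h : H U) : pi0 a = 0 -> positive (a *: h).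
Proof.
move=> a0; have -> : a = a - al (pi0 a) by rewrite a0 rmorph0 subr0.
move: U a h {a0}; apply: O_ind0 => [V f|V a b ha hb|V g a ha|V a IH] h.
- by rewrite pi0_al subrr scale0r; exact: positive0.
- rewrite pi0D rmorphD opprD addrACA scalerDl; apply: positiveD; [exact: ha|exact: hb].
- rewrite pi0M pi0_io mul0r rmorph0 subr0 -scalerA; exact: positive_io.
- apply: positive_loc => x Vx; have [W [s [Wx hW]]] := IH x Vx.
  exists W, s; split=> //; rewrite mresZ rmorphB -amor_res -pi0_res; exact: hW.
Qed.

Lemma filt1_positive U (h : H U) : filt 1 h -> positive h.
Proof.
move=> hh; apply: positive_loc => x Ux.
have [V [s [Vx [m [a [w [ha _ e]]]]]]] := hh x Ux.
exists V, s; split=> //; rewrite e; apply: (big_ind (@positive V)) => [||i _].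
- exact: positive0.
- exact: positiveD.
- by apply: positive_scale; exact: pi0_oddIdeal.
Qed.

(** J gr E has no component of degree 0, so a degree 0 class lying in it vanishes because the sum
    over degrees is direct. *)
Lemma filt1_symb U (v : E U) : filt 1 (symb H 0 v) -> filt 1 v.
Proof.
move=> /filt1_positive h; apply: filt_loc => x Ux.
have [V [s [Vx [m [w [w0 fw e]]]]]] := h x Ux.
exists V, s; split=> //; apply/(@symb_ker _ _ _ _ _ _ H 0) => //.
pose w' p := if (p < m)%N then w p else 0.
have fw' p : filt p (w' p) by rewrite /w'; case: ifP => // _; exact: filt0.
(* The relation for [symb_direct]: v in place 0, and the negatives of the entries representing its
   symbol in the positive places. *)
pose v' p := if p is q.+1 then - w' q.+1 else mres s v.
have fv' p : filt p (v' p) by case: p => [|p]; [exact: I|exact: filtN].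
apply: (@symb_direct _ _ _ _ _ _ H V m.+1 v' fv' _ 0%N) => //.
rewrite big_ord_recl [v' _]/= symb_res // e (symb_widen w (leqnSn m)).
rewrite -/(w' _) big_ord_recl /= -/(w' 0%N) {1}/w' w0 if_same symb0 add0r.
rewrite -big_split big1 // => p _ /=.
by rewrite -[X in symb H _ X + _]/(w' _) symbN // addrN.
Qed.

End GradedModule.

(** * From the unit class to a connection *)

Section UnitClass.
Context (K : numFieldType) (M : topologicalType).
Context (F : comAlgSheaf K M) (G : modSheaf F) (O : extAlg G).
Hypothesis freeG : locally_free G.

Local Notation al := (ealpha O _).
Local Notation io := (@eiota _ _ _ _ O _).
Local Notation sl V W := (@Defs.subIl M V W).
Local Notation sr V W := (@Defs.subIr M V W).

Definition is_lift U (X : Der F U) (D : sDer O U) :=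
  T0 D /\ forall (V : opens M) (s : V `<=` U) f,
    sdapp D s (al f) = al (dapp X s f).

Lemma is_lift_res (U V : opens M) (s : V `<=` U) X D :
  is_lift X D -> is_lift (mres s X) (mres s D).
Proof.
move=> [h hX]; split=> [q W t a|W t f].
  by rewrite (sdapp_mres s D t (subset_trans t s)); exact: h.
by rewrite (sdapp_mres s D t (subset_trans t s)) hX (dapp_mres s X t (subset_trans t s)).
Qed.

Lemma is_liftP U (f : F U) X Y D E :
  is_lift X D -> is_lift Y E -> is_lift (f *: X + Y) (al f *: D + E).
Proof.
move=> [hD hX] [hE hY]; split=> [q V s a ha|V s g].
  rewrite sdappP; apply: OdegD; last exact: hE.
  by rewrite -amor_res; apply: Odeg_alM; exact: hD.
by rewrite sdappP hX hY -amor_res -rmorphM -rmorphD.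
Qed.

(** The difference kills F and maps G to G; in [kernel_expansion] its coefficients are then sections
    of G, which are odd. *)
Lemma lift_filt1 U (X : Der F U) (D E : sDer O U) :
  is_lift X D -> is_lift X E -> filt 1 (D - E).
Proof.
move=> hD hE.
have h0 : is_lift 0 (D - E).
  have := is_liftP (-1) hE hD.
  have -> : -1 *: X + X = 0 by rewrite scaleN1r addNr.
  have -> : al (-1) *: E + D = D - E by rewrite rmorphN rmorph1 scaleN1r addrC.
  by [].
apply: filt_loc => x Ux.
have [V [s [Vx [r [e eP]]]]] := local_basis freeG Ux.
exists V, s; split=> //; have [hT hk] := is_lift_res s h0.
have hk0 (W : opens M) (t : W `<=` V) f : sdapp (mres s (D - E)) t (al f) = 0.
  by rewrite hk (dapp_mres s 0 t (subset_trans t s)) rmorph0.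
rewrite (kernel_expansion eP hk0).
apply: filt_sum => i _; apply: filt_mul; last exact: I.
rewrite (T0_io hT); apply: odd_oddIdeal; exact: eiota_odd.
Qed.

Lemma pi0_filt1 U (D : sDer O U) (V : opens M) (s : V `<=` U) a :
  filt 1 D -> pi0 (sdapp D s a) = 0.
Proof.
move=> h; apply: asep => x Vx.
have [W [t [Wx [m [b [w [hb _ e]]]]]]] := h x (s x Vx).
exists (opensI V W), (sl V W); split=> //.
rewrite rmorph0 -pi0_res -(sdapp_res D s (sl V W) (subset_trans (sr V W) t)).
rewrite -(sdapp_mres t _ (sr V W)) e sum_sdapp.
apply: (big_ind (fun a => pi0 a = 0)) => [|a' b' ha hb'|i _].
- exact: pi00.
- by rewrite pi0D ha hb' addr0.
- by rewrite pi0M (pi0_oddIdeal (oddIdeal_res _ (hb i))) mul0r.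
Qed.

Variables (H : retract (sDer O)).

(* [c i j] is the coboundary of [u], and [f i] = b d_i trivializes T over [W i]. *)
Lemma unit_data (unit : corresponds_to H (H1_unit H)) :
  exists (I : Type) (W : I -> opens M)
    (f : I -> forall V, sDer O V -> H V)
    (u : I -> forall V, H V -> H V)
    (b : forall V, H V -> H V) (c : I -> I -> forall V, H V -> H V),
  [/\ [set: M] `<=` \bigcup_i W i,
      forall i, is_iso_over (W i) (f i) /\ is_iso_over (W i) (u i),
      is_iso_over (opensT M) b,
      forall i j (V : opens M), V `<=` W i -> V `<=` W j ->
        (forall e, c i j V (f j V e) = f i V e) /\
        (forall h, c i j V (u j V h) = u i V h) &
      forall i (V : opens M), V `<=` W i -> forall e h,
        f i V e = u i V (b V (symb H 0 h)) -> filt 1 (e - h)].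
Proof.
have [c [d [b [hd hb hc he]]]] := unit.
(* The class of c contains c, by the identity coboundary. Equality with the unit class therefore
   makes c itself a coboundary. *)
have : H1_class c c.
  exists (cidx c), (@ccov _ _ _ _ _ _ c), id, id, (fun i V h => h); split=> //.
  - by move=> x _; have := @ccov_all _ _ _ _ _ _ c x; apply.
  - by move=> i; split; exact: subset_refl.
  - by move=> i; exact: is_aut1_id.
rewrite -he => -[I [W [t [t' [u [cov sub hu hcomp]]]]]].
have [bL bP bR bB] := hb.1.
have T V : V `<=` opensT M by [].
exists I, W, (fun i V e => b V (d (t' i) V e)), u, b,
  (fun i j => cfun (t' i) (t' j)); split=> //.
- move=> i; have [[dL dP dR dB] _] := hd (t' i).
  have sW V : V `<=` W i -> V `<=` ccov (t' i).
    by move=> s; apply: subset_trans s (proj2 (sub i)).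
  split; last exact: (hu i).1; split.
  + by move=> V /sW s a v w; rewrite dL // bL.
  + by move=> V /sW s k v hv; apply: bP => //; exact: dP.
  + by move=> V V' s /sW s' v; rewrite dR // bR.
  + by move=> V /sW s; apply: bij_comp; [exact: bB|exact: dB].
- move=> i j V si sj; split=> [e|h]; last exact: hcomp.
  by apply: hc; [exact: subset_trans si (proj2 (sub i))|
    exact: subset_trans sj (proj2 (sub j))].
- move=> i V s e h E; apply: (@filt1_symb _ _ _ _ _ _ H).
  have [[dL dP dR dB] /(_ V)] := hd (t' i).
  move=> /(_ (subset_trans s (proj2 (sub i))) 0%N e Logic.I) de.
  have [_ /(_ V s (b V (symb H 0 h)))] := hu i; rewrite -E => ub.
  have bD v w : b V (v + w) = b V v + b V w.
    by have := bL V (T V) 1 v w; rewrite !scale1r.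
  have bZ a v : b V (a *: v) = a *: b V v.
    have := bL V (T V) a v 0; rewrite !addr0 => ->.
    have -> : b V 0 = 0 by apply: (addrI (b V 0)); rewrite -bD !addr0.
    by rewrite addr0.
  have bN v : b V (- v) = - b V v by rewrite -scaleN1r bZ scaleN1r.
  rewrite -bN -bD in ub.
  (* Since u_i is the identity modulo J, b maps d e - symb h into J gr T. Being an O-linear
     bijection, b reflects J gr T; then d e may be replaced by symb e modulo J. *)
  suff vb : filt 1 (d (t' i) V e - symb H 0 h).
    by have := filtB vb de; rewrite opprB addrC addrA addrNK symbB.
  move: ub; move: (_ - _) => v hv; apply: filt_loc => x Vx.
  have [V' [s' [Vx' [m [a [w [ha _ e']]]]]]] := hv x Vx.
  exists V', s'; split=> //.
  have [b' bK b'K] := bB V' (T V').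
  have -> : mres s' v = \sum_(i < m) a i *: b' (w i); last first.
    by apply: filt_sum => k _; apply: filt_mul.
  apply: (can_inj bK); rewrite bR // e'.
  have bL' := bL V' (T V').
  have bD' v' w' : b V' (v' + w') = b V' v' + b V' w'.
    by have := bL' 1 v' w'; rewrite !scale1r.
  have b0 : b V' 0 = 0 by apply: (addrI (b V' 0)); rewrite -bD' !addr0.
  rewrite (big_morph _ bD' b0); apply: eq_bigr => k _.
  by have := bL' (a k) (b' (w k)) 0; rewrite !addr0 b0 addr0 b'K => ->.
Qed.

(** * Descent of the corrected local trivializations *)

Section Descent.
Variables (I : Type) (W : I -> opens M).
Variables (f : I -> forall V, sDer O V -> H V) (u : I -> forall V, H V -> H V).
Variables (b : forall V, H V -> H V) (c : I -> I -> forall V, H V -> H V).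
Hypothesis cov : [set: M] `<=` \bigcup_i W i.
Hypothesis isof : forall i, is_iso_over (W i) (f i).
Hypothesis isou : forall i, is_iso_over (W i) (u i).
Hypothesis isob : is_iso_over (opensT M) b.
Hypothesis cf : forall i j (V : opens M), V `<=` W i -> V `<=` W j ->
  forall e : sDer O V, c i j (f j e) = f i e.
Hypothesis cu : forall i j (V : opens M), V `<=` W i -> V `<=` W j ->
  forall h : H V, c i j (u j h) = u i h.
Hypothesis fu : forall i (V : opens M), V `<=` W i -> forall (e h : sDer O V),
  f i e = u i (b (symb H 0 h)) -> filt 1 (e - h).

(* The isomorphisms b^-1 u_i^-1 f_i agree on overlaps; [unit_lift X E] says   *)
(* that the resulting isomorphism T -> gr T maps E to the class in T/JT of    *)
(* the local lifts of X.                                                      *)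
Definition unit_lift U (X : Der F U) (E : sDer O U) :=
  locally_on (fun V (s : V `<=` U) => exists i (D : sDer O V),
    [/\ V `<=` W i, is_lift (mres s X) D &
        f i (mres s E) = u i (b (symb H 0 D))]).

Lemma iso_locus (V V' : opens M) (s : V' `<=` V) i (E D : sDer O V) :
  V `<=` W i -> f i E = u i (b (symb H 0 D)) ->
  f i (mres s E) = u i (b (symb H 0 (mres s D))).
Proof.
move=> sV e; rewrite (iso_res (isof i)) // e symb_res //.
by rewrite (iso_res isob) // (iso_res (isou i)).
Qed.

Lemma iso_index i j (V : opens M) (E D : sDer O V) : V `<=` W i -> V `<=` W j ->
  f j E = u j (b (symb H 0 D)) -> f i E = u i (b (symb H 0 D)).
Proof. by move=> si sj e; rewrite -(cf si sj) e cu. Qed.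

Lemma unit_lift_res (U V : opens M) (s : V `<=` U) X E :
  unit_lift X E -> unit_lift (mres s X) (mres s E).
Proof.
move=> h x Vx; have [V' [t [Vx' [i [D [sV hD e]]]]]] := h x (s x Vx).
exists (opensI V V'), (sl V V'); split=> //; exists i, (mres (sr V V') D).
have q := subset_trans (sr V V') t.
split; first exact: subset_trans (sr V V') sV.
  by rewrite (mres_comp s _ q) -(mres_comp t (sr V V')); exact: is_lift_res.
by rewrite (mres_comp s _ q) -(mres_comp t (sr V V')); exact: iso_locus.
Qed.

Lemma unit_lift_loc (U : opens M) X (E : sDer O U) :
  locally_on (fun V (s : V `<=` U) => unit_lift (mres s X) (mres s E)) ->
  unit_lift X E.
Proof.
move=> h x Ux; have [V [s [Vx hV]]] := h x Ux.
have [V' [t [Vx' [i [D [sV hD e]]]]]] := hV x Vx.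
exists V', (subset_trans t s); split=> //; exists i, D.
by rewrite -!(mres_comp s t).
Qed.

(* Two sections are compared, and added, after passing to a common index. *)
Lemma unit_lift2 U X Y (E E' : sDer O U) : unit_lift X E -> unit_lift Y E' ->
  locally_on (fun V (s : V `<=` U) => exists i (D D' : sDer O V),
    [/\ V `<=` W i, is_lift (mres s X) D, is_lift (mres s Y) D',
        f i (mres s E) = u i (b (symb H 0 D)) &
        f i (mres s E') = u i (b (symb H 0 D'))]).
Proof.
move=> h h' x Ux; have [V [s [Vx [i [D [sV hD e]]]]]] := h x Ux.
have [V' [s' [Vx' [i' [D' [sV' hD' e']]]]]] := h' x Ux.
have l := sl V V'; have r := sr V V'; have q := subset_trans l s.
exists (opensI V V'), q; split=> //.
exists i, (mres l D), (mres r D'); split.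
- exact: subset_trans l sV.
- by rewrite -(mres_comp s l); exact: is_lift_res.
- by rewrite -(mres_comp s' r); exact: is_lift_res.
- by rewrite -(mres_comp s l); exact: iso_locus.
apply: (@iso_index i i'); [exact: subset_trans l sV|exact: subset_trans r sV'|].
by rewrite -(mres_comp s' r); exact: iso_locus.
Qed.

Lemma symb0_lift U (X : Der F U) D D' : is_lift X D -> is_lift X D' ->
  symb H 0 D = symb H 0 D'.
Proof.
move=> h h'; apply/eqP; rewrite -subr_eq0 -symbB //; apply/eqP.
by apply/(@symb_ker _ _ _ _ _ _ H 0) => //; exact: lift_filt1 h h'.
Qed.

Lemma unit_lift_unique U (X : Der F U) E E' :
  unit_lift X E -> unit_lift X E' -> E = E'.
Proof.
move=> h h'; apply: msep => x Ux.
have [V [s [Vx [i [D [D' [sV hD hD' e e']]]]]]] := unit_lift2 h h' Ux.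
exists V, s; split=> //; apply: (bij_inj (iso_bij (isof i) sV)).
by rewrite e e' (symb0_lift hD hD').
Qed.

Lemma unit_liftP U (a : F U) X Y (E E' : sDer O U) :
  unit_lift X E -> unit_lift Y E' -> unit_lift (a *: X + Y) (al a *: E + E').
Proof.
move=> h h' x Ux.
have [V [s [Vx [i [D [D' [sV hD hD' e e']]]]]]] := unit_lift2 h h' Ux.
exists V, s; split=> //; exists i, (al (ares s a) *: D + D'); split=> //.
  by rewrite mresP; exact: is_liftP.
rewrite mresP -amor_res (iso_linear (isof i)) // e e' symbD // symb_al //.
by rewrite (iso_linear isob) // (iso_linear (isou i)).
Qed.

Lemma unit_lift_filt1 U (X : Der F U) E : unit_lift X E ->
  locally_on (fun V (s : V `<=` U) => exists D : sDer O V,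
    is_lift (mres s X) D /\ filt 1 (mres s E - D)).
Proof.
move=> h x Ux; have [V [s [Vx [i [D [sV hD e]]]]]] := h x Ux.
by exists V, s; split=> //; exists D; split=> //; exact: (@fu i V sV _ _ e).
Qed.

(** Locally the section is the preimage under f_i of u_i b applied to the class of a lift. It does
    not depend on the lift or on i, so the local sections glue. *)
Lemma unit_lift_exists U (X : Der F U) : exists E : sDer O U, unit_lift X E.
Proof.
have ex : locally_on (fun V (s : V `<=` U) =>
    exists E : sDer O V, unit_lift (mres s X) E).
  move=> x Ux; have [V [s [Vx [D hD]]]] := local_lift O freeG X Ux.
  have [i _ Wx] := cov (Logic.I : [set: M] x).
  have l := sl V (W i); have r := sr V (W i).
  exists (opensI V (W i)), (subset_trans l s); split=> //.
  have [g fK gK] := iso_bij (isof i) r.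
  exists (g (u i (b (symb H 0 (mres l D))))); apply: locallyW.
  exists i, (mres l D); split=> //; rewrite mres_id ?gK //.
  by rewrite -(mres_comp s l); apply: is_lift_res.
have [||E hE] := glue_unique (@msheaf _ _ _ (sDer O)) _ _ ex.
- move=> V V' s t s' E h.
  by rewrite -(mres_comp s t s'); exact: unit_lift_res.
- by move=> V s E E'; exact: unit_lift_unique.
exists E; apply: unit_lift_loc => x Ux; have [V [s [Vx [E' h]]]] := ex x Ux.
by exists V, s; split=> //; rewrite (hE _ _ _ h).
Qed.

(** E differs locally from a lift of X by a section of JT, whose values have no component in F. *)
Lemma unit_lift_al U (X : Der F U) E : unit_lift X E ->
  forall (V : opens M) (s : V `<=` U) a,
  pi0 (sdapp E s (al a)) = dapp X s a.
Proof.
move=> h V s a; apply: asep => x Vx.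
have [V' [t [Vx' [D [[_ hD] hE]]]]] := unit_lift_filt1 h (s x Vx).
have l := sl V V'; have r := sr V V'; have q := subset_trans r t.
exists (opensI V V'), l; split=> //.
rewrite -pi0_res -(sdapp_res _ s l q) -(dapp_res _ s l q) -amor_res.
rewrite -(sdapp_mres t _ r) -(dapp_mres t _ r) -[mres t E](subrK D).
by rewrite sdapp_add pi0D (pi0_filt1 _ _ hE) add0r hD pi0_al.
Qed.

(** In pi_1 of E(f g) = E(f) g + f E(g), only the F-component of E(f) multiplies g, and that is X f.
    Uniqueness of E gives linearity in X. *)
Lemma unit_lift_connection : has_connection G.
Proof.
pose id U := @subset_refl _ (oset U : set M).
pose L U (X : Der F U) := sval (cid (unit_lift_exists X)).
have LP U (X : Der F U) : unit_lift X (L U X) by rewrite /L; case: cid.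
exists (fun U X g => pi1 (sdapp (L U X) (id U) (io g))); split.
- move=> U f' X Y g.
  rewrite (unit_lift_unique (LP _ _) (unit_liftP f' (LP _ X) (LP _ Y))) sdappP.
  by rewrite ares_id pi1D pi1M pi0_al pi1_al scaler0 addr0.
- move=> U k X g h; rewrite eiotaP sdappD amor_cst sdapp_cst pi1D pi1M.
  by rewrite -(amor_cst (ealpha O)) pi0_al pi1_al scaler0 addr0.
- move=> U V i X g.
  rewrite (unit_lift_unique (LP _ _) (unit_lift_res i (LP _ X))) eiota_res.
  by rewrite (sdapp_mres i _ _ (subset_trans (id V) i)) (sdapp_res _ (id U)) pi1_res.
- move=> U X f' g; rewrite eiotaZ sdapp_alM pi1D !pi1M (unit_lift_al (LP _ X)).
  by rewrite pi0_al pi1_al pi1_io pi0_io !scaler0 scale0r !addr0 addrC.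
Qed.

End Descent.

Hypothesis unit : corresponds_to H (H1_unit H).

Lemma unit_connection : has_connection G.
Proof.
have [I [W [f [u [b [c [cov hi hb hc hf]]]]]]] := unit_data unit.
apply: (@unit_lift_connection I W f u b c) => //.
- by move=> i; have [] := hi i.
- by move=> i; have [] := hi i.
- by move=> i j V si sj e; have [+ _] := hc i j V si sj; apply.
- by move=> i j V si sj e; have [_] := hc i j V si sj; apply.
Qed.

End UnitClass.

(** * Exterior monomials *)

Section Monomials.
Context (K : numFieldType) (M : topologicalType).
Context (F : comAlgSheaf K M) (G : modSheaf F) (O : extAlg G).

Local Notation al := (ealpha O _).
Local Notation io := (@eiota _ _ _ _ O _).

Variables (U : opens M) (r : nat) (e : 'I_r -> G U).
Hypothesis eP : is_basis e.
Local Notation pd i s := (sdapp (pderiv O eP i) s).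

Section Products.
Variables (V : opens M) (s : V `<=` U).
Let x i : O V := io (mres s (e i)).

(** The factors follow the order of the list. Arbitrary lists are allowed for the sake of induction;
    [mono] uses the enumeration of all indices. *)
Definition mono_seq (l : seq 'I_r) (I : {set 'I_r}) : O V :=
  \prod_(i <- l | i \in I) x i.

Lemma io_anticomm (g h : G V) : io g * io h = - (io h * io g).
Proof. by rewrite (scommute (eiota_odd O g) (eiota_odd O h)) expr1 mulN1r. Qed.

Lemma mono_seq_cons j l I : mono_seq (j :: l) I =
  if j \in I then x j * mono_seq l I else mono_seq l I.
Proof. by rewrite /mono_seq big_cons. Qed.

Lemma mono_seqU1 l i I : i \notin l -> mono_seq l (i |: I) = mono_seq l I.
Proof.
move=> il; rewrite /mono_seq big_seq_cond [RHS]big_seq_cond.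
apply: eq_bigl => j; case: (boolP (j \in l)) => //= jl.
by rewrite finset.in_setU1; case: eqP jl il => // -> ->.
Qed.

Lemma mono_seqD1 l i I : i \notin l -> mono_seq l (I :\ i) = mono_seq l I.
Proof.
move=> il; rewrite /mono_seq big_seq_cond [RHS]big_seq_cond.
apply: eq_bigl => j; case: (boolP (j \in l)) => //= jl.
by rewrite finset.in_setD1; case: eqP jl il => // -> ->.
Qed.

(** Moving x_i to its place only produces signs. Their value is left implicit, since it does not
    affect whether coefficients exist or vanish. *)
Lemma io_mono_seq l i I : uniq l -> i \in l -> exists k : bool,
  x i * mono_seq l I =
  (-1) ^+ k * (if i \in I then 0 else mono_seq l (i |: I)).
Proof.
elim: l => [//|j l IH] /= /andP[jl ul]; rewrite in_cons.
have [eij _|ij /= il] := eqVneq i j.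
  exists false; rewrite eij mul1r !mono_seq_cons finset.setU11.
  case: ifP => jI; last by rewrite mono_seqU1.
  by rewrite mulrA [x j * x j]eiota_sqr mul0r.
have [k hk] := IH ul il; rewrite !mono_seq_cons finset.in_setU1 eq_sym (negPf ij) /=.
case: ifP => jI; last by exists k.
exists (~~ k); rewrite mulrA [x i * x j]io_anticomm mulNr -mulrA hk mulrA.
rewrite [x j * (-1) ^+ _]commr_sign -mulrA -mulNr signrN.
by case: ifP => _; rewrite ?mulr0.
Qed.

Lemma pderiv_mono_seq l i I : uniq l -> exists k : bool,
  pd i s (mono_seq l I) =
  (-1) ^+ k * (if (i \in l) && (i \in I) then mono_seq l (I :\ i) else 0).
Proof.
elim: l => [_|j l IH /= /andP[jl ul]].
  exists false; rewrite /mono_seq big_nil mulr0 -(rmorph1 al); exact: pderiv_al.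
rewrite in_cons !mono_seq_cons finset.in_setD1; have [k hk] := IH ul.
have pdx : pd i s (x j) = al (i == j)%:R by rewrite pderiv_io coor_e.
have pdM : pd i s (x j * mono_seq l I) =
    al (i == j)%:R * mono_seq l I - x j * pd i s (mono_seq l I).
  by rewrite pderivM pdx (tw_par _ (eiota_odd O _)) expr1 mulN1r mulNr.
have [eij|ij] := eqVneq i j; rewrite /= in pdM *.
  move: hk pdM; rewrite eij (negPf jl) /= eqxx mulr0 => hk.
  rewrite hk rmorph1 mul1r mulr0 subr0 => pdM.
  exists false; rewrite mul1r mono_seqD1 //.
  by case: ifP.
case: ifP => jI; last by exists k.
exists (~~ k); rewrite pdM (negPf ij) rmorph0 mul0r add0r hk mulrA.
rewrite [x j * (-1) ^+ _]commr_sign -mulrA -mulNr signrN.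
by case: ifP => _; rewrite ?mulr0.
Qed.

Definition mono (I : {set 'I_r}) : O V := mono_seq (index_enum 'I_r) I.

Lemma mono0 : mono finset.set0 = 1.
Proof. by rewrite /mono /mono_seq big1 // => i; rewrite inE. Qed.

Lemma io_mono i I : exists k : bool,
  x i * mono I = (-1) ^+ k * (if i \in I then 0 else mono (i |: I)).
Proof. by apply: io_mono_seq; rewrite ?index_enum_uniq ?mem_index_enum. Qed.

Lemma pderiv_mono i I : exists k : bool,
  pd i s (mono I) = (-1) ^+ k * (if i \in I then mono (I :\ i) else 0).
Proof.
have [k hk] := @pderiv_mono_seq (index_enum 'I_r) i I (index_enum_uniq _).
by exists k; rewrite hk mem_index_enum.
Qed.

Lemma pi0_mono I : pi0 (mono I) = (I == finset.set0)%:R.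
Proof.
have [->|[i iI]] := set_0Vmem I.
  by rewrite mono0 eqxx -(rmorph1 al) pi0_al.
have -> : I == finset.set0 = false by apply/negP => /eqP I0; rewrite I0 inE in iI.
suff h l : i \in l -> pi0 (mono_seq l I) = 0 by apply: h; exact: mem_index_enum.
elim: l => [//|j l IH]; rewrite in_cons mono_seq_cons => /orP[/eqP <-|il].
  by rewrite iI pi0M pi0_io mul0r.
by case: ifP => _; rewrite ?pi0M IH // mulr0.
Qed.

Lemma Odeg_mono_set (I : {set 'I_r}) : Odeg #|I| (mono I).
Proof.
have -> : #|I| = count (mem I) (index_enum 'I_r).
  by rewrite -sum1_card -sum1_count.
rewrite /mono; elim: (index_enum _) => [|j l IH] /=.
  by rewrite /mono_seq big_nil -(rmorph1 al); exact: Odeg0_al.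
by rewrite mono_seq_cons; case: ifP => _ //; exact: Odeg_ioM.
Qed.

Lemma filt_mono (E : superMod O) (I : {set 'I_r}) (v : E V) : filt #|I| (mono I *: v).
Proof.
have -> : #|I| = count (mem I) (index_enum 'I_r).
  by rewrite -sum1_card -sum1_count.
rewrite /mono; elim: (index_enum _) => [|j l IH] /=; first exact: Logic.I.
rewrite mono_seq_cons; case: ifP => _ //; rewrite -scalerA.
by apply: filt_mul => //; apply: odd_oddIdeal; exact: eiota_odd.
Qed.

(* Sections all of whose iterated contractions of order < p have no component *)
(* of degree 0, i.e. sections of J^p.                                         *)
Fixpoint Jpow (p : nat) (a : O V) : Prop :=
  if p is q.+1 then pi0 a = 0 /\ forall i, Jpow q (pd i s a) else True.

Lemma JpowD p a b : Jpow p a -> Jpow p b -> Jpow p (a + b).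
Proof.
elim: p a b => [//|p IH] a b /= [a0 ha] [b0 hb]; split.
  by rewrite pi0D a0 b0 addr0.
by move=> i; rewrite sdappD; apply: IH.
Qed.

Lemma JpowS p a : Jpow p.+1 a -> Jpow p a.
Proof. by elim: p a => [//|p IH] a [a0 ha]; split=> // i; exact: IH. Qed.

Lemma Jpow_le p q a : (p <= q)%N -> Jpow q a -> Jpow p a.
Proof.
move=> /subnK <-; elim: (q - p)%N => [//|k IH]; rewrite addSn => /JpowS.
exact: IH.
Qed.

Lemma JpowM p a b : Jpow p b -> Jpow p (a * b).
Proof.
elim: p a b => [//|p IH] a b hb; split; first by rewrite pi0M hb.1 mulr0.
move=> i; rewrite pderivM; apply: JpowD; apply: IH; first exact: JpowS.
exact: hb.2.
Qed.

Lemma JpowM1 p a b : pi0 a = 0 -> Jpow p b -> Jpow p.+1 (a * b).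
Proof.
elim: p a b => [|p IH] a b a0 hb; split; rewrite ?pi0M ?a0 ?mul0r // => i.
rewrite pderivM; apply: JpowD; first exact: JpowM.
by apply: IH; [rewrite pi0_tw|exact: hb.2].
Qed.

Lemma Jpow0 p : Jpow p 0.
Proof. by elim: p => [//|p IH]; split; rewrite ?pi00 // => i; rewrite sdapp0. Qed.

Lemma Jpow_sum p (J : finType) (P : pred J) (a : J -> O V) :
  (forall i, P i -> Jpow p (a i)) -> Jpow p (\sum_(i | P i) a i).
Proof.
by move=> h; apply: (big_ind (Jpow p)) => //; [exact: Jpow0|exact: JpowD].
Qed.

Lemma JpowN p a : Jpow p a -> Jpow p (- a).
Proof. by rewrite -mulN1r; exact: JpowM. Qed.

Lemma Jpow_mono (I : {set 'I_r}) a : Jpow #|I| (mono I * a).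
Proof.
have -> : #|I| = count (mem I) (index_enum 'I_r).
  by rewrite -sum1_card -sum1_count.
rewrite /mono; elim: (index_enum _) => [//|j l IH] /=.
rewrite mono_seq_cons; case: ifP => _ //; rewrite -mulrA.
by apply: JpowM1 => //; exact: pi0_io.
Qed.

(** The coefficient of the empty monomial is read off by pi_0. Contraction with an index i of I
    turns the coefficient at I, up to sign, into one at I minus i, while p drops by one. *)
Lemma Jpow_coef p (f : {set 'I_r} -> F V) :
  Jpow p (\sum_I mono I * al (f I)) -> forall I : {set 'I_r}, (#|I| < p)%N -> f I = 0.
Proof.
elim: p f => [//|p IH] f [f0 hf] I Ip.
have pi0f : pi0 (\sum_I mono I * al (f I)) = f finset.set0.
  rewrite (big_morph _ (@pi0D _ _ _ _ O V) (pi00 O V)) (bigD1 finset.set0) //=.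
  rewrite pi0M pi0_mono eqxx mul1r pi0_al big1 ?addr0 // => J /negPf J0.
  by rewrite pi0M pi0_mono J0 mul0r.
have [->|[i iI]] := set_0Vmem I; first by rewrite -pi0f.
pose k J := sval (cid (pderiv_mono i J)).
have hk J : pd i s (mono J) =
    (-1) ^+ (k J) * (if i \in J then mono (J :\ i) else 0).
  by rewrite /k; case: cid.
(* The coefficients of the contracted section: the monomials containing i lose it, and no others
   survive. *)
pose h (J : {set 'I_r}) := if i \in J then 0 else (-1) ^+ (k (i |: J)) * f (i |: J).
have e1 : pd i s (\sum_I mono I * al (f I)) = \sum_J mono J * al (h J).
  rewrite sdapp_sum.
  transitivity (\sum_(J : {set 'I_r} | i \in J) mono (J :\ i) * al ((-1) ^+ (k J) * f J)).
    rewrite [RHS]big_mkcond; apply: eq_bigr => J _.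
    rewrite pderivM pderiv_al mulr0 addr0 hk; case: ifP => _.
      by rewrite rmorphM rmorph_sign mulrA commr_sign.
    by rewrite mulr0 mul0r.
  transitivity (\sum_(J : {set 'I_r} | i \notin J)
      mono J * al ((-1) ^+ (k (i |: J)) * f (i |: J))).
    rewrite (reindex_onto (fun J => i |: J) (fun J => J :\ i)) /=; last first.
      by move=> J; exact: finset.setD1K.
    apply: eq_big => [J|J]; last by case/andP=> _ /eqP ->.
    rewrite finset.setU11 /=; apply/eqP/idP => [<-|]; first by rewrite finset.setD11.
    exact: finset.setU1K.
  rewrite big_mkcond; apply: eq_bigr => J _; rewrite /h.
  by case: (i \in J); rewrite //= rmorph0 mulr0.
have := IH h; rewrite -e1 => /(_ (hf i) (I :\ i)).
rewrite /h finset.setD11 finset.setD1K // => /(_ _)/eqP; rewrite mulrI_eq0 => [fI|].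
  by apply/eqP/fI; rewrite (cardsD1 i) iI in Ip.
exact: lregX (lregN (@lreg1 _)).
Qed.

End Products.

End Monomials.

(** * Coefficients of sections and of derivations *)

Section Coefficients.
Context (K : numFieldType) (M : topologicalType).
Context (F : comAlgSheaf K M) (G : modSheaf F) (O : extAlg G).

Local Notation al := (ealpha O _).
Local Notation io := (@eiota _ _ _ _ O _).

Variables (U : opens M) (r : nat) (e : 'I_r -> G U).
Hypothesis eP : is_basis e.
Local Notation pd i s := (sdapp (pderiv O eP i) s).
Local Notation mon s I := (mono O e s I).
Implicit Types I J : {set 'I_r}.

Lemma Jpow_loc p (V : opens M) (s : V `<=` U) (a : O V) :
  locally_on (fun W (t : W `<=` V) =>
    Jpow eP (subset_trans t s) p (ares t a)) -> Jpow eP s p a.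
Proof.
elim: p a => [//|p IH] a h; split.
  apply: asep => x Vx; have [W [t [Wx [h0 _]]]] := h x Vx.
  by exists W, t; split=> //; rewrite -pi0_res h0 rmorph0.
move=> i; apply: IH => x Vx; have [W [t [Wx [_ hW]]]] := h x Vx.
exists W, t; split=> //.
rewrite -(sdapp_res _ s t (subset_trans t s)); exact: hW.
Qed.

Lemma mono_res (V W : opens M) (s : V `<=` U) (t : W `<=` V) (s' : W `<=` U) I :
  ares t (mon s I) = mon s' I.
Proof.
rewrite /mono /mono_seq rmorph_prod; apply: eq_bigr => i _.
by rewrite -eiota_res (mres_comp s t s').
Qed.

(** [Jpow_coef] applied to 0, with p = r + 1 exceeding every cardinality. *)
Lemma mono_free (V : opens M) (s : V `<=` U) (f f' : {set 'I_r} -> F V) :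
  \sum_I mon s I * al (f I) = \sum_I mon s I * al (f' I) -> forall I, f I = f' I.
Proof.
move=> h I; apply/eqP; rewrite -subr_eq0; apply/eqP.
apply: (@Jpow_coef _ _ _ _ O _ _ _ eP _ s r.+1 (fun I => f I - f' I)).
  rewrite (eq_bigr (fun I => mon s I * al (f I) - mon s I * al (f' I))).
    by rewrite sumrB h subrr; exact: Jpow0.
  by move=> J _; rewrite rmorphB mulrBr.
by rewrite ltnS -[r in (_ <= r)%N]card_ord max_card.
Qed.

Definition expansion (V : opens M) (s : V `<=` U) (a : O V) :=
  exists f : {set 'I_r} -> F V, a = \sum_I mon s I * al (f I).

Lemma expansionD (V : opens M) (s : V `<=` U) a b :
  expansion s a -> expansion s b -> expansion s (a + b).
Proof.
move=> [f ->] [g ->]; exists (fun I => f I + g I); rewrite -big_split.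
by apply: eq_bigr => I _; rewrite rmorphD mulrDr.
Qed.

Lemma expansion_alM (V : opens M) (s : V `<=` U) f a :
  expansion s a -> expansion s (al f * a).
Proof.
move=> [g ->]; exists (fun I => f * g I); rewrite mulr_sumr.
by apply: eq_bigr => I _; rewrite rmorphM mulrA ealphaC -mulrA.
Qed.

Lemma expansion_mono (V : opens M) (s : V `<=` U) I f :
  expansion s (mon s I * al f).
Proof.
exists (fun J => if J == I then f else 0); rewrite (bigD1 I) //= eqxx.
by rewrite big1 ?addr0 // => J /negPf ->; rewrite rmorph0 mulr0.
Qed.

Lemma expansion_sum (V : opens M) (s : V `<=` U) (J : finType) (a : J -> O V) :
  (forall i, expansion s (a i)) -> expansion s (\sum_i a i).
Proof.
move=> h; apply: (big_ind (expansion s)) => // [|a' b'].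
  have := expansion_mono s finset.set0 0; by rewrite rmorph0 mulr0.
exact: expansionD.
Qed.

Lemma expansion_io (V : opens M) (s : V `<=` U) i a :
  expansion s a -> expansion s (io (mres s (e i)) * a).
Proof.
move=> [f ->]; rewrite mulr_sumr; apply: expansion_sum => I.
have [k hk] := io_mono O e s i I; rewrite mulrA hk -mulrA.
rewrite -(rmorph_sign al); apply: expansion_alM; case: ifP => _.
  by rewrite mul0r; have := expansion_mono s I 0; rewrite rmorph0 mulr0.
exact: expansion_mono.
Qed.

(** The delicate case of the induction is gluing: by [mono_free] the local coefficients are unique,
    so they agree on overlaps. *)
Lemma expansion_exists (V : opens M) (s : V `<=` U) a : expansion s a.
Proof.
move: V s a; apply: O_ind => [V s f|V s a b|V s g a ha|V s a h].
- by have := expansion_mono s finset.set0 f; rewrite mono0 mul1r.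
- exact: expansionD.
- rewrite (coorP eP s g) eiota_sum mulr_suml; apply: expansion_sum => i.
  by rewrite eiotaZ -mulrA; apply: expansion_alM; exact: expansion_io.
pose P I (W : opens M) (t : W `<=` V) v := exists f : {set 'I_r} -> F W,
  ares t a = \sum_I mon (subset_trans t s) I * al (f I) /\ f I = v.
have glued I : exists v : F V, forall (W : opens M) (t : W `<=` V) w,
    P I W t w -> ares t v = w.
  apply: (glue_unique (@asheaf _ _ F)) => [W W' t u t' v [f [hf <-]]|W t v w|].
  - exists (fun I => ares u (f I)); split=> //.
    rewrite -(ares_comp t u t') hf rmorph_sum; apply: eq_bigr => J _.
    by rewrite rmorphM amor_res (mono_res _ _ (subset_trans t' s)).
  - move=> [f [hf <-]] [g [hg <-]]; apply: (mono_free (s := subset_trans t s)).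
    by rewrite -hf.
  - move=> x Vx; have [W [t [Wx [f hf]]]] := h x Vx.
    by exists W, t; split=> //; exists (f I), f.
exists (fun I => sval (cid (glued I))); apply: asep => x Vx.
have [W [t [Wx [f hf]]]] := h x Vx; exists W, t; split=> //.
rewrite hf rmorph_sum; apply: eq_bigr => I _.
rewrite rmorphM -amor_res (mono_res s t (subset_trans t s)).
by case: cid => v /= /(_ W t (f I)) -> //; exists f.
Qed.

Definition coef (V : opens M) (s : V `<=` U) (a : O V) : {set 'I_r} -> F V :=
  sval (cid (expansion_exists s a)).

Lemma coefP (V : opens M) (s : V `<=` U) (a : O V) :
  a = \sum_I mon s I * al (coef s a I).
Proof. by rewrite /coef; case: cid. Qed.

Lemma coefE (V : opens M) (s : V `<=` U) (a : O V) f :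
  a = \sum_I mon s I * al (f I) -> forall I, coef s a I = f I.
Proof. by move=> h; apply: (mono_free (s := s)); rewrite -coefP. Qed.

Lemma coefD (V : opens M) (s : V `<=` U) (a b : O V) I :
  coef s (a + b) I = coef s a I + coef s b I.
Proof.
apply: (@coefE _ _ _ (fun I => coef s a I + coef s b I)).
rewrite {1}(coefP s a) {1}(coefP s b) -big_split.
by apply: eq_bigr => J _; rewrite rmorphD mulrDr.
Qed.

Lemma coef_alM (V : opens M) (s : V `<=` U) f (a : O V) I :
  coef s (al f * a) I = f * coef s a I.
Proof.
apply: (@coefE _ _ _ (fun I => f * coef s a I)).
rewrite {1}(coefP s a) mulr_sumr.
by apply: eq_bigr => J _; rewrite rmorphM mulrA ealphaC -mulrA.
Qed.

Lemma coef_res (V W : opens M) (s : V `<=` U) (t : W `<=` V) (s' : W `<=` U) a I :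
  coef s' (ares t a) I = ares t (coef s a I).
Proof.
apply: (@coefE _ _ _ (fun I => ares t (coef s a I))).
rewrite {1}(coefP s a) rmorph_sum.
by apply: eq_bigr => J _; rewrite rmorphM (mono_res s t s') amor_res.
Qed.

(** F is central in O and taking coefficients is F-linear, so each coefficient of f -> D f inherits
    the Leibniz rule. *)
Lemma component_exists (D : sDer O U) I : exists X : Der F U,
  forall (V : opens M) (s : V `<=` U) f, dapp X s f = coef s (sdapp D s (al f)) I.
Proof.
apply: mk_Der => [V s c f g|V s f g|V W s t s' f].
- rewrite rmorphD rmorphM amor_cst sdappD sdapp_cst coefD.
  by rewrite -(amor_cst (ealpha O)) coef_alM.
- rewrite rmorphM sdapp_alM coefD coef_alM -ealphaC coef_alM.
  by rewrite [g * _]calgC.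
- by rewrite amor_res (sdapp_res D s t) (coef_res s t).
Qed.

(** Each coefficient from J in a local expression of D raises the order of its values by one. *)
Lemma filt_Jpow p (V : opens M) (s : V `<=` U) (D : sDer O V) : filt p D ->
  forall (W : opens M) (t : W `<=` V) a,
  Jpow eP (subset_trans t s) p (sdapp D t a).
Proof.
elim: p V s D => [//|p IH] V s D hD W t a; apply: Jpow_loc => x Wx.
have [V' [s' [Vx [m [b [w [hb hw eD]]]]]]] := hD x (t x Wx).
have l := @Defs.subIl M W V'; have q := @Defs.subIr M W V'.
exists (opensI W V'), l; split=> //.
rewrite -(sdapp_res D t l (subset_trans q s')) -(sdapp_mres s' D q) eD sum_sdapp.
apply: Jpow_sum => i _; apply: JpowM1.
  by apply: pi0_oddIdeal; exact: oddIdeal_res.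
rewrite (Prop_irrelevance (subset_trans l (subset_trans t s))
  (subset_trans q (subset_trans s' s))).
exact: (IH _ _ _ (hw i)).
Qed.

End Coefficients.

(** * From a connection to the unit class *)

Section SplitTangent.
Context (K : numFieldType) (M : topologicalType).
Context (F : comAlgSheaf K M) (G : modSheaf F) (O : extAlg G).
Hypothesis freeG : locally_free G.
Variable H : retract (sDer O).
Variable nabla : forall V, Der F V -> G V -> G V.
Hypothesis nablaP : is_connection nabla.

Local Notation al := (ealpha O _).
Local Notation io := (@eiota _ _ _ _ O _).
Local Notation id U := (@subset_refl _ (oset U : set M)).
Local Notation sl V W := (@Defs.subIl M V W).
Local Notation sr V W := (@Defs.subIr M V W).

Lemma nabla0 V (g : G V) : nabla 0 g = 0.
Proof.
have := connection_linl nablaP (-1) 0 0 g.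
by rewrite scaler0 addr0 scaleN1r addNr.
Qed.

(* The F-module generated by the horizontal lifts of vector fields and the    *)
(* contractions: it is mapped isomorphically onto T/JT.                       *)
Definition principal V (Z : sDer O V) := exists X : Der F V,
  (forall (W : opens M) (s : W `<=` V) f, sdapp Z s (al f) = al (dapp X s f)) /\
  (forall (W : opens M) (s : W `<=` V) g, exists n,
     sdapp Z s (io g) = io (nabla (mres s X) g) + al n).

Lemma principal_res (U V : opens M) (s : V `<=` U) Z :
  principal Z -> principal (mres s Z).
Proof.
move=> [X [hf hg]]; exists (mres s X); split=> W t x.
  rewrite (sdapp_mres s Z t (subset_trans t s)) hf.
  by rewrite (dapp_mres s X t (subset_trans t s)).
rewrite (sdapp_mres s Z t (subset_trans t s)) (mres_comp s t (subset_trans t s)).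
exact: hg.
Qed.

Lemma principalP U (a : F U) Z Z' :
  principal Z -> principal Z' -> principal (al a *: Z + Z').
Proof.
move=> [X [hf hg]] [X' [hf' hg']]; exists (a *: X + X'); split=> W s x.
  by rewrite sdappP hf hf' -amor_res -rmorphM -rmorphD.
have [n hn] := hg W s x; have [n' hn'] := hg' W s x.
exists (ares s a * n + n'); rewrite sdappP hn hn' mresP (connection_linl nablaP).
by rewrite eiotaP -amor_res mulrDr rmorphD rmorphM addrACA.
Qed.

Lemma principal0 U : principal (0 : sDer O U).
Proof.
exists 0; split=> W s x; first by rewrite dapp0 rmorph0.
by exists 0; rewrite mres0 nabla0 eiota0 rmorph0 addr0.
Qed.

Lemma principalZ U (a : F U) Z : principal Z -> principal (al a *: Z).
Proof.
move=> h; rewrite -[_ *: _]addr0.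
by apply: principalP => //; exact: principal0.
Qed.

Lemma principalD U (Z Z' : sDer O U) :
  principal Z -> principal Z' -> principal (Z + Z').
Proof. by move=> h; rewrite -[Z]scale1r -(rmorph1 al); exact: principalP. Qed.

Lemma principal_sum U (J : finType) (P : pred J) (Z : J -> sDer O U) :
  (forall i, P i -> principal (Z i)) -> principal (\sum_(i | P i) Z i).
Proof.
by move=> h; apply: (big_ind (@principal U)) => //;
  [exact: principal0|exact: principalD].
Qed.

Lemma principal_sigma U (X : Der F U) : principal (nabla_sigma O nablaP X).
Proof.
exists X; split=> W s x; first by rewrite nabla_sigma_al.
by exists 0; rewrite nabla_sigma_io rmorph0 addr0.
Qed.

Lemma sdapp_mproj k U (Z : sDer O U) (V : opens M) (s : V `<=` U) a :
  sdapp (mproj (sDer O) k Z) s a =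
  sproj O k (sdapp Z s (sproj O false a)) +
  sproj O (~~ k) (sdapp Z s (sproj O true a)).
Proof. by []. Qed.

(** The even part of a principal derivation is the horizontal lift of its vector field, the odd part
    a contraction. *)
Lemma principal_mproj k U (Z : sDer O U) :
  principal Z -> principal (mproj (sDer O) k Z).
Proof.
move=> [X [hf hg]].
have ef (V : opens M) (s : V `<=` U) f :
    sdapp (mproj (sDer O) k Z) s (al f) = if k then 0 else al (dapp X s f).
  by rewrite sdapp_mproj !sproj_al sdapp0 sproj0 addr0 hf sproj_al.
have eg (V : opens M) (s : V `<=` U) g : exists n,
    sdapp (mproj (sDer O) k Z) s (io g) =
    if k then al n else io (nabla (mres s X) g).
  have [n en] := hg V s g; exists n.
  rewrite sdapp_mproj !(sproj_other _ (eiota_odd O g)) sdapp0 sproj0 add0r.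
  rewrite en sprojD sproj_al (sproj_other _ (eiota_odd O _)).
  by case: (k); rewrite ?add0r ?addr0.
case: k ef eg => ef eg; [exists 0|exists X]; split=> W s x.
- by rewrite ef dapp0 rmorph0.
- by have [n ->] := eg W s x; exists n; rewrite mres0 nabla0 eiota0 add0r.
- exact: ef.
- by have [n ->] := eg W s x; exists 0; rewrite rmorph0 addr0.
Qed.

(** * Local expansions in principal derivations *)

Section Local.
Variables (U : opens M) (r : nat) (e : 'I_r -> G U).
Hypothesis eP : is_basis e.
Local Notation mon s I := (mono O e s I).
Implicit Types I J : {set 'I_r}.

Lemma principal_pderiv i : principal (pderiv O eP i).
Proof.
exists 0; split=> W s x; first by rewrite pderiv_al dapp0 rmorph0.
by exists (coor eP s x i); rewrite pderiv_io mres0 nabla0 eiota0 add0r.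
Qed.

(** On F, D is the sum of the e_I X_I for its component vector fields. Subtracting the horizontal
    lifts leaves a derivation killing F, that is, a combination of contractions; their coefficients
    are then expanded in monomials. *)
Lemma principal_expansion (D : sDer O U) : exists Z : {set 'I_r} -> sDer O U,
  (forall I, principal (Z I)) /\ D = \sum_I mon (id U) I *: Z I.
Proof.
pose X I := sval (cid (component_exists eP D I)).
have hX I (V : opens M) (s : V `<=` U) f :
    dapp (X I) s f = coef eP s (sdapp D s (al f)) I.
  by rewrite /X; case: cid.
pose S I := nabla_sigma O nablaP (X I).
pose C := D - \sum_I mon (id U) I *: S I.
have hC (V : opens M) (s : V `<=` U) f : sdapp C s (al f) = 0.
  rewrite /C addrC -scaleN1r sdappP rmorphN rmorph1 mulN1r sum_sdapp.
  rewrite [X in _ + X](coefP eP s) addrC; apply/eqP; rewrite subr_eq0; apply/eqP.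
  apply: eq_bigr => I _; rewrite (mono_res O e (id U) s s) nabla_sigma_al.
  by rewrite hX.
pose b i := sdapp C (id U) (io (e i)).
exists (fun I => S I + \sum_i al (coef eP (id U) (b i) I) *: pderiv O eP i); split.
  move=> I; apply: principalD; first exact: principal_sigma.
  by apply: principal_sum => i _; apply: principalZ; exact: principal_pderiv.
have -> : D = \sum_I mon (id U) I *: S I + C by rewrite /C addrC subrK.
rewrite {1}(kernel_expansion eP hC) -/b.
rewrite [RHS](eq_bigr (fun I => mon (id U) I *: S I +
  \sum_i (mon (id U) I * al (coef eP (id U) (b i) I)) *: pderiv O eP i)).
  rewrite big_split exchange_big /=; congr (_ + _); apply: eq_bigr => i _.
  by rewrite -scaler_suml -(coefP eP).
move=> I _; rewrite scalerDr scaler_sumr; congr (_ + _).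
by apply: eq_bigr => i _; rewrite scalerA.
Qed.

(** Values of a derivation in J^p T lie in J^p, where coefficients of monomials of length below p
    vanish. This is applied to values on F, then to values on G. *)
Lemma filt_components p (Z : {set 'I_r} -> sDer O U) :
  (forall I, principal (Z I)) -> filt p (\sum_I mon (id U) I *: Z I) ->
  forall I, (#|I| < p)%N -> Z I = 0.
Proof.
move=> hZ hp I Ip.
have ev (V : opens M) (s : V `<=` U) a :
    Jpow eP s p (\sum_I mon s I * sdapp (Z I) s a).
  have := filt_Jpow eP (id U) hp s a; rewrite sum_sdapp.
  rewrite (Prop_irrelevance (subset_trans s (id U)) s).
  by under eq_bigr do rewrite (mono_res O e (id U) s s).
pose X J := sval (cid (hZ J)).
have [hf hg] : (forall J (V : opens M) (s : V `<=` U) f,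
    sdapp (Z J) s (al f) = al (dapp (X J) s f)) /\
    (forall J (W : opens M) (s : W `<=` U) g, exists n,
     sdapp (Z J) s (io g) = io (nabla (mres s (X J)) g) + al n).
  by split=> J; rewrite /X; case: cid => ? [].
(* On F only the vector fields X_J are seen, so the coefficients of the value already lie in F. *)
have X0 J : (#|J| < p)%N -> X J = 0.
  move=> Jp; apply: Der_eq => V s f; rewrite dapp0.
  apply: (@Jpow_coef _ _ _ _ O _ _ _ eP _ s p (fun I => dapp (X I) s f)) Jp.
  by have := ev V s (al f); under eq_bigr do rewrite hf.
(* Once X_J = 0, the remaining part of Z_J is a contraction, so its values on G also lie in F. *)
have Z0 J (V : opens M) (s : V `<=` U) g : (#|J| < p)%N ->
    sdapp (Z J) s (io g) = al (pi0 (sdapp (Z J) s (io g))).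
  move=> Jp; have [n ->] := hg J V s g.
  by rewrite X0 // mres0 nabla0 eiota0 add0r pi0_al.
apply: sDer_eq => V s x.
  by rewrite hf X0 // dapp0 rmorph0.
rewrite Z0 //.
have := @Jpow_coef _ _ _ _ O _ _ _ eP _ s p
  (fun I : {set 'I_r} => if (#|I| < p)%N then pi0 (sdapp (Z I) s (io x)) else 0).
move=> /(_ _ I Ip); rewrite Ip => -> //; first by rewrite rmorph0.
(* The values of Z_J for |J| >= p need not lie in F; their terms are in J^p anyway and are removed
   before coefficients are compared. *)
have -> : \sum_(J : {set 'I_r}) mon s J * al (if (#|J| < p)%N
      then pi0 (sdapp (Z J) s (io x)) else 0) =
    \sum_I mon s I * sdapp (Z I) s (io x) -
    \sum_(I : {set 'I_r} | (p <= #|I|)%N) mon s I * sdapp (Z I) s (io x).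
  rewrite [X in _ - X]big_mkcond -sumrB; apply: eq_bigr => J _.
  rewrite [(p <= _)%N]leqNgt; case: (boolP (#|J| < p)%N) => Jp /=.
    by rewrite subr0 -Z0.
  by rewrite subrr rmorph0 mulr0.
apply: JpowD; first exact: ev.
apply: JpowN; apply: Jpow_sum => J Jp; apply: (Jpow_le Jp); exact: Jpow_mono.
Qed.

Lemma symb_homogeneous p (Z : {set 'I_r} -> sDer O U) :
  symb H p (\sum_(I : {set 'I_r} | #|I| == p) mon (id U) I *: Z I) =
  \sum_(I : {set 'I_r} | #|I| == p) mon (id U) I *: symb H 0 (Z I).
Proof.
rewrite symb_sum => [|I /eqP <-]; last exact: filt_mono.
apply: eq_bigr => I /eqP Ip; rewrite -[p in LHS]addn0 symbZ //.
by rewrite -Ip; exact: Odeg_mono_set.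
Qed.

Lemma filt_high p (E : superMod O) (Z : {set 'I_r} -> E U) :
  (forall I : {set 'I_r}, (#|I| < p)%N -> Z I = 0) ->
  filt p.+1 (\sum_(I : {set 'I_r} | #|I| != p) mon (id U) I *: Z I).
Proof.
move=> Z0; apply: filt_sum => I; rewrite neq_ltn => /orP[Ip|Ip].
  by rewrite Z0 // scaler0; exact: filt0.
exact: filt_le Ip (filt_mono _ _ _ _).
Qed.

(** The terms with |I| < p vanish by [filt_components], and those with |I| > p lie in J^(p+1) T. *)
Lemma symb_components p (Z : {set 'I_r} -> sDer O U) :
  (forall I, principal (Z I)) -> filt p (\sum_I mon (id U) I *: Z I) ->
  symb H p (\sum_I mon (id U) I *: Z I) =
  \sum_(I : {set 'I_r} | #|I| == p) mon (id U) I *: symb H 0 (Z I).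
Proof.
move=> hZ hp; have Z0 := filt_components hZ hp.
rewrite (bigID (fun I : {set 'I_r} => #|I| == p)) /=.
have h2 := filt_high Z0; rewrite symbD ?symb_homogeneous; last exact: filtS.
  by rewrite (proj2 (symb_ker H (filtS h2)) h2) addr0.
by apply: filt_sum => I /eqP <-; exact: filt_mono.
Qed.

(** Grouped by |I|, the terms are homogeneous, so the part of degree |I| vanishes separately. Its
    preimage then lies in J^(|I|+1) T and [filt_components] applies. *)
Lemma symb_free (Z : {set 'I_r} -> sDer O U) : (forall I, principal (Z I)) ->
  \sum_I mon (id U) I *: symb H 0 (Z I) = 0 -> forall I, Z I = 0.
Proof.
move=> hZ h I.
pose v p := \sum_(I : {set 'I_r} | #|I| == p) mon (id U) I *: Z I.
have fv p : filt p (v p) by apply: filt_sum => J /eqP <-; exact: filt_mono.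
have Ir (J : {set 'I_r}) : (#|J| < r.+1)%N.
  by rewrite ltnS -[r in (_ <= r)%N]card_ord max_card.
have sv : symb H #|I| (v #|I|) = 0.
  apply: (symb_direct fv (m := r.+1)); last exact: Ir.
  rewrite -[RHS]h (partition_big (fun J : {set 'I_r} => Ordinal (Ir J)) xpredT) //=.
  by apply: eq_bigr => p _; rewrite /v symb_homogeneous; apply: eq_bigl.
have /(symb_ker H (fv _)) := sv.
pose Z' J := if #|J| == #|I| then Z J else 0.
have -> : v #|I| = \sum_J mon (id U) J *: Z' J.
  rewrite /v big_mkcond; apply: eq_bigr => J _; rewrite /Z'.
  by case: ifP => // _; rewrite scaler0.
have hZ' J : principal (Z' J) by rewrite /Z'; case: ifP => // _; exact: principal0.
by move=> /(filt_components hZ')/(_ I (ltnSn _)); rewrite /Z' eqxx.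
Qed.

End Local.

(** * The global isomorphism T -> gr T *)

Definition spanned V (D : sDer O V) (h : H V) := exists (J : finType)
  (a : J -> O V) (Z : J -> sDer O V), [/\ forall j, principal (Z j),
    D = \sum_j a j *: Z j & h = \sum_j a j *: symb H 0 (Z j)].

Lemma spanned_res (U V : opens M) (s : V `<=` U) D h :
  spanned D h -> spanned (mres s D) (mres s h).
Proof.
move=> [J [a [Z [hZ -> ->]]]].
exists J, (fun j => ares s (a j)), (fun j => mres s (Z j)); split.
- by move=> j; exact: principal_res.
- by rewrite mres_sum; apply: eq_bigr => j _; rewrite mresZ.
- by rewrite mres_sum; apply: eq_bigr => j _; rewrite mresZ symb_res.
Qed.

Lemma spannedD V (D D' : sDer O V) h h' :
  spanned D h -> spanned D' h' -> spanned (D + D') (h + h').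
Proof.
move=> [J [a [Z [hZ -> ->]]]] [J' [a' [Z' [hZ' -> ->]]]].
exists (J + J')%type,
  (fun j => match j with inl j => a j | inr j => a' j end),
  (fun j => match j with inl j => Z j | inr j => Z' j end).
by split; [case|rewrite big_sumType|rewrite big_sumType].
Qed.

Lemma spannedZ V (b : O V) (D : sDer O V) h : spanned D h -> spanned (b *: D) (b *: h).
Proof.
move=> [J [a [Z [hZ -> ->]]]]; exists J, (fun j => b * a j), Z.
by split=> //; rewrite scaler_sumr; apply: eq_bigr => j _; rewrite scalerA.
Qed.

Lemma spanned_principal V (Z : sDer O V) : principal Z -> spanned Z (symb H 0 Z).
Proof.
move=> hZ; exists unit, (fun=> 1), (fun=> Z); split=> //.
  by rewrite (big_pred1 tt) ?scale1r // => -[].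
by rewrite (big_pred1 tt) ?scale1r // => -[].
Qed.

Lemma spanned0 V : spanned (0 : sDer O V) 0.
Proof. by have := spanned_principal (principal0 V); rewrite symb0. Qed.

Lemma spanned_sum V (I : finType) (P : pred I) (D : I -> sDer O V) (h : I -> H V) :
  (forall i, P i -> spanned (D i) (h i)) ->
  spanned (\sum_(i | P i) D i) (\sum_(i | P i) h i).
Proof.
by move=> hD; apply: (big_ind2 (@spanned V)) => //;
  [exact: spanned0|move=> *; exact: spannedD].
Qed.

(** Parity projections preserve principal derivations and commute with [symb H 0]; hence the
    isomorphism will preserve parity. *)
Lemma spanned_mproj k V (D : sDer O V) h :
  spanned D h -> spanned (mproj (sDer O) k D) (mproj H k h).
Proof.
have mprojS (E : superMod O) (a : O V) (v : E V) : mproj E k (a *: v) =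
    sproj O false a *: mproj E k v + sproj O true a *: mproj E (~~ k) v.
  have hp l m : mproj E k (sproj O l a *: mproj E m v) =
      if k == addb l m then sproj O l a *: mproj E m v else 0.
    have hw : mproj E m (mproj E m v) = mproj E m v by rewrite mproj_proj eqxx.
    rewrite -{1}(mprojZ (spar_proj l a) hw) mproj_proj.
    by rewrite (mprojZ (spar_proj l a) hw).
  rewrite -[a in LHS](@oddeven _ _ _ _ O) -[v in LHS]mproj_sum.
  rewrite scalerDl !scalerDr !mprojD !hp.
  by case: (k); rewrite /= ?addr0 ?add0r.
have mproj0 (E : superMod O) : mproj E k 0 = 0 :> E V.
  by apply: (addrI (mproj E k 0)); rewrite -mprojD !addr0.
have mproj_symb l (Z : sDer O V) :
    mproj H l (symb H 0 Z) = symb H 0 (mproj (sDer O) l Z).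
  have hs m : mproj H m (symb H 0 (mproj (sDer O) m Z)) =
      symb H 0 (mproj (sDer O) m Z).
    have e : mproj (sDer O) m (mproj (sDer O) m Z) = mproj (sDer O) m Z.
      by rewrite mproj_proj eqxx.
    exact: (symb_par H (p := 0)).
  rewrite -[Z in LHS]mproj_sum symbD // mprojD -(hs false) -(hs true) !mproj_proj.
  by case: (l); rewrite /= ?addr0 ?add0r !hs.
move=> [J [a [Z [hZ -> ->]]]].
rewrite (big_morph _ (@mprojD _ _ _ (sDer O) k V) (mproj0 (sDer O))).
rewrite (big_morph _ (@mprojD _ _ _ H k V) (mproj0 H)).
apply: spanned_sum => j _; rewrite !mprojS !mproj_symb.
by apply: spannedD; apply: spannedZ; apply: spanned_principal;
  exact: principal_mproj.
Qed.

(** Arbitrary coefficients are expanded in monomials simultaneously in T and gr T, as classes of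
    principal derivations are F-linear. This reduces statements on [spanned] to the unique local
    form. *)
Lemma spanned_components U r (e : 'I_r -> G U) (eP : is_basis e) D h :
  spanned D h -> exists Z : {set 'I_r} -> sDer O U,
    [/\ forall I, principal (Z I), D = \sum_I mono O e (id U) I *: Z I &
        h = \sum_I mono O e (id U) I *: symb H 0 (Z I)].
Proof.
move=> [J [a [Z [hZ -> ->]]]].
exists (fun I => \sum_j al (coef eP (id U) (a j) I) *: Z j); split.
- by move=> I; apply: principal_sum => j _; exact: principalZ.
- under [RHS]eq_bigr do rewrite scaler_sumr.
  rewrite exchange_big; apply: eq_bigr => j _.
  rewrite {1}(coefP eP (id U) (a j)) scaler_suml; apply: eq_bigr => I _.
  by rewrite scalerA.
- under [RHS]eq_bigr do rewrite symb_sum // scaler_sumr.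
  rewrite exchange_big; apply: eq_bigr => j _.
  rewrite {1}(coefP eP (id U) (a j)) scaler_suml; apply: eq_bigr => I _.
  by rewrite symb_al // scalerA.
Qed.

(* The graph of the isomorphism T -> gr T that maps a Z to a symb_0(Z) for    *)
(* principal Z.                                                               *)
Definition split_rel U (D : sDer O U) (h : H U) :=
  locally_on (fun V (s : V `<=` U) => spanned (mres s D) (mres s h)).

Lemma split_components U (D : sDer O U) h : split_rel D h ->
  locally_on (fun V (s : V `<=` U) => exists (r : nat) (e : 'I_r -> G V),
    is_basis e /\ exists Z : {set 'I_r} -> sDer O V,
    [/\ forall I, principal (Z I), mres s D = \sum_I mono O e (id V) I *: Z I &
        mres s h = \sum_I mono O e (id V) I *: symb H 0 (Z I)]).
Proof.
move=> hD x Ux; have [V [s [Vx hV]]] := hD x Ux.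
have [W [t [Wx [r [e eP]]]]] := local_basis freeG Vx.
exists W, (subset_trans t s); split=> //; exists r, e; split=> //.
by apply: (spanned_components eP); rewrite -!(mres_comp s t); exact: spanned_res.
Qed.

Lemma split_rel_res (U V : opens M) (s : V `<=` U) D h :
  split_rel D h -> split_rel (mres s D) (mres s h).
Proof.
move=> hD x Vx; have [W [t [Wx hW]]] := hD x (s x Vx).
have l := sl V W; have r := sr V W.
exists (opensI V W), l; split=> //.
by rewrite !(mres_comp s l (subset_trans r t)) -!(mres_comp t r); exact: spanned_res.
Qed.

Lemma split_rel_loc U (D : sDer O U) h :
  locally_on (fun V (s : V `<=` U) => split_rel (mres s D) (mres s h)) ->
  split_rel D h.
Proof.
move=> hD x Ux; have [V [s [Vx hV]]] := hD x Ux.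
have [W [t [Wx hW]]] := hV x Vx; exists W, (subset_trans t s); split=> //.
by rewrite -!(mres_comp s t).
Qed.

Lemma spanned_split U (D : sDer O U) h : spanned D h -> split_rel D h.
Proof. by move=> hD; apply: locallyW; rewrite !mres_id. Qed.

Lemma split_relP U (a : O U) D D' h h' :
  split_rel D h -> split_rel D' h' -> split_rel (a *: D + D') (a *: h + h').
Proof.
move=> hD hD' x Ux; have [V [s [Vx hV]]] := hD x Ux.
have [W [t [Wx hW]]] := hD' x Ux.
have l := sl V W; have r := sr V W; have q := subset_trans l s.
exists (opensI V W), q; split=> //; rewrite !mresP; apply: spannedD.
  by apply: spannedZ; rewrite -!(mres_comp s l); exact: spanned_res.
by rewrite -!(mres_comp t r); exact: spanned_res.
Qed.

Lemma split_rel_inj U (D : sDer O U) : split_rel D 0 -> D = 0.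
Proof.
move=> /split_components hD; apply: msep => x Ux.
have [V [s [Vx [r [e [eP [Z [hZ eD e0]]]]]]]] := hD x Ux.
exists V, s; split=> //; rewrite mres0 in e0.
rewrite eD mres0 big1 // => I _.
by rewrite (symb_free eP hZ (esym e0)) scaler0.
Qed.

Lemma split_rel_fun U (h : H U) : split_rel 0 h -> h = 0.
Proof.
move=> /split_components hD; apply: msep => x Ux.
have [V [s [Vx [r [e [eP [Z [hZ e0 eh]]]]]]]] := hD x Ux.
exists V, s; split=> //; rewrite mres0 in e0.
rewrite eh mres0 big1 // => I _.
have hf : filt #|I|.+1 (\sum_I mono O e (id V) I *: Z I).
  by rewrite -e0; exact: filt0.
by rewrite (filt_components eP hZ hf) // symb0 scaler0.
Qed.

Lemma split_relB U (D D' : sDer O U) h h' :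
  split_rel D h -> split_rel D' h' -> split_rel (D - D') (h - h').
Proof.
move=> hD hD'; have := split_relP (-1) hD' hD.
by rewrite !scaleN1r ![- _ + _]addrC.
Qed.

(** A local image is given by [principal_expansion]; by [split_rel_fun] it is unique, so the local
    images glue. *)
Lemma split_rel_total U (D : sDer O U) : exists h : H U, split_rel D h.
Proof.
have ex : locally_on (fun V (s : V `<=` U) => exists h, split_rel (mres s D) h).
  move=> x Ux; have [V [s [Vx [r [e eP]]]]] := local_basis freeG Ux.
  exists V, s; split=> //; have [Z [hZ ->]] := principal_expansion eP (mres s D).
  exists (\sum_I mono O e (id V) I *: symb H 0 (Z I)); apply: spanned_split.
  by apply: spanned_sum => I _; apply: spannedZ; exact: spanned_principal.
have [||h hh] := glue_unique (@msheaf _ _ _ H) _ _ ex.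
- move=> V V' s t s' h hh; rewrite -(mres_comp s t s'); exact: split_rel_res.
- move=> V s h h' hh hh'; apply/eqP; rewrite -subr_eq0; apply/eqP.
  by apply: split_rel_fun; rewrite -(subrr (mres s D)); exact: split_relB.
exists h; apply: split_rel_loc => x Ux; have [V [s [Vx [h' hh']]]] := ex x Ux.
by exists V, s; split=> //; rewrite (hh V s h').
Qed.

(** gr T is locally spanned by symbols, and [symb_components] writes each of them through classes of
    principal derivations. Injectivity makes the local preimages glue. *)
Lemma split_rel_onto U (h : H U) : exists D : sDer O U, split_rel D h.
Proof.
have ex : locally_on (fun V (s : V `<=` U) => exists D, split_rel D (mres s h)).
  move=> x Ux; have [V [s [Vx [m [v [fv eh]]]]]] := symb_span h Ux.
  have [W [t [Wx [r [e eP]]]]] := local_basis freeG Vx.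
  exists W, (subset_trans t s); split=> //.
  have ev p : exists D, spanned D (symb H p (mres t (v p))).
    have [Z [hZ eZ]] := principal_expansion eP (mres t (v p)).
    exists (\sum_(I : {set 'I_r} | #|I| == p) mono O e (id W) I *: Z I).
    rewrite eZ symb_components // -?eZ; last exact: filt_res.
    by apply: spanned_sum => I _; apply: spannedZ; exact: spanned_principal.
  exists (\sum_(p < m) sval (cid (ev p))); apply: spanned_split.
  rewrite -(mres_comp s t) eh mres_sum; apply: spanned_sum => p _.
  by rewrite -symb_res //; case: cid.
have [||D hD] := glue_unique (@msheaf _ _ _ (sDer O)) _ _ ex.
- move=> V V' s t s' D hD; rewrite -(mres_comp s t s'); exact: split_rel_res.
- move=> V s D D' hD hD'; apply/eqP; rewrite -subr_eq0; apply/eqP.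
  by apply: split_rel_inj; rewrite -(subrr (mres s h)); exact: split_relB.
exists D; apply: split_rel_loc => x Ux; have [V [s [Vx [D' hD']]]] := ex x Ux.
by exists V, s; split=> //; rewrite (hD V s D').
Qed.

(** The symbol accounts for the terms with |I| = p; the shorter ones vanish and the longer ones lie
    in J^(p+1) gr T. So the isomorphism induces the identity on gr T. *)
Lemma split_rel_symb U p (D : sDer O U) h : filt p D -> split_rel D h ->
  filt p.+1 (h - symb H p D).
Proof.
move=> hp /split_components hD; apply: filt_loc => x Ux.
have [V [s [Vx [r [e [eP [Z [hZ eD eh]]]]]]]] := hD x Ux.
exists V, s; split=> //; have := filt_res s hp; rewrite eD => hp'.
rewrite mresD mresN -symb_res // eD eh symb_components //.
rewrite (bigID (fun I : {set 'I_r} => #|I| == p)) /= addrAC subrr add0r.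
by apply: filt_high => I Ip; rewrite (filt_components eP hZ hp') ?symb0.
Qed.

(** A single global trivialization over the cover by M alone has the trivial cocycle, and the
    identity serves as graded automorphism. *)
Lemma connection_unit : corresponds_to H (H1_unit H).
Proof.
pose phi U D : H U := sval (cid (split_rel_total D)).
have phiP U D : split_rel D (phi U D) by rewrite /phi; case: cid.
have phiE U (D : sDer O U) h : split_rel D h -> phi U D = h.
  move=> hD; apply/eqP; rewrite -subr_eq0; apply/eqP.
  by apply: split_rel_fun; rewrite -(subrr D); exact: split_relB.
exists (cocycle1 H), (fun _ => phi), (fun V h => h); split=> //.
- move=> i; split; last by move=> V _ p v fv; exact: split_rel_symb.
  split=> [V _ a v w|V _ k v hv|V V' s _ v|V _].
  + by apply: phiE; exact: split_relP.
  + apply/esym/phiE => x Vx.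
    have [W [s [Wx hW]]] := phiP V v x Vx; exists W, s; split=> //.
    have := spanned_mproj k hW.
    by rewrite !mproj_res hv.
  + by apply: phiE; exact: split_rel_res.
  + pose psi h := sval (cid (split_rel_onto (h : H V))).
    have psiP h : split_rel (psi h) h by rewrite /psi; case: cid.
    exists psi => [D|h]; last by apply: phiE.
    apply/eqP; rewrite -subr_eq0; apply/eqP; apply: split_rel_inj.
    by rewrite -(subrr (phi V D)); apply: split_relB.
- by have [] := is_aut1_id H (opensT M).
Qed.

End SplitTangent.

Theorem theorem6 (R : realType) (M : topologicalType) (n : nat)
  (F : comAlgSheaf (complex R) M) (manF : complex_manifold n F)
  (G : modSheaf F) (freeG : locally_free G)
  (O : extAlg G) (grT : retract (sDer O)) :
  (corresponds_to grT (H1_unit grT) <-> exact_sequence_splits O) /\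
  (exact_sequence_splits O <-> has_connection G).
Proof.
have two_three : exact_sequence_splits O <-> has_connection G.
  split; first exact: splits_connection.
  by move=> [nabla nablaP]; exact: (nabla_splits O freeG nablaP).
split=> //; rewrite two_three; split; first exact: (unit_connection freeG).
by move=> [nabla nablaP]; exact: (connection_unit freeG grT nablaP).
Qed.
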